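(* Consider the plane-wave cold plasma problem described in the context: the unknown fields satisfy the differential equations (a)–(d) listed there together with the stated initial/asymptotic conditions, and $n_h(0,z)=0$ for $z<0$, so that for $x^0\le 0$ the electromagnetic wave is free, $\boldsymbol{A}^\perp(x^0,z)=\boldsymbol{\alpha}^\perp(x^0-z)$ with $\boldsymbol{\alpha}^\perp(\xi)=0$ for $\xi\le0$. Put $s_h:=\gamma_h-u_h^z$ (which is positive), $\varepsilon_h^z:=\frac{-q_hE^z}{m_hc^2}$, $\partial_-:=\frac12(\partial_0+\partial_z)$. Make use of the following formulae: - transverse momenta: $\boldsymbol{u}_h^\perp=\frac{-q_h}{m_hc^2}\boldsymbol{A}^\perp$; - densities: $n_h(x^0,z)=\widetilde{n_{h0}}[Z_h(x^0,z)]\,\partial_zZ_h(x^0,z)$; - longitudinal electric field: $E^z(x^0,z)=4\pi\sum_{h=1}^kq_h\widetilde N_h[Z_h(x^0,z)]$, where $\widetilde N_h(Z):=\int_{\bar Z}^Z\widetilde{n_{h0}}(Z')\,dZ'$ with any $\bar Z\in\mathbb{R}$; - recovery of the other kinematic variables from $s_h,\boldsymbol{u}_h^\perp$: $$\gamma_h=\frac{1+\boldsymbol{u}_h^{\perp2}+s_h^2}{2s_h},\quad u_h^z=\frac{1+\boldsymbol{u}_h^{\perp2}-s_h^2}{2s_h},\quad \boldsymbol{\beta}_h^\perp=\frac{\boldsymbol{u}_h^\perp}{\gamma_h}=\frac{2s_h\boldsymbol{u}_h^\perp}{1+\boldsymbol{u}_h^{\perp2}+s_h^2},\quad \beta_h^z=\frac{u_h^z}{\gamma_h}=\frac{1+\boldsymbol{u}_h^{\perp2}-s_h^2}{1+\boldsymbol{u}_h^{\perp2}+s_h^2}.$$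 Then the determination of the evolution of the system (for $x^0\ge0$) is reduced to solving the following system of integral equations in the unknowns $\boldsymbol{A}^\perp,s_h,z_h$ ($h=1,\dots,k$): $$\boldsymbol{A}^\perp(x^0,z)-\boldsymbol{\alpha}^\perp(x^0-z)=\int_0^{x^0}\!dx^{0\prime}\int_{x^{0\prime}-x^0+z}^{x^0-x^{0\prime}+z}\!dz'\Big[2\pi\sum_{j=1}^kq_jn_j\boldsymbol{\beta}_j^\perp\Big](x^{0\prime},z'),$$ $$\tilde s_h(x^0,Z)=\exp\Big[\int_0^{x^0}\!dx^{0\prime}\,\frac{\tilde\varepsilon_h^z}{\tilde\gamma_h}(x^{0\prime},Z)\Big]+\int_0^{x^0}\!dx^{0\prime}\,\exp\Big[\int_{x^{0\prime}}^{x^0}\!dx^{0\prime\prime}\,\frac{\tilde\varepsilon_h^z}{\tilde\gamma_h}(x^{0\prime\prime},Z)\Big]\Big[\frac{\widetilde{\partial_-\boldsymbol{u}_h^{\perp2}}}{\tilde\gamma_h}\Big](x^{0\prime},Z),$$ $$z_h(x^0,Z)=Z+\int_0^{x^0}\!dx^{0\prime}\,\beta_h^z[x^{0\prime},z_h(x^{0\prime},Z)].$$ Once this system is solved, the transverse motions are known as well, from $$\boldsymbol{x}_h^\perp(x^0,\boldsymbol{X})=\boldsymbol{X}^\perp+\int_0^{x^0}\!dx^{0\prime}\,\boldsymbol{\beta}_h^\perp[x^{0\prime},z_h(x^{0\prime},Z)],$$ whose right-hand side is then a known function.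
   Context: Setting (CGS units): a collisionless cold plasma of $k\ge2$ species of charged particles with rest masses $m_h$ and charges $q_h$, $h=1,\dots,k$; $c$ is the speed of light, $x^0=ct$, $z=x^3$, $\partial_0=\partial/\partial x^0$, and $\perp$ denotes the $x,y$ components. All fields depend only on $(x^0,z)$ (plane-wave Ansatz). $A^\mu$ is the electromagnetic potential, $\boldsymbol{A}^\perp$ its transverse part, $E^z$ the longitudinal electric field, $n_h$ the number density of the $h$-th fluid, $\boldsymbol{\beta}_h$ its velocity divided by $c$, $\gamma_h=1/\sqrt{1-\boldsymbol{\beta}_h^2}$, $\boldsymbol{u}_h=\gamma_h\boldsymbol{\beta}_h$, so $\gamma_h=\sqrt{1+\boldsymbol{u}_h^2}$. $\boldsymbol{x}_h(x^0,\boldsymbol{X})$ is the position at time $x^0$ of the element of the $h$-th fluid initially located at $\boldsymbol{X}$ (with $Z:=X^3$), $z_h(x^0,Z)$ its longitudinal component, assumed strictly increasing in $Z$ for each $x^0$, and $Z_h(x^0,\cdot)$ the inverse of $z_h(x^0,\cdot)$. For an observable $f_h(x^0,z)$, $\tilde f_h(x^0,Z):=f_h[x^0,z_h(x^0,Z)]$ is its Lagrangian counterpart; $\frac{d}{dx^0}=\partial_0+\beta_h^z\partial_z$ is the material derivative of the $h$-th fluid. Equations of the problem: (a) Maxwell: $\partial_zE^z=4\pi\sum_hq_hn_h$, $\ \partial_0E^z=-4\pi\sum_hq_hn_h\beta_h^z$, $\ (\partial_0^2-\partial_z^2)\boldsymbol{A}^\perp-4\pi\sum_hq_hn_h\boldsymbol{\beta}_h^\perp=0$.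 (b) Lorentz: $\frac{d}{dx^0}(m_hc^2\boldsymbol{u}_h^\perp+q_h\boldsymbol{A}^\perp)=0$, $\ \frac{d\gamma_h}{dx^0}-\frac{q_hu_h^zE^z}{m_hc^2\gamma_h}-\frac{q_h^2\partial_0(\boldsymbol{A}^\perp)^2}{2\gamma_hm_h^2c^4}=0$, $\ \frac{du_h^z}{dx^0}-\frac{q_hE^z}{m_hc^2}+\frac{q_h^2\partial_z(\boldsymbol{A}^\perp)^2}{2\gamma_hm_h^2c^4}=0$. (c) Conservation of particle number: $\tilde n_h(x^0,Z)\,\partial_Zz_h(x^0,Z)=\widetilde{n_{h0}}(Z)$. (d) $\partial_0\boldsymbol{x}_h(x^0,\boldsymbol{X})=\boldsymbol{\beta}_h[x^0,\boldsymbol{x}_h(x^0,\boldsymbol{X})]$. Initial/asymptotic conditions: for $x^0\le z$ one has $A^\mu=0$, $\boldsymbol{u}_h=\boldsymbol{0}$ and $n_h(x^0,z)=\widetilde{n_{h0}}(z)$, where the given initial densities satisfy the neutrality condition $\sum_hq_h\widetilde{n_{h0}}\equiv0$ (so that $\sum_hq_h\widetilde N_h\equiv0$). With $n_h(0,z)=0$ for $z<0$, time $x^0=0$ is taken as initial time: $\widetilde{n_{h0}}(Z)=n_h(0,Z)$, $\boldsymbol{x}_h(0,\boldsymbol{X})=\boldsymbol{X}$, $\tilde s_h(0,Z)=1$, and $\boldsymbol{A}^\perp(x^0,z)=\boldsymbol{\alpha}^\perp(x^0-z)$ for $x^0\le0$. *)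

(* Defs.v *)
(* Classical reals of the standard library, with Coquelicot. *)
From Stdlib Require Import Reals.
From Coquelicot Require Import Coquelicot.
Open Scope R_scope.

(* Fields of the plane-wave problem are functions f : R -> R -> R of (x0, z)
   with x0 = c t (or of (x0, Z) for Lagrangian functions). *)

Definition d_0 (f : R -> R -> R) (x0 z : R) : R := Derive (fun t => f t z) x0.
Definition d_z (f : R -> R -> R) (x0 z : R) : R := Derive (fun y => f x0 y) z.
Definition d_minus (f : R -> R -> R) (x0 z : R) : R :=
  / 2 * (d_0 f x0 z + d_z f x0 z).

Definition C0 (f : R -> R -> R) : Prop :=
  forall x0 z, continuity_2d_pt f x0 z.

Definition C1 (f : R -> R -> R) : Prop :=
  (forall x0 z, ex_derive (fun t => f t z) x0) /\
  (forall x0 z, ex_derive (fun y => f x0 y) z) /\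
  C0 (d_0 f) /\ C0 (d_z f).

Definition C2 (f : R -> R -> R) : Prop :=
  C1 f /\ C1 (d_0 f) /\ C1 (d_z f).

(* C1 on the closed half-plane x0 >= 0, up to the boundary; the values at
   x0 < 0 are irrelevant. *)
Definition C1_future (f : R -> R -> R) : Prop :=
  exists g, C1 g /\ forall x0 z, 0 <= x0 -> f x0 z = g x0 z.

(* Lagrangian counterpart of the Eulerian f along the motion zl. *)
Definition tilde (zl f : R -> R -> R) (x0 Z : R) : R := f x0 (zl x0 Z).

(* Transverse vectors are functions on Perp. *)
Inductive Perp : Set := px | py.

Definition sqnorm (v : Perp -> R -> R -> R) (x0 z : R) : R :=
  v px x0 z ^ 2 + v py x0 z ^ 2.

(* Species are the indices 1 <= h <= k. *)
Record plasma_data : Type := {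
  k : nat;
  m : nat -> R;
  q : nat -> R;
  c : R;
  n0 : nat -> R -> R;            (* \tilde n_{h0}(Z) *)
  alpha : Perp -> R -> R         (* the incoming wave alpha^perp(xi) *)
}.

Definition species (D : plasma_data) (h : nat) : Prop := (1 <= h <= k D)%nat.

Definition sum_species (D : plasma_data) (f : nat -> R) : R :=
  sum_n_m f 1 (k D).

Definition admissible (D : plasma_data) : Prop :=
  (2 <= k D)%nat /\ 0 < c D /\
  (forall h, species D h -> 0 < m D h) /\
  (forall h, species D h -> forall Z, continuous (n0 D h) Z) /\
  (forall h, species D h -> forall Z, Z < 0 -> n0 D h Z = 0) /\
  (forall Z, sum_species D (fun h => q D h * n0 D h Z) = 0) /\
  (forall i xi, xi <= 0 -> alpha D i xi = 0).

Record fields : Type := {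
  Ap : Perp -> R -> R -> R;          (* A^perp(x0, z) *)
  Ez : R -> R -> R;                  (* E^z(x0, z) *)
  n : nat -> R -> R -> R;            (* n_h(x0, z) *)
  betap : nat -> Perp -> R -> R -> R; (* beta_h^perp(x0, z) *)
  betaz : nat -> R -> R -> R;        (* beta_h^z(x0, z) *)
  zl : nat -> R -> R -> R;           (* z_h(x0, Z) *)
  Zl : nat -> R -> R -> R;           (* Z_h(x0, z) *)
  xp : nat -> Perp -> R -> (Perp -> R) -> R -> R
                                     (* x_h^perp(x0, X), X = (X^perp, Z) *)
}.

Definition gamma (F : fields) (h : nat) (x0 z : R) : R :=
  / sqrt (1 - (sqnorm (betap F h) x0 z + betaz F h x0 z ^ 2)).
Definition up (F : fields) (h : nat) (i : Perp) (x0 z : R) : R :=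
  gamma F h x0 z * betap F h i x0 z.
Definition uz (F : fields) (h : nat) (x0 z : R) : R :=
  gamma F h x0 z * betaz F h x0 z.
Definition s (F : fields) (h : nat) (x0 z : R) : R :=
  gamma F h x0 z - uz F h x0 z.

Definition material (F : fields) (h : nat) (f : R -> R -> R) (x0 z : R) : R :=
  d_0 f x0 z + betaz F h x0 z * d_z f x0 z.

Definition smooth (D : plasma_data) (F : fields) : Prop :=
  (forall i, C2 (Ap F i)) /\ C1 (Ez F) /\
  (forall h, species D h ->
     C0 (n F h) /\ (forall i, C1 (betap F h i)) /\ C1 (betaz F h) /\
     C1 (zl F h)).

Definition kinematics (D : plasma_data) (F : fields) : Prop :=
  forall h, species D h ->
    (forall x0 z, sqnorm (betap F h) x0 z + betaz F h x0 z ^ 2 < 1) /\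
    (forall x0 Z Z', Z < Z' -> zl F h x0 Z < zl F h x0 Z') /\
    (forall x0 Z, Zl F h x0 (zl F h x0 Z) = Z) /\
    (forall x0 z, zl F h x0 (Zl F h x0 z) = z).

Definition maxwell (D : plasma_data) (F : fields) : Prop :=
  forall x0 z,
    d_z (Ez F) x0 z
      = 4 * PI * sum_species D (fun h => q D h * n F h x0 z) /\
    d_0 (Ez F) x0 z
      = - (4 * PI * sum_species D
             (fun h => q D h * n F h x0 z * betaz F h x0 z)) /\
    forall i,
      (d_0 (d_0 (Ap F i)) x0 z - d_z (d_z (Ap F i)) x0 z)
      - 4 * PI * sum_species D
          (fun h => q D h * n F h x0 z * betap F h i x0 z) = 0.

Definition lorentz (D : plasma_data) (F : fields) : Prop :=
  forall h, species D h -> forall x0 z,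
    (forall i,
       material F h
         (fun t y => m D h * c D ^ 2 * up F h i t y + q D h * Ap F i t y)
         x0 z = 0) /\
    material F h (gamma F h) x0 z
      - q D h * uz F h x0 z * Ez F x0 z
          / (m D h * c D ^ 2 * gamma F h x0 z)
      - q D h ^ 2 * d_0 (sqnorm (Ap F)) x0 z
          / (2 * gamma F h x0 z * m D h ^ 2 * c D ^ 4) = 0 /\
    material F h (uz F h) x0 z
      - q D h * Ez F x0 z / (m D h * c D ^ 2)
      + q D h ^ 2 * d_z (sqnorm (Ap F)) x0 z
          / (2 * gamma F h x0 z * m D h ^ 2 * c D ^ 4) = 0.

Definition conservation (D : plasma_data) (F : fields) : Prop :=
  forall h, species D h -> forall x0 Z,
    tilde (zl F h) (n F h) x0 Z * d_z (zl F h) x0 Z = n0 D h Z.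

Definition motion (D : plasma_data) (F : fields) : Prop :=
  forall h, species D h ->
    (forall x0 Z,
       is_derive (fun t => zl F h t Z) x0 (betaz F h x0 (zl F h x0 Z))) /\
    (forall i x0 X Z,
       is_derive (fun t => xp F h i t X Z) x0
         (betap F h i x0 (zl F h x0 Z))).

(* The vanishing of A^0 and A^z for x0 <= z enters the equations only through
   E^z = - d_z A^0 - d_0 A^z = 0. *)
Definition asymptotics (D : plasma_data) (F : fields) : Prop :=
  forall x0 z, x0 <= z ->
    (forall i, Ap F i x0 z = 0) /\ Ez F x0 z = 0 /\
    forall h, species D h ->
      (forall i, up F h i x0 z = 0) /\ uz F h x0 z = 0 /\
      n F h x0 z = n0 D h z.

Definition initial (D : plasma_data) (F : fields) : Prop :=
  (forall i x0 z, x0 <= 0 -> Ap F i x0 z = alpha D i (x0 - z)) /\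
  forall h, species D h ->
    (forall Z, n F h 0 Z = n0 D h Z) /\
    (forall Z, zl F h 0 Z = Z) /\
    (forall i X Z, xp F h i 0 X Z = X i) /\
    (forall Z, tilde (zl F h) (s F h) 0 Z = 1).

(* The equations hold on the whole (x0, z)-plane, so that the wave-free past
   of every fluid element is part of the problem. *)
Definition plasma_solution (D : plasma_data) (F : fields) : Prop :=
  smooth D F /\ kinematics D F /\ maxwell D F /\ lorentz D F /\
  conservation D F /\ motion D F /\ asymptotics D F /\ initial D F.

(* The genuine unknowns are uA, us, uzl; uZl is the inverse of uzl in its last
   argument (see unknowns_class). *)
Record unknowns : Type := {
  uA : Perp -> R -> R -> R;          (* A^perp(x0, z) *)
  us : nat -> R -> R -> R;           (* s_h(x0, z) *)
  uzl : nat -> R -> R -> R;          (* z_h(x0, Z) *)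
  uZl : nat -> R -> R -> R           (* Z_h(x0, z) *)
}.

Definition unknowns_of (F : fields) : unknowns :=
  {| uA := Ap F; us := s F; uzl := zl F; uZl := Zl F |}.

Definition rec_up (D : plasma_data) (U : unknowns) (h : nat) (i : Perp)
    (x0 z : R) : R :=
  - q D h / (m D h * c D ^ 2) * uA U i x0 z.

Definition rec_up2 (D : plasma_data) (U : unknowns) (h : nat) : R -> R -> R :=
  sqnorm (rec_up D U h).

Definition rec_n (D : plasma_data) (U : unknowns) (h : nat) (x0 z : R) : R :=
  n0 D h (uZl U h x0 z) * d_z (uZl U h) x0 z.

(* \tilde N_h, with base point Zbar *)
Definition Ncum (D : plasma_data) (Zbar : R) (h : nat) (Z : R) : R :=
  RInt (n0 D h) Zbar Z.

Definition rec_Ez (D : plasma_data) (Zbar : R) (U : unknowns) (x0 z : R) : R :=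
  4 * PI * sum_species D (fun h => q D h * Ncum D Zbar h (uZl U h x0 z)).

Definition rec_gamma (D : plasma_data) (U : unknowns) (h : nat)
    (x0 z : R) : R :=
  (1 + rec_up2 D U h x0 z + us U h x0 z ^ 2) / (2 * us U h x0 z).

Definition rec_uz (D : plasma_data) (U : unknowns) (h : nat) (x0 z : R) : R :=
  (1 + rec_up2 D U h x0 z - us U h x0 z ^ 2) / (2 * us U h x0 z).

Definition rec_betap (D : plasma_data) (U : unknowns) (h : nat) (i : Perp)
    (x0 z : R) : R :=
  2 * us U h x0 z * rec_up D U h i x0 z
  / (1 + rec_up2 D U h x0 z + us U h x0 z ^ 2).

Definition rec_betaz (D : plasma_data) (U : unknowns) (h : nat)
    (x0 z : R) : R :=
  (1 + rec_up2 D U h x0 z - us U h x0 z ^ 2)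
  / (1 + rec_up2 D U h x0 z + us U h x0 z ^ 2).

Definition eps (D : plasma_data) (Zbar : R) (U : unknowns) (h : nat)
    (x0 z : R) : R :=
  - q D h * rec_Ez D Zbar U x0 z / (m D h * c D ^ 2).

Definition wave_eq (D : plasma_data) (U : unknowns) : Prop :=
  forall i x0 z, 0 <= x0 ->
    uA U i x0 z - alpha D i (x0 - z)
    = RInt (fun t =>
        RInt (fun y =>
          2 * PI * sum_species D
            (fun j => q D j * rec_n D U j t y * rec_betap D U j i t y))
          (t - x0 + z) (x0 - t + z))
        0 x0.

Definition growth (D : plasma_data) (Zbar : R) (U : unknowns) (h : nat)
    (x0 Z : R) : R :=
  tilde (uzl U h) (eps D Zbar U h) x0 Z
  / tilde (uzl U h) (rec_gamma D U h) x0 Z.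

Definition s_eq (D : plasma_data) (Zbar : R) (U : unknowns) : Prop :=
  forall h, species D h -> forall x0 Z, 0 <= x0 ->
    tilde (uzl U h) (us U h) x0 Z
    = exp (RInt (fun t => growth D Zbar U h t Z) 0 x0)
      + RInt (fun t =>
          exp (RInt (fun t' => growth D Zbar U h t' Z) t x0)
          * (tilde (uzl U h) (d_minus (rec_up2 D U h)) t Z
             / tilde (uzl U h) (rec_gamma D U h) t Z))
          0 x0.

Definition z_eq (D : plasma_data) (U : unknowns) : Prop :=
  forall h, species D h -> forall x0 Z, 0 <= x0 ->
    uzl U h x0 Z
    = Z + RInt (fun t => rec_betaz D U h t (uzl U h t Z)) 0 x0.

(* s_h, z_h, Z_h are only constrained at x0 >= 0; A^perp is the given free
   wave at x0 <= 0. *)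
Definition unknowns_class (D : plasma_data) (U : unknowns) : Prop :=
  (forall i, C2 (uA U i)) /\
  (forall i x0 z, x0 <= 0 -> uA U i x0 z = alpha D i (x0 - z)) /\
  forall h, species D h ->
    C1_future (us U h) /\ C1_future (uzl U h) /\
    forall x0, 0 <= x0 ->
      (forall z, 0 < us U h x0 z) /\
      (forall Z Z', Z < Z' -> uzl U h x0 Z < uzl U h x0 Z') /\
      (forall Z, uZl U h x0 (uzl U h x0 Z) = Z) /\
      (forall z, uzl U h x0 (uZl U h x0 z) = z).

Definition integral_solution (D : plasma_data) (Zbar : R) (U : unknowns)
  : Prop :=
  unknowns_class D U /\ wave_eq D U /\ s_eq D Zbar U /\ z_eq D U.

(* At time x0, the fields F are those determined by the unknowns U. *)
Definition recovered_at (D : plasma_data) (Zbar : R) (U : unknowns)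
    (F : fields) (x0 : R) : Prop :=
  (forall i z, Ap F i x0 z = uA U i x0 z) /\
  (forall z, Ez F x0 z = rec_Ez D Zbar U x0 z) /\
  forall h, species D h ->
    (forall z,
       s F h x0 z = us U h x0 z /\ 0 < s F h x0 z /\
       zl F h x0 z = uzl U h x0 z /\ Zl F h x0 z = uZl U h x0 z /\
       (forall i, up F h i x0 z = rec_up D U h i x0 z) /\
       n F h x0 z = rec_n D U h x0 z /\
       gamma F h x0 z = rec_gamma D U h x0 z /\
       uz F h x0 z = rec_uz D U h x0 z /\
       (forall i, betap F h i x0 z = rec_betap D U h i x0 z) /\
       betaz F h x0 z = rec_betaz D U h x0 z) /\
    (forall i X Z,
       xp F h i x0 X Z
       = X i + RInt (fun t => rec_betap D U h i t (uzl U h t Z)) 0 x0).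

(* Main.v *)
Require Import Defs.
From Stdlib Require Import Reals Lra Lia FunctionalExtensionality.
From Coquelicot Require Import Coquelicot.
(* [Reals] also exports a constant [C1]. *)
Import Defs.
Open Scope R_scope.

(** From the differential to the integral equations. Each unknown solves an
    equation that integrates along characteristics: [A^perp] by d'Alembert's
    formula, [s_h] (linear first order along the trajectories) by Duhamel's
    formula, [z_h] directly. The Jacobian of [z_h] is an exponential, hence
    positive, which gives the densities; [E^z] and its recovered expression have
    the same [z]-derivative and both vanish ahead of the light front. The
    transverse canonical momentum is constant along trajectories and vanishes
    ahead of the front; every trajectory, also one with [Z < 0], lies there in
    the remote past, since in the free wave [t - z_h] decreases backwards at a
    rate bounded away from zero.

    Conversely, a solution of the integral equations on [x0 >= 0] is continued
    to [x0 < 0] by the explicit motion in the free wave, [s_h = 1] and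
    [z_h = x0 - phase^{-1} (x0 + phase (- Z))]; the two pieces match to first
    order at [x0 = 0]. Differentiating the integral equations yields the
    differential ones. What remains is that nothing happens ahead of the front
    [x0 <= z], and this follows from two Gronwall estimates on backward light
    cones: one for [A^perp], whose wave equation is linear in [A^perp] once the
    densities and the [s_h] are given, and one for [E^z] jointly with
    [s_h - 1]. *)

(** * Functions of two variables *)

(** The unknowns [s_h] and [z_h] are C1 only up to the boundary of the future, while the plasma
    equations are required on the whole plane. The past must therefore be built and joined in a C1
    way. The joint works because [E^z] and the wave's drive on [s_h] both vanish at [x0 = 0], so
    that [s_h] leaves the value [1] with zero slope. The densities are merely continuous, so the
    retarded integral cannot be differentiated twice. The wave operator is factored into its two
    characteristic derivatives, each applied once to something differentiable. Likewise the Jacobian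
    of the flow is read off the differentiated integral equation instead of a mixed second
    derivative. The order of the two cone estimates is forced. Once [A^perp] vanishes, the equation
    for [s_h] loses its inhomogeneous term and [beta_h^z] becomes a bounded multiple of [s_h - 1].
    Only then do [E^z], the time integral of the current, and [s_h - 1], the integral of [E^z] along
    trajectories, form a closed homogeneous system. Neutrality fixes the constant in [E^z]: the
    field vanishes wherever all fluids share the same [Z]. *)

Lemma C0_filterlim f x z : C0 f ->
  filterlim (fun p : R * R => f (fst p) (snd p)) (locally (x, z))
    (locally (f x z)).
Proof. intros Hf. now apply continuity_2d_pt_filterlim. Qed.

Lemma C0_slice f a b x : C0 f -> continuous a x -> continuous b x ->
  continuous (fun t : R => f (a t) (b t)) x.
Proof.
intros Hf Ha Hb.
apply (continuous_comp_2 a b f x Ha Hb).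
apply C0_filterlim, Hf.
Qed.

Lemma C0_slice1 f z x : C0 f -> continuous (fun t => f t z) x.
Proof.
intros Hf; apply (C0_slice f (fun t => t) (fun _ => z) x Hf);
  [apply continuous_id | apply continuous_const].
Qed.

Lemma C0_slice2 f z x : C0 f -> continuous (f z) x.
Proof.
intros Hf; apply (C0_slice f (fun _ => z) (fun t => t) x Hf);
  [apply continuous_const | apply continuous_id].
Qed.

Lemma C0_comp f a b : C0 f -> C0 a -> C0 b -> C0 (fun x z => f (a x z) (b x z)).
Proof.
intros Hf Ha Hb x z; apply continuity_2d_pt_filterlim.
apply (continuous_comp_2 (fun p : R * R => a (fst p) (snd p))
         (fun p => b (fst p) (snd p)) f (x, z)); simpl.
- apply (C0_filterlim a x z Ha).
- apply (C0_filterlim b x z Hb).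
- apply C0_filterlim, Hf.
Qed.

Lemma C0_ext f g : (forall x z, f x z = g x z) -> C0 f -> C0 g.
Proof. intros E Hf x z; apply (continuity_2d_pt_ext f); [exact E | apply Hf]. Qed.

Lemma C0_const a : C0 (fun _ _ => a).
Proof. intros x z; apply continuity_2d_pt_const. Qed.

Lemma C0_fst : C0 (fun x _ => x).
Proof. intros x z; apply continuity_2d_pt_id1. Qed.

Lemma C0_snd : C0 (fun _ z => z).
Proof. intros x z; apply continuity_2d_pt_id2. Qed.

Lemma C0_plus f g : C0 f -> C0 g -> C0 (fun x z => f x z + g x z).
Proof. intros Hf Hg x z; now apply continuity_2d_pt_plus. Qed.

Lemma C0_minus f g : C0 f -> C0 g -> C0 (fun x z => f x z - g x z).
Proof. intros Hf Hg x z; now apply continuity_2d_pt_minus. Qed.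

Lemma C0_mult f g : C0 f -> C0 g -> C0 (fun x z => f x z * g x z).
Proof. intros Hf Hg x z; now apply continuity_2d_pt_mult. Qed.

Lemma C0_opp f : C0 f -> C0 (fun x z => - f x z).
Proof. intros Hf x z; now apply continuity_2d_pt_opp. Qed.

Lemma C0_inv f : (forall x z, f x z <> 0) -> C0 f -> C0 (fun x z => / f x z).
Proof. intros H Hf x z; now apply continuity_2d_pt_inv. Qed.

Lemma C0_div f g : (forall x z, g x z <> 0) -> C0 f -> C0 g ->
  C0 (fun x z => f x z / g x z).
Proof. intros H Hf Hg; apply C0_mult; [|apply C0_inv]; assumption. Qed.

Lemma C0_comp1 (phi : R -> R) f :
  (forall x z, continuous phi (f x z)) -> C0 f -> C0 (fun x z => phi (f x z)).
Proof.
intros H Hf x z; apply continuity_1d_2d_pt_comp; [|apply Hf].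
apply continuity_pt_filterlim, H.
Qed.

Lemma C0_pow2 f : C0 f -> C0 (fun x z => f x z ^ 2).
Proof.
intros Hf; apply (C0_ext (fun x z => f x z * f x z)); [intros; simpl; ring|].
now apply C0_mult.
Qed.

Lemma C0_Rabs f : C0 f -> C0 (fun x z => Rabs (f x z)).
Proof. apply C0_comp1; intros; apply continuous_Rabs. Qed.

Lemma C0_sum K (f : nat -> R -> R -> R) :
  (forall h, (1 <= h <= K)%nat -> C0 (f h)) ->
  C0 (fun x z => sum_n_m (fun h => f h x z) 1 K).
Proof.
induction K as [|K IH]; intros H.
- apply (C0_ext (fun _ _ => 0)); [|apply C0_const].
  intros; now rewrite sum_n_m_zero; [|lia].
- apply (C0_ext (fun x z => sum_n_m (fun h => f h x z) 1 K + f (S K) x z)).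
  + intros; now rewrite sum_n_Sm; [|lia].
  + apply C0_plus; [apply IH; intros; apply H; lia | apply H; lia].
Qed.

(** A form of [C1] that carries formulas for both derivatives, so that the rules of calculus chain
    without evaluating [Derive]. *)
Definition partials (f f0 fz : R -> R -> R) : Prop :=
  (forall x z, is_derive (fun t => f t z) x (f0 x z)) /\
  (forall x z, is_derive (fun y => f x y) z (fz x z)) /\ C0 f0 /\ C0 fz.

Lemma C1_partials f : C1 f -> partials f (d_0 f) (d_z f).
Proof.
intros (H1 & H2 & H3 & H4); split; [|split; [|split]]; try assumption;
  intros x z; now apply Derive_correct.
Qed.

Lemma partials_d_0 f f0 fz : partials f f0 fz -> forall x z, d_0 f x z = f0 x z.
Proof. intros (H1 & H2 & _) x z; apply is_derive_unique; auto. Qed.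

Lemma partials_d_z f f0 fz : partials f f0 fz -> forall x z, d_z f x z = fz x z.
Proof. intros (H1 & H2 & _) x z; apply is_derive_unique; auto. Qed.

Lemma partials_C1 f f0 fz : partials f f0 fz -> C1 f.
Proof.
intros H; pose proof (partials_d_0 _ _ _ H) as E0.
pose proof (partials_d_z _ _ _ H) as Ez; destruct H as (H1 & H2 & H3 & H4).
split; [|split; [|split]].
- intros x z; exists (f0 x z); apply H1.
- intros x z; exists (fz x z); apply H2.
- now apply (C0_ext f0).
- now apply (C0_ext fz).
Qed.

Lemma partials_ext f f0 fz g g0 gz : partials f f0 fz ->
  (forall x z, f x z = g x z) -> (forall x z, f0 x z = g0 x z) ->
  (forall x z, fz x z = gz x z) -> partials g g0 gz.
Proof.
intros (H1 & H2 & H3 & H4) E E0 Ez; split; [|split; [|split]].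
- intros x z; rewrite <- E0; apply (is_derive_ext (fun t => f t z)); auto.
- intros x z; rewrite <- Ez; apply (is_derive_ext (fun t => f x t)); auto.
- now apply (C0_ext f0).
- now apply (C0_ext fz).
Qed.

(** Continuity of one partial derivative together with existence of the other yields the total
    derivative, hence the chain rule along curves. *)
Lemma partials_differentiable f f0 fz x z : partials f f0 fz ->
  differentiable_pt_lim f x z (f0 x z) (fz x z).
Proof.
intros H.
rewrite <- (partials_d_z _ _ _ H), <- (partials_d_0 _ _ _ H).
destruct (partials_C1 _ _ _ H) as (H1 & H2 & H3 & H4).
apply filterdiff_differentiable_pt_lim.
apply (is_derive_filterdiff f x z (d_0 f) (d_z f x z)).
- apply filter_forall; intros p; apply Derive_correct, H1.
- apply Derive_correct, H2.
- apply (C0_filterlim (d_0 f) x z H3).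
Qed.

Lemma partials_C0 f f0 fz : partials f f0 fz -> C0 f.
Proof.
intros H x z; apply differentiable_continuity_pt.
exists (f0 x z), (fz x z); now apply partials_differentiable.
Qed.

Lemma C1_C0 f : C1 f -> C0 f.
Proof. intros H; eapply partials_C0, C1_partials, H. Qed.

Lemma partials_curve f f0 fz a b t a' b' : partials f f0 fz ->
  is_derive a t a' -> is_derive b t b' ->
  is_derive (fun r => f (a r) (b r)) t
    (f0 (a t) (b t) * a' + fz (a t) (b t) * b').
Proof.
intros H Ha Hb; apply is_derive_Reals.
apply derivable_pt_lim_comp_2d.
- now apply partials_differentiable.
- now apply is_derive_Reals.
- now apply is_derive_Reals.
Qed.

Lemma partials_const a : partials (fun _ _ => a) (fun _ _ => 0) (fun _ _ => 0).
Proof.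
split; [|split; [|split]]; try apply C0_const; intros; apply (is_derive_const a).
Qed.

Lemma partials_fst : partials (fun x _ => x) (fun _ _ => 1) (fun _ _ => 0).
Proof.
split; [|split; [|split]]; try apply C0_const; intros.
- apply (is_derive_id x).
- apply (is_derive_const x).
Qed.

Lemma partials_snd : partials (fun _ z => z) (fun _ _ => 0) (fun _ _ => 1).
Proof.
split; [|split; [|split]]; try apply C0_const; intros.
- apply (is_derive_const z).
- apply (is_derive_id z).
Qed.

Lemma partials_comp f f0 fz a a0 az b b0 bz : partials f f0 fz ->
  partials a a0 az -> partials b b0 bz ->
  partials (fun x z => f (a x z) (b x z))
    (fun x z => f0 (a x z) (b x z) * a0 x z + fz (a x z) (b x z) * b0 x z)
    (fun x z => f0 (a x z) (b x z) * az x z + fz (a x z) (b x z) * bz x z).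
Proof.
intros Hf Ha Hb.
pose proof (partials_C0 _ _ _ Ha); pose proof (partials_C0 _ _ _ Hb).
pose proof Hf as (_ & _ & Hf3 & Hf4).
destruct Ha as (Ha1 & Ha2 & Ha3 & Ha4).
destruct Hb as (Hb1 & Hb2 & Hb3 & Hb4).
split; [|split; [|split]].
- intros x z; apply (partials_curve f f0 fz (fun t => a t z) (fun t => b t z));
    auto.
- intros x z; apply (partials_curve f f0 fz (fun t => a x t) (fun t => b x t));
    auto.
- apply C0_plus; apply C0_mult; auto; apply C0_comp; auto.
- apply C0_plus; apply C0_mult; auto; apply C0_comp; auto.
Qed.

Lemma partials_comp1 (phi dphi : R -> R) f f0 fz : partials f f0 fz ->
  (forall x z, is_derive phi (f x z) (dphi (f x z))) ->
  (forall x z, continuous dphi (f x z)) ->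
  partials (fun x z => phi (f x z)) (fun x z => dphi (f x z) * f0 x z)
    (fun x z => dphi (f x z) * fz x z).
Proof.
intros Hf Hd Hc; pose proof (partials_C0 _ _ _ Hf).
destruct Hf as (H1 & H2 & H3 & H4).
split; [|split; [|split]].
- intros x z; rewrite Rmult_comm.
  apply (is_derive_comp phi (fun t => f t z)); auto.
- intros x z; rewrite Rmult_comm.
  apply (is_derive_comp phi (fun t => f x t)); auto.
- apply C0_mult; [apply C0_comp1|]; auto.
- apply C0_mult; [apply C0_comp1|]; auto.
Qed.

Lemma partials_plus f f0 fz g g0 gz : partials f f0 fz -> partials g g0 gz ->
  partials (fun x z => f x z + g x z) (fun x z => f0 x z + g0 x z)
    (fun x z => fz x z + gz x z).
Proof.
intros (H1 & H2 & H3 & H4) (K1 & K2 & K3 & K4); split; [|split; [|split]].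
- intros x z; apply (is_derive_plus (fun t => f t z) (fun t => g t z)); auto.
- intros x z; apply (is_derive_plus (fun t => f x t) (fun t => g x t)); auto.
- now apply C0_plus.
- now apply C0_plus.
Qed.

Lemma partials_mult f f0 fz g g0 gz : partials f f0 fz -> partials g g0 gz ->
  partials (fun x z => f x z * g x z)
    (fun x z => f0 x z * g x z + f x z * g0 x z)
    (fun x z => fz x z * g x z + f x z * gz x z).
Proof.
intros Hf Hg; pose proof (partials_C0 _ _ _ Hf); pose proof (partials_C0 _ _ _ Hg).
destruct Hf as (H1 & H2 & H3 & H4); destruct Hg as (K1 & K2 & K3 & K4).
split; [|split; [|split]].
- intros x z; apply (is_derive_mult (fun t => f t z) (fun t => g t z)); auto.
  intros; apply Rmult_comm.
- intros x z; apply (is_derive_mult (fun t => f x t) (fun t => g x t)); auto.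
  intros; apply Rmult_comm.
- apply C0_plus; apply C0_mult; auto.
- apply C0_plus; apply C0_mult; auto.
Qed.

Lemma partials_scal a f f0 fz : partials f f0 fz ->
  partials (fun x z => a * f x z) (fun x z => a * f0 x z) (fun x z => a * fz x z).
Proof.
intros Hf; eapply partials_ext;
  [apply (partials_mult _ _ _ _ _ _ (partials_const a) Hf) | | |];
  intros; simpl; ring.
Qed.

Lemma partials_minus f f0 fz g g0 gz : partials f f0 fz -> partials g g0 gz ->
  partials (fun x z => f x z - g x z) (fun x z => f0 x z - g0 x z)
    (fun x z => fz x z - gz x z).
Proof.
intros Hf Hg; eapply partials_ext;
  [apply (partials_plus _ _ _ _ _ _ Hf (partials_scal (-1) _ _ _ Hg)) | | |];
  intros; simpl; ring.
Qed.

Lemma partials_pow2 f f0 fz : partials f f0 fz ->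
  partials (fun x z => f x z ^ 2) (fun x z => 2 * f x z * f0 x z)
    (fun x z => 2 * f x z * fz x z).
Proof.
intros Hf; eapply partials_ext; [apply (partials_mult _ _ _ _ _ _ Hf Hf) | | |];
  intros; simpl; ring.
Qed.

Lemma partials_div f f0 fz g g0 gz : (forall x z, g x z <> 0) ->
  partials f f0 fz -> partials g g0 gz ->
  partials (fun x z => f x z / g x z)
    (fun x z => (f0 x z * g x z - f x z * g0 x z) / g x z ^ 2)
    (fun x z => (fz x z * g x z - f x z * gz x z) / g x z ^ 2).
Proof.
intros Hn Hf Hg.
assert (Hi : partials (fun x z => / g x z) (fun x z => - / g x z ^ 2 * g0 x z)
               (fun x z => - / g x z ^ 2 * gz x z)).
{ apply (partials_comp1 Rinv (fun y => - / y ^ 2) _ _ _ Hg); intros x z.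
  - replace (- / g x z ^ 2) with (- (1) / g x z ^ 2) by (field; auto).
    apply (is_derive_inv (fun y => y)); [apply (is_derive_id (g x z)) | auto].
  - apply (ex_derive_continuous (fun y => - / y ^ 2)).
    auto_derive; simpl; apply Rmult_integral_contrapositive; split; auto. }
eapply partials_ext; [apply (partials_mult _ _ _ _ _ _ Hf Hi) | | |];
  intros; simpl; try (field; auto).
Qed.

Lemma partials_sum K (f f0 fz : nat -> R -> R -> R) :
  (forall h, (1 <= h <= K)%nat -> partials (f h) (f0 h) (fz h)) ->
  partials (fun x z => sum_n_m (fun h => f h x z) 1 K)
    (fun x z => sum_n_m (fun h => f0 h x z) 1 K)
    (fun x z => sum_n_m (fun h => fz h x z) 1 K).
Proof.
induction K as [|K IH]; intros H.
- eapply partials_ext; [apply (partials_const 0) | | |];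
  intros; now rewrite sum_n_m_zero; [|lia].
- eapply partials_ext;
    [apply (partials_plus _ _ _ _ _ _ (IH (fun h Hh => H h ltac:(lia)))
       (H (S K) ltac:(lia))) | | |];
  intros; now rewrite sum_n_Sm; [|lia].
Qed.

(** * One-sided limits and gluing along the slice [x0 = 0] *)

Lemma continuous_eq_filter (F : (R -> Prop) -> Prop) (f g : R -> R) (a : R) :
  ProperFilter' F -> filter_le F (locally a) ->
  continuous f a -> continuous g a -> F (fun x => f x = g x) -> f a = g a.
Proof.
intros PF HF Hf Hg E.
apply (filterlim_locally_unique (F := F) f).
- exact (filterlim_filter_le_1 _ HF Hf).
- apply (filterlim_ext_loc (F := F) g).
  + revert E; apply filter_imp; congruence.
  + exact (filterlim_filter_le_1 _ HF Hg).
Qed.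

Lemma continuous_eq_right (f g : R -> R) (a : R) :
  continuous f a -> continuous g a ->
  (forall x, a < x -> f x = g x) -> f a = g a.
Proof.
intros Hf Hg E; apply (continuous_eq_filter (at_right a)); auto.
- apply Proper_StrongProper, at_right_proper_filter.
- intros P HP; now apply filter_le_within.
- apply (filter_forall (F := locally a)); auto.
Qed.

Lemma continuous_eq_left (f g : R -> R) (a : R) :
  continuous f a -> continuous g a ->
  (forall x, x < a -> f x = g x) -> f a = g a.
Proof.
intros Hf Hg E; apply (continuous_eq_filter (at_left a)); auto.
- apply Proper_StrongProper, at_left_proper_filter.
- intros P HP; now apply filter_le_within.
- apply (filter_forall (F := locally a)); auto.
Qed.

(** An integral equation on [0 <= x0] can be differentiated only where it holds on a neighbourhood,
    that is for [0 < x0]; the boundary is then reached by continuity. *)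
Lemma C0_eq_right f g : C0 f -> C0 g ->
  (forall x z, 0 < x -> f x z = g x z) -> forall x z, 0 <= x -> f x z = g x z.
Proof.
intros Hf Hg E x z [Hx|<-]; [auto|].
apply (continuous_eq_right (fun t => f t z) (fun t => g t z));
  try now apply C0_slice1.
intros; now apply E.
Qed.

Lemma is_derive_glue (f g : R -> R) a l : is_derive f a l -> is_derive g a l ->
  f a = g a -> is_derive (fun x => if Rle_dec a x then f x else g x) a l.
Proof.
intros Hf Hg E; apply is_derive_Reals in Hf, Hg; apply is_derive_Reals.
intros eps Heps; destruct (Hf eps Heps) as [d1 H1].
destruct (Hg eps Heps) as [d2 H2].
assert (Hd : 0 < Rmin d1 d2) by (apply Rmin_glb_lt; apply cond_pos).
exists (mkposreal _ Hd); intros h Hh0 Hh; simpl in Hh.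
destruct (Rle_dec a a) as [_|]; [|lra].
destruct (Rle_dec a (a + h)).
- apply H1; auto; eapply Rlt_le_trans; [apply Hh | apply Rmin_l].
- rewrite E; apply H2; auto; eapply Rlt_le_trans; [apply Hh | apply Rmin_r].
Qed.

Definition glue (f g : R -> R -> R) (x z : R) : R :=
  if Rle_dec 0 x then f x z else g x z.

Lemma glue_future f g x z : 0 <= x -> glue f g x z = f x z.
Proof. unfold glue; destruct (Rle_dec 0 x); lra. Qed.

Lemma glue_past f g x z : x < 0 -> glue f g x z = g x z.
Proof. unfold glue; destruct (Rle_dec 0 x); lra. Qed.

Lemma glue_past0 f g x z : (forall y, f 0 y = g 0 y) -> x <= 0 ->
  glue f g x z = g x z.
Proof.
intros E [H| ->]; [now apply glue_past|].
rewrite glue_future; [auto | lra].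
Qed.

Lemma locally_lt (a x : R) : a < x -> locally x (fun y => a < y).
Proof. intros H; apply (open_gt a x H). Qed.

Lemma locally_gt (a x : R) : x < a -> locally x (fun y => y < a).
Proof. intros H; apply (open_lt a x H). Qed.

Lemma C0_glue f g : C0 f -> C0 g -> (forall z, f 0 z = g 0 z) -> C0 (glue f g).
Proof.
intros Hf Hg E x z eps; destruct (Hf x z eps) as [d1 H1].
destruct (Hg x z eps) as [d2 H2].
destruct (Rtotal_order x 0) as [Hx|[->|Hx]].
- assert (Hd : 0 < Rmin d2 (- x)) by (apply Rmin_glb_lt; [apply cond_pos | lra]).
  exists (mkposreal _ Hd); intros u v Hu Hv; simpl in Hu, Hv.
  pose proof (Rmin_l d2 (- x)); pose proof (Rmin_r d2 (- x)).
  apply Rabs_def2 in Hu as Hu'.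
  rewrite !glue_past by lra; apply H2; lra.
- assert (Hd : 0 < Rmin d1 d2) by (apply Rmin_glb_lt; apply cond_pos).
  exists (mkposreal _ Hd); intros u v Hu Hv; simpl in Hu, Hv.
  pose proof (Rmin_l d1 d2); pose proof (Rmin_r d1 d2).
  rewrite (glue_future f g 0) by lra; unfold glue; destruct (Rle_dec 0 u).
  + apply H1; lra.
  + rewrite E; apply H2; lra.
- assert (Hd : 0 < Rmin d1 x) by (apply Rmin_glb_lt; [apply cond_pos | lra]).
  exists (mkposreal _ Hd); intros u v Hu Hv; simpl in Hu, Hv.
  pose proof (Rmin_l d1 x); pose proof (Rmin_r d1 x).
  apply Rabs_def2 in Hu as Hu'.
  rewrite !glue_future by lra; apply H1; lra.
Qed.

(** Only values and time derivatives have to match: agreement of the values along the whole line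
    [x = 0] already forces the [z]-derivatives to agree there. *)
Lemma partials_glue f f0 fz g g0 gz : partials f f0 fz -> partials g g0 gz ->
  (forall z, f 0 z = g 0 z) -> (forall z, f0 0 z = g0 0 z) ->
  partials (glue f g) (glue f0 g0) (glue fz gz).
Proof.
intros (H1 & H2 & H3 & H4) (K1 & K2 & K3 & K4) E E0.
assert (Ez : forall z, fz 0 z = gz 0 z).
{ intros z; rewrite <- (is_derive_unique _ _ _ (H2 0 z)).
  rewrite <- (is_derive_unique _ _ _ (K2 0 z)); now apply Derive_ext. }
split; [|split; [|split]]; try now apply C0_glue.
- intros x z; destruct (Rtotal_order x 0) as [Hx|[->|Hx]].
  + rewrite glue_past by auto; apply (is_derive_ext_loc (fun t => g t z)); auto.
    generalize (locally_gt 0 x Hx); apply filter_imp; intros y Hy.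
    now rewrite glue_past.
  + rewrite glue_future by lra.
    apply (is_derive_glue (fun t => f t z) (fun t => g t z)); auto.
    rewrite E0; auto.
  + rewrite glue_future by lra.
    apply (is_derive_ext_loc (fun t => f t z)); auto.
    generalize (locally_lt 0 x Hx); apply filter_imp; intros y Hy.
    now rewrite glue_future by lra.
- intros x z; unfold glue; destruct (Rle_dec 0 x); auto.
Qed.

(** * Implicit and inverse functions *)

Lemma is_derive_mult_vanishing (N c : R -> R) a N' : is_derive N a N' ->
  N a = 0 -> continuous c a -> is_derive (fun x => N x * c x) a (N' * c a).
Proof.
intros HN N0 Hc; apply is_derive_Reals in HN; apply is_derive_Reals.
intros eps Heps.
pose proof (Rabs_pos (c a)); pose proof (Rabs_pos N').
assert (He1 : 0 < eps / (2 * (Rabs (c a) + 1))) by (apply Rdiv_lt_0_compat; lra).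
assert (He2 : 0 < Rmin 1 (eps / (2 * (Rabs N' + 1)))).
{ apply Rmin_glb_lt; [lra | apply Rdiv_lt_0_compat; lra]. }
destruct (HN _ He1) as [d1 H1].
apply filterlim_locally with (eps := mkposreal _ He2) in Hc.
destruct Hc as [d2 H2].
assert (Hd : 0 < Rmin d1 d2) by (apply Rmin_glb_lt; apply cond_pos).
exists (mkposreal _ Hd); intros h Hh0 Hh; simpl in Hh.
assert (K1 : Rabs ((N (a + h) - N a) / h - N') < eps / (2 * (Rabs (c a) + 1))).
{ apply H1; auto; eapply Rlt_le_trans; [apply Hh | apply Rmin_l]. }
assert (K2 : Rabs (c (a + h) - c a) < Rmin 1 (eps / (2 * (Rabs N' + 1)))).
{ apply H2; change (Rabs (a + h - a) < d2); replace (a + h - a) with h by ring.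
  eapply Rlt_le_trans; [apply Hh | apply Rmin_r]. }
pose proof (Rmin_l 1 (eps / (2 * (Rabs N' + 1)))).
pose proof (Rmin_r 1 (eps / (2 * (Rabs N' + 1)))).
rewrite N0 in *.
(* As [N a = 0], the difference quotient of the product is that of [N] times [c (a + h)]; continuity
   of [c] therefore suffices. *)
replace ((N (a + h) * c (a + h) - 0 * c a) / h - N' * c a)
  with (((N (a + h) - 0) / h - N') * c (a + h) + N' * (c (a + h) - c a))
  by (field; auto).
eapply Rle_lt_trans; [apply Rabs_triang|]; rewrite !Rabs_mult.
assert (Rabs (c (a + h)) <= Rabs (c a) + 1).
{ replace (c (a + h)) with (c a + (c (a + h) - c a)) by ring.
  eapply Rle_trans; [apply Rabs_triang | lra]. }
assert (Rabs ((N (a + h) - 0) / h - N') * Rabs (c (a + h))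
        < eps / (2 * (Rabs (c a) + 1)) * (Rabs (c a) + 1)).
{ eapply Rle_lt_trans; [apply Rmult_le_compat_l; [apply Rabs_pos | eassumption]|].
  apply Rmult_lt_compat_r; lra. }
assert (Rabs N' * Rabs (c (a + h) - c a)
        <= (Rabs N' + 1) * (eps / (2 * (Rabs N' + 1)))).
{ apply Rmult_le_compat; try apply Rabs_pos; lra. }
replace (eps / (2 * (Rabs (c a) + 1)) * (Rabs (c a) + 1)) with (eps / 2) in *
  by (field; lra).
replace ((Rabs N' + 1) * (eps / (2 * (Rabs N' + 1)))) with (eps / 2) in *
  by (field; lra).
lra.
Qed.

(* Caratheodory's criterion: the difference quotient of [f] in its second
   argument extends continuously by [fz]. *)
Lemma partials_implicit f f0 fz (a : R -> R) a' (b : R -> R) b' (w : R -> R)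
    (h0 : R) :
  partials f f0 fz ->
  is_derive a h0 a' -> is_derive b h0 b' -> continuous w h0 ->
  (forall h, f (a h) (w h) = b h) -> fz (a h0) (w h0) <> 0 ->
  is_derive w h0 ((b' - f0 (a h0) (w h0) * a') / fz (a h0) (w h0)).
Proof.
intros Hf Ha Hb Hw E Hn.
pose proof Hf as (H1 & H2 & H3 & H4).
set (w0 := w h0) in *.
set (S := fun h => if Req_EM_T (w h) w0 then fz (a h) w0
                   else (f (a h) (w h) - f (a h) w0) / (w h - w0)).
(* By the mean value theorem [S h] is a value of [fz (a h)] between [w0] and [w h], so the joint
   continuity of [fz] makes [S] continuous at [h0]. *)
assert (HS : forall h, exists th, Rabs (th - w0) <= Rabs (w h - w0) /\
                                  S h = fz (a h) th).
{ intros h; unfold S; destruct (Req_EM_T (w h) w0) as [e|e].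
  - exists w0; split; auto; rewrite Rminus_diag, Rabs_R0; apply Rabs_pos.
  - destruct (MVT_gen (f (a h)) w0 (w h) (fz (a h))) as (th & Hth & Eth).
    + auto.
    + intros x _; apply continuity_pt_filterlim.
      apply (ex_derive_continuous (f (a h))); exists (fz (a h) x); auto.
    + exists th; split.
      * unfold Rmin, Rmax in Hth; unfold Rabs.
        destruct (Rle_dec w0 (w h)); repeat destruct Rcase_abs; lra.
      * rewrite Eth; field; lra. }
assert (HS0 : S h0 = fz (a h0) w0).
{ unfold S; fold w0; destruct (Req_EM_T w0 w0); lra. }
assert (CS : continuous S h0).
{ apply filterlim_locally; intros eps.
  destruct (H4 (a h0) w0 eps) as [d Hd].
  assert (Ca : continuous a h0) by (apply (ex_derive_continuous a); now exists a').
  apply filterlim_locally with (eps := d) in Ca.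
  apply filterlim_locally with (eps := d) in Hw.
  generalize (filter_and _ _ Ca Hw); apply filter_imp; intros h [K1 K2].
  destruct (HS h) as (th & Hth & ->); rewrite HS0.
  apply Hd; [apply K1|].
  eapply Rle_lt_trans; [apply Hth | apply K2]. }
assert (HN : is_derive (fun h => b h - f (a h) w0) h0
               (b' - f0 (a h0) w0 * a')).
{ replace (b' - f0 (a h0) w0 * a')
    with (b' - (f0 (a h0) w0 * a' + fz (a h0) w0 * 0)) by ring.
  apply (is_derive_minus (K := R_AbsRing) b (fun h => f (a h) w0)); auto.
  apply (partials_curve f f0 fz a (fun _ => w0)); auto.
  apply (is_derive_const w0). }
(* This quotient equals [w h - w0] near [h0]. Its numerator is differentiable and vanishes at [h0],
   while [/ S] is only known to be continuous. *)
assert (Hq : is_derive (fun h => (b h - f (a h) w0) * / S h) h0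
               ((b' - f0 (a h0) w0 * a') * / S h0)).
{ apply (is_derive_mult_vanishing (fun h => b h - f (a h) w0)
           (fun h => / S h) h0 _ HN).
  - rewrite <- E; fold w0; ring.
  - apply (continuous_comp S Rinv h0 CS).
    apply continuous_Rinv; rewrite HS0; exact Hn. }
rewrite HS0 in Hq; unfold Rdiv.
replace ((b' - f0 (a h0) w0 * a') * / fz (a h0) w0)
  with (0 + (b' - f0 (a h0) w0 * a') * / fz (a h0) w0) by ring.
apply (is_derive_ext_loc (fun h => w0 + (b h - f (a h) w0) * / S h)).
- assert (Hne : locally h0 (fun h => S h <> 0)).
  { apply (CS (fun y => y <> 0)); apply (open_neq 0); rewrite HS0; auto. }
  revert Hne; apply filter_imp; intros h Hh.
  assert (ES : f (a h) (w h) - f (a h) w0 = S h * (w h - w0)).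
  { unfold S; destruct (Req_EM_T (w h) w0) as [e|e];
      [rewrite e; ring | field; lra]. }
  rewrite <- E, ES.
  refine (_ : w0 + S h * (w h - w0) * / S h = w h :> R); field; exact Hh.
- apply (is_derive_plus (K := R_AbsRing) (fun _ => w0)
           (fun h => (b h - f (a h) w0) * / S h)); auto.
  apply (is_derive_const w0).
Qed.

(** Monotonicity traps the inverse: the strict inequalities for [f] at [g x z - eps] and
    [g x z + eps] persist at nearby points. *)
Lemma C0_inverse f g : C0 f ->
  (forall x Z Z', Z < Z' -> f x Z < f x Z') ->
  (forall x Z, g x (f x Z) = Z) -> (forall x z, f x (g x z) = z) -> C0 g.
Proof.
intros Hf Hi E1 E2 x z eps; pose proof (cond_pos eps) as Heps.
assert (Hle : forall x Z Z', f x Z < f x Z' -> Z < Z').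
{ intros x' Z Z' H; destruct (Rtotal_order Z Z') as [|[->|H']]; auto; [lra|].
  specialize (Hi x' _ _ H'); lra. }
assert (K1 : f x (g x z - eps) < z) by (rewrite <- (E2 x z) at 2; apply Hi; lra).
assert (K2 : z < f x (g x z + eps)) by (rewrite <- (E2 x z) at 1; apply Hi; lra).
(* Half of the smaller gap: one half absorbs the displacement of [z], the other the change of [f]
   when [x] moves. *)
set (r := Rmin (z - f x (g x z - eps)) (f x (g x z + eps) - z) / 2).
assert (Hr : 0 < r).
{ unfold r; assert (0 < Rmin (z - f x (g x z - eps)) (f x (g x z + eps) - z))
    by (apply Rmin_glb_lt; lra); lra. }
assert (Hr1 : 2 * r <= z - f x (g x z - eps)).
{ unfold r; pose proof (Rmin_l (z - f x (g x z - eps)) (f x (g x z + eps) - z)); lra. }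
assert (Hr2 : 2 * r <= f x (g x z + eps) - z).
{ unfold r; pose proof (Rmin_r (z - f x (g x z - eps)) (f x (g x z + eps) - z)); lra. }
destruct (Hf x (g x z - eps) (mkposreal _ Hr)) as [d1 D1].
destruct (Hf x (g x z + eps) (mkposreal _ Hr)) as [d2 D2]; simpl in D1, D2.
assert (Hd : 0 < Rmin r (Rmin d1 d2)).
{ apply Rmin_glb_lt; auto; apply Rmin_glb_lt; apply cond_pos. }
exists (mkposreal _ Hd); intros u v Hu Hv; simpl in Hu, Hv.
pose proof (Rmin_l r (Rmin d1 d2)); pose proof (Rmin_r r (Rmin d1 d2)).
pose proof (Rmin_l d1 d2); pose proof (Rmin_r d1 d2).
assert (L1 := D1 u (g x z - eps) ltac:(lra) ltac:(rewrite Rminus_diag, Rabs_R0; apply cond_pos)).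
assert (L2 := D2 u (g x z + eps) ltac:(lra) ltac:(rewrite Rminus_diag, Rabs_R0; apply cond_pos)).
apply Rabs_def2 in L1; apply Rabs_def2 in L2; apply Rabs_def2 in Hv.
apply Rabs_def1.
- assert (g u v < g x z + eps); [|lra].
  apply (Hle u); rewrite E2; lra.
- assert (g x z - eps < g u v); [|lra].
  apply (Hle u); rewrite E2; lra.
Qed.

Lemma partials_inverse f f0 fz g : partials f f0 fz ->
  (forall x Z Z', Z < Z' -> f x Z < f x Z') ->
  (forall x Z, g x (f x Z) = Z) -> (forall x z, f x (g x z) = z) ->
  (forall x Z, 0 < fz x Z) ->
  partials g (fun x z => - f0 x (g x z) / fz x (g x z))
    (fun x z => / fz x (g x z)).
Proof.
intros Hf Hi E1 E2 Hp; pose proof (partials_C0 _ _ _ Hf) as Cf.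
assert (Cg : C0 g) by (now apply (C0_inverse f)).
assert (Hn : forall x z, fz x z <> 0) by (intros; apply Rgt_not_eq, Hp).
pose proof Hf as (H1 & H2 & H3 & H4).
assert (C0 (fun x z => fz x (g x z))) by (apply C0_comp; auto; apply C0_fst).
split; [|split; [|split]].
- intros x z.
  replace (- f0 x (g x z) / fz x (g x z))
    with ((0 - f0 x (g x z) * 1) / fz x (g x z)) by (field; auto).
  apply (partials_implicit f f0 fz (fun t => t) 1 (fun _ => z) 0
           (fun t => g t z)); auto.
  + apply (is_derive_id x).
  + apply (is_derive_const z).
  + now apply C0_slice1.
- intros x z.
  replace (/ fz x (g x z))
    with ((1 - f0 x (g x z) * 0) / fz x (g x z)) by (field; auto).
  apply (partials_implicit f f0 fz (fun _ => x) 0 (fun y => y) 1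
           (fun y => g x y)); auto.
  + apply (is_derive_const x).
  + apply (is_derive_id z).
  + now apply C0_slice2.
- apply C0_div; auto; apply C0_opp, C0_comp; auto; apply C0_fst.
- apply C0_inv; auto.
Qed.

(** * Integrals with variable limits and parameters *)

Lemma ex_RInt_cont (f : R -> R) a b : (forall x, continuous f x) -> ex_RInt f a b.
Proof. intros H; apply (ex_RInt_continuous f); auto. Qed.

Lemma is_derive_RInt_cont (f : R -> R) a x : (forall y, continuous f y) ->
  is_derive (fun b => RInt f a b) x (f x).
Proof.
intros H; apply (is_derive_RInt f (fun b => RInt f a b) a x); auto.
apply filter_forall; intros b; apply (RInt_correct f), ex_RInt_cont, H.
Qed.

Lemma continuous_RInt_cont (f : R -> R) a x : (forall y, continuous f y) ->
  continuous (fun b => RInt f a b) x.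
Proof.
intros H; apply (ex_derive_continuous (fun b => RInt f a b)).
exists (f x); now apply is_derive_RInt_cont.
Qed.

Lemma eq_RInt_derive (f df : R -> R) a b :
  (forall x, Rmin a b <= x <= Rmax a b -> is_derive f x (df x)) ->
  (forall x, Rmin a b <= x <= Rmax a b -> continuous df x) ->
  f b = f a + RInt df a b.
Proof.
intros H1 H2.
rewrite (is_RInt_unique _ _ _ _ (is_RInt_derive f df a b H1 H2)).
change (f b = f a + (f b - f a)); ring.
Qed.

Lemma constant_of_is_derive_0 (v : R -> R) a b :
  (forall x, Rmin a b <= x <= Rmax a b -> is_derive v x 0) -> v b = v a.
Proof.
intros H; rewrite (eq_RInt_derive v (fun _ => 0) a b); auto.
- rewrite RInt_const; change (v a + (b - a) * 0 = v a); ring.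
- intros; apply continuous_const.
Qed.

Lemma Rabs_RInt_le (f : R -> R) a b M : (forall x, continuous f x) ->
  (forall t, Rmin a b <= t <= Rmax a b -> Rabs (f t) <= M) ->
  Rabs (RInt f a b) <= Rabs (b - a) * M.
Proof.
intros Hf H; destruct (Rle_lt_dec a b) as [Hab|Hab].
- rewrite Rmin_left, Rmax_right in H by auto.
  rewrite (Rabs_right (b - a)) by lra.
  apply abs_RInt_le_const; auto; now apply ex_RInt_cont.
- rewrite Rmin_right, Rmax_left in H by lra.
  rewrite (Rabs_left (b - a)) by lra.
  rewrite <- (opp_RInt_swap f) by (now apply ex_RInt_cont).
  change (Rabs (- RInt f b a) <= - (b - a) * M).
  rewrite Rabs_Ropp; replace (- (b - a)) with (a - b) by ring.
  apply abs_RInt_le_const; [lra | now apply ex_RInt_cont | auto].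
Qed.

Lemma C0_RInt G : C0 G -> C0 (fun v x => RInt (fun t => G v t) 0 x).
Proof.
intros HG v0 x0 eps; pose proof (cond_pos eps).
assert (CG : forall v y, continuous (fun t => G v t) y)
  by (intros; now apply C0_slice2).
(* All upper limits within distance [1] of [x0] lie in [[-L, L]], where the continuity of [G] in its
   parameter is uniform. *)
set (L := Rabs x0 + 1); pose proof (Rabs_pos x0).
assert (HL : 0 < L) by (unfold L; lra).
assert (He : 0 < eps / (2 * L)) by (apply Rdiv_lt_0_compat; lra).
assert (He2 : 0 < eps / 2) by lra.
destruct (uniform_continuity_2d_1d' G (- L) L v0 (fun x _ => HG v0 x)
            (mkposreal _ He)) as [d1 D1]; simpl in D1.
pose proof (continuous_RInt_cont (G v0) 0 x0 (CG v0)) as CI.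
apply filterlim_locally with (eps := mkposreal _ He2) in CI.
destruct CI as [d2 D2].
assert (Hd : 0 < Rmin 1 (Rmin d1 d2)).
{ apply Rmin_glb_lt; [lra|]; apply Rmin_glb_lt; apply cond_pos. }
exists (mkposreal _ Hd); intros v x Hv Hx; simpl in Hv, Hx.
pose proof (Rmin_l 1 (Rmin d1 d2)); pose proof (Rmin_r 1 (Rmin d1 d2)).
pose proof (Rmin_l d1 d2); pose proof (Rmin_r d1 d2); pose proof (cond_pos d1).
replace (RInt (fun t => G v t) 0 x - RInt (fun t => G v0 t) 0 x0)
  with (RInt (fun t => minus (G v t) (G v0 t)) 0 x
        + (RInt (fun t => G v0 t) 0 x - RInt (fun t => G v0 t) 0 x0)).
2:{ rewrite (RInt_minus (fun t => G v t) (fun t => G v0 t))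
      by (apply ex_RInt_cont; auto).
    unfold minus, plus, opp; simpl; ring. }
eapply Rle_lt_trans; [apply Rabs_triang|].
assert (K2 : Rabs (RInt (fun t => G v0 t) 0 x - RInt (fun t => G v0 t) 0 x0)
             < eps / 2).
{ apply D2; change (Rabs (x - x0) < d2); lra. }
assert (HxL : Rabs x <= L).
{ unfold L; replace x with (x0 + (x - x0)) by ring.
  eapply Rle_trans; [apply Rabs_triang|]; lra. }
assert (K1 : Rabs (RInt (fun t => minus (G v t) (G v0 t)) 0 x)
             <= Rabs (x - 0) * (eps / (2 * L))).
{ apply Rabs_RInt_le.
  - intros y; apply (continuous_minus (fun t => G v t) (fun t => G v0 t)); auto.
  - intros t Ht; left; apply (D1 t v0 t v).
    + unfold Rmin, Rmax in Ht; unfold Rabs in HxL.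
      destruct (Rle_dec 0 x); destruct (Rcase_abs x); lra.
    + lra.
    + unfold Rmin, Rmax in Ht; unfold Rabs in HxL.
      destruct (Rle_dec 0 x); destruct (Rcase_abs x); lra.
    + apply Rabs_def2 in Hv; lra.
    + rewrite Rminus_diag, Rabs_R0; apply cond_pos. }
assert (Rabs (x - 0) * (eps / (2 * L)) <= L * (eps / (2 * L))).
{ rewrite Rminus_0_r; apply Rmult_le_compat_r; lra. }
replace (L * (eps / (2 * L))) with (eps / 2) in * by (field; lra).
lra.
Qed.

(** Leibniz' rule as a statement about two variables. The parameter comes first and the upper limit
    second, so functions of [(t, Z)] enter with their arguments swapped. *)
Lemma partials_RInt f fv : C0 f -> C0 fv ->
  (forall v t, is_derive (fun v => f v t) v (fv v t)) ->
  partials (fun v x => RInt (fun t => f v t) 0 x)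
    (fun v x => RInt (fun t => fv v t) 0 x) f.
Proof.
intros Hf Hfv Hd; split; [|split; [|split]]; auto.
- intros v x.
  rewrite (RInt_ext (fun t => fv v t) (fun t => Derive (fun u => f u t) v)).
  2:{ intros t _; symmetry; apply is_derive_unique, Hd. }
  apply (is_derive_RInt_param f 0 x v).
  + apply filter_forall; intros y t _; exists (fv y t); apply Hd.
  + intros t _; apply (continuity_2d_pt_ext fv); [|apply Hfv].
    intros; symmetry; apply is_derive_unique, Hd.
  + apply filter_forall; intros y; apply ex_RInt_cont.
    intros; now apply C0_slice2.
- intros v x; apply (is_derive_RInt_cont (f v)); intros; now apply C0_slice2.
- now apply C0_RInt.
Qed.

(** * Gronwall estimates, linear equations and the wave equation *)

(** Uniform continuity does the work: the segment from the corner [(a, a')] to any point is cut into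
    [N] pieces shorter than the modulus for [1], and [f] changes by less than [1] on each. *)
Lemma C0_bounded_on_rectangle f a b a' b' : C0 f ->
  exists M, 0 < M /\ forall x z, a <= x <= b -> a' <= z <= b' -> Rabs (f x z) <= M.
Proof.
intros Hf.
destruct (uniform_continuity_2d f a b a' b' (fun x z _ _ => Hf x z)
            (mkposreal 1 Rlt_0_1)) as [d Hd]; simpl in Hd.
set (L := Rmax 0 (Rmax (b - a) (b' - a'))).
assert (HL : 0 <= L) by apply Rmax_l.
assert (HL' : Rmax (b - a) (b' - a') <= L) by apply Rmax_r.
pose proof (Rmax_l (b - a) (b' - a')); pose proof (Rmax_r (b - a) (b' - a')).
pose proof (cond_pos d).
destruct (archimed_cor1 (d / (L + 1))) as (N & HN & HN0);
  [apply Rdiv_lt_0_compat; lra|].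
apply lt_INR in HN0; simpl in HN0.
assert (HNd : L / INR N < d).
{ apply Rmult_lt_reg_r with (INR N); auto.
  unfold Rdiv; rewrite Rmult_assoc, Rinv_l, Rmult_1_r by lra.
  apply Rmult_lt_compat_r with (r := INR N * (L + 1)) in HN;
    [|apply Rmult_lt_0_compat; lra].
  replace (/ INR N * (INR N * (L + 1))) with (L + 1) in HN by (field; lra).
  replace (d / (L + 1) * (INR N * (L + 1))) with (d * INR N) in HN by (field; lra).
  lra. }
exists (Rabs (f a a') + INR N); pose proof (Rabs_pos (f a a')).
split; [lra|]; intros x z Hx Hz.
set (p := fun j => a + INR j / INR N * (x - a)).
set (r := fun j => a' + INR j / INR N * (z - a')).
assert (Hstep : forall j, (j <= N)%nat ->
          Rabs (f (p j) (r j)) <= Rabs (f a a') + INR j).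
{ induction j as [|j IH]; intros Hj.
  - unfold p, r; simpl; unfold Rdiv; rewrite !Rmult_0_l, !Rplus_0_r; lra.
  - rewrite S_INR.
    assert (Hb : forall i, (i <= N)%nat -> 0 <= INR i / INR N <= 1).
    { intros i Hi; apply le_INR in Hi; pose proof (pos_INR i); split.
      - apply Rdiv_le_0_compat; lra.
      - apply Rmult_le_reg_r with (INR N); auto.
        unfold Rdiv; rewrite Rmult_assoc, Rinv_l, Rmult_1_r by lra; lra. }
    assert (Hin : forall i u v w, (i <= N)%nat -> u <= w <= v ->
              u <= u + INR i / INR N * (w - u) <= v).
    { intros i u v w Hi Hw; specialize (Hb i Hi).
      assert (0 <= INR i / INR N * (w - u)) by (apply Rmult_le_pos; lra).
      assert (INR i / INR N * (w - u) <= 1 * (w - u))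
        by (apply Rmult_le_compat_r; lra); lra. }
    assert (Hdiff : forall u w, 0 <= w - u <= L ->
              Rabs (u + INR (S j) / INR N * (w - u)
                    - (u + INR j / INR N * (w - u))) < d).
    { intros u w Hw.
      replace (u + INR (S j) / INR N * (w - u) - (u + INR j / INR N * (w - u)))
        with ((w - u) / INR N) by (rewrite S_INR; field; lra).
      rewrite Rabs_right by (apply Rle_ge, Rdiv_le_0_compat; lra).
      eapply Rle_lt_trans; [|apply HNd].
      apply Rmult_le_compat_r; [left; apply Rinv_0_lt_compat; lra | lra]. }
    assert (Hlt : Rabs (f (p (S j)) (r (S j)) - f (p j) (r j)) < 1).
    { apply Hd.
      - apply Hin; [lia | lra].
      - apply Hin; [lia | lra].
      - apply Hin; [lia | lra].
      - apply Hin; [lia | lra].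
      - apply Hdiff; lra.
      - apply Hdiff; lra. }
    specialize (IH ltac:(lia)).
    replace (f (p (S j)) (r (S j)))
      with (f (p j) (r j) + (f (p (S j)) (r (S j)) - f (p j) (r j))) by ring.
    eapply Rle_trans; [apply Rabs_triang | lra]. }
specialize (Hstep N (Nat.le_refl N)); unfold p, r in Hstep.
replace (INR N / INR N) with 1 in Hstep by (field; lra).
replace (a + 1 * (x - a)) with x in Hstep by ring.
replace (a' + 1 * (z - a')) with z in Hstep by ring; exact Hstep.
Qed.

(* Gronwall's argument in the form of a contraction for the norm weighted by
   [exp (- lam t)]. *)
Lemma vanishes_of_halving (P : R -> R -> Prop) (f : R -> R -> R) lam M0 :
  0 <= M0 ->
  (forall t y, P t y -> Rabs (f t y) <= M0 * exp (lam * t)) ->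
  (forall M, 0 <= M ->
     (forall t y, P t y -> Rabs (f t y) <= M * exp (lam * t)) ->
     forall t y, P t y -> Rabs (f t y) <= M / 2 * exp (lam * t)) ->
  forall t y, P t y -> f t y = 0.
Proof.
intros HM0 H0 Hstep.
assert (Hn : forall j t y, P t y -> Rabs (f t y) <= M0 / 2 ^ j * exp (lam * t)).
{ induction j as [|j IH]; intros t y Hp.
  - simpl; unfold Rdiv; rewrite Rinv_1, Rmult_1_r; auto.
  - replace (M0 / 2 ^ S j) with (M0 / 2 ^ j / 2)
      by (simpl; field; apply pow_nonzero; lra).
    apply Hstep; auto.
    apply Rdiv_le_0_compat; auto; apply pow_lt; lra. }
intros t y Hp; destruct (Req_dec (f t y) 0) as [|Hne]; auto; exfalso.
apply Rabs_pos_lt in Hne; pose proof (exp_pos (lam * t)) as He.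
set (K := M0 * exp (lam * t)) in *.
assert (HK : 0 <= K) by (apply Rmult_le_pos; lra).
destruct (pow_lt_1_zero (/ 2) ltac:(rewrite Rabs_right; lra)
            (Rabs (f t y) / (K + 1))) as [j Hj].
{ apply Rdiv_lt_0_compat; lra. }
specialize (Hj j (Nat.le_refl j)); specialize (Hn j t y Hp).
rewrite Rabs_right in Hj by (apply Rle_ge, pow_le; lra).
replace (M0 / 2 ^ j * exp (lam * t)) with (K * (/ 2) ^ j) in Hn
  by (unfold K; rewrite pow_inv; field; apply pow_nonzero; lra).
assert (0 < (/ 2) ^ j) by (apply pow_lt; lra).
apply Rmult_lt_compat_l with (r := K + 1) in Hj; [|lra].
replace ((K + 1) * (Rabs (f t y) / (K + 1))) with (Rabs (f t y)) in Hj
  by (field; lra).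
lra.
Qed.

(** Variation of constants for [y' = g y + r], [y 0 = 1]. Unlike in Duhamel's form, [x] does not
    occur in the integrand, so the product rule differentiates it. *)
Definition linear_solution (g r : R -> R) (x : R) : R :=
  exp (RInt g 0 x) * (1 + RInt (fun t => exp (- RInt g 0 t) * r t) 0 x).

Lemma continuous_exp_primitive (g : R -> R) x : (forall y, continuous g y) ->
  continuous (fun t => exp (- RInt g 0 t)) x.
Proof.
intros Cg; apply (continuous_comp (fun t => - RInt g 0 t) exp).
- apply (continuous_opp (fun t => RInt g 0 t)), continuous_RInt_cont, Cg.
- apply continuous_exp.
Qed.

Lemma is_derive_linear_solution (g r : R -> R) x :
  (forall y, continuous g y) -> (forall y, continuous r y) ->
  is_derive (linear_solution g r) x (g x * linear_solution g r x + r x).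
Proof.
intros Cg Cr.
pose proof (is_derive_RInt_cont g 0 x Cg) as D1.
pose proof (is_derive_RInt_cont (fun t => exp (- RInt g 0 t) * r t) 0 x) as D2.
assert (C2' : forall y, continuous (fun t => exp (- RInt g 0 t) * r t) y).
{ intros y; apply (continuous_mult (fun t => exp (- RInt g 0 t)) r); auto.
  now apply continuous_exp_primitive. }
specialize (D2 C2').
assert (D3 : is_derive (fun b => exp (RInt g 0 b)) x (g x * exp (RInt g 0 x))).
{ apply (is_derive_comp exp (fun b => RInt g 0 b)); auto.
  apply is_derive_exp. }
assert (D4 : is_derive
  (fun b => 1 + RInt (fun t => exp (- RInt g 0 t) * r t) 0 b) x
  (0 + exp (- RInt g 0 x) * r x)).
{ apply (is_derive_plus (K := R_AbsRing) (fun _ => 1)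
           (fun b => RInt (fun t => exp (- RInt g 0 t) * r t) 0 b)); auto.
  apply (is_derive_const 1). }
replace (g x * linear_solution g r x + r x)
  with (g x * exp (RInt g 0 x)
        * (1 + RInt (fun t => exp (- RInt g 0 t) * r t) 0 x)
        + exp (RInt g 0 x) * (0 + exp (- RInt g 0 x) * r x)).
- apply (is_derive_mult (K := R_AbsRing) (fun b => exp (RInt g 0 b))
    (fun b => 1 + RInt (fun t => exp (- RInt g 0 t) * r t) 0 b) x _ _ D3 D4).
  intros; apply Rmult_comm.
- unfold linear_solution.
  replace (exp (RInt g 0 x) * (0 + exp (- RInt g 0 x) * r x))
    with (exp (RInt g 0 x) * exp (- RInt g 0 x) * r x) by ring.
  rewrite <- exp_plus, Rplus_opp_r, exp_0; ring.
Qed.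

Lemma linear_solution_0 g r : linear_solution g r 0 = 1.
Proof.
unfold linear_solution; rewrite !RInt_point.
change (exp 0 * (1 + 0) = 1); rewrite exp_0; ring.
Qed.

Lemma linear_solution_unique (g r y : R -> R) :
  (forall t, continuous g t) -> (forall t, continuous r t) ->
  (forall t, is_derive y t (g t * y t + r t)) ->
  y 0 = 1 -> forall x, y x = linear_solution g r x.
Proof.
intros Cg Cr Hy H0 x.
set (v := fun t => exp (- RInt g 0 t) * (y t - linear_solution g r t)).
assert (Hv : forall t, is_derive v t 0).
{ intros t.
  replace 0 with (- g t * exp (- RInt g 0 t) * (y t - linear_solution g r t)
    + exp (- RInt g 0 t)
      * (g t * y t + r t - (g t * linear_solution g r t + r t))) by ring.
  apply (is_derive_mult (K := R_AbsRing) (fun b => exp (- RInt g 0 b))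
           (fun b => y b - linear_solution g r b)).
  - apply (is_derive_comp exp (fun b => - RInt g 0 b)).
    + apply is_derive_exp.
    + apply (is_derive_opp (K := R_AbsRing) (fun b => RInt g 0 b)).
      now apply is_derive_RInt_cont.
  - apply (is_derive_minus (K := R_AbsRing) y (linear_solution g r)); auto.
    now apply is_derive_linear_solution.
  - intros; apply Rmult_comm. }
assert (E : v x = v 0) by (apply constant_of_is_derive_0; auto).
unfold v in E; rewrite H0, linear_solution_0 in E.
rewrite Rminus_diag, Rmult_0_r in E.
apply Rmult_integral in E; destruct E as [E|E]; [|lra].
pose proof (exp_pos (- RInt g 0 x)); lra.
Qed.

Lemma linear_solution_Duhamel (g r : R -> R) x :
  (forall t, continuous g t) -> (forall t, continuous r t) ->
  linear_solution g r x
  = exp (RInt g 0 x) + RInt (fun t => exp (RInt g t x) * r t) 0 x.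
Proof.
intros Cg Cr; unfold linear_solution; rewrite Rmult_plus_distr_l, Rmult_1_r; f_equal.
rewrite <- (RInt_scal (fun t => exp (- RInt g 0 t) * r t)).
2:{ apply ex_RInt_cont; intros y.
    apply (continuous_mult (fun t => exp (- RInt g 0 t)) r); auto.
    now apply continuous_exp_primitive. }
apply RInt_ext; intros t _.
change (exp (RInt g 0 x) * (exp (- RInt g 0 t) * r t) = exp (RInt g t x) * r t).
rewrite <- Rmult_assoc, <- exp_plus; do 2 f_equal.
rewrite <- (RInt_Chasles g 0 t x) by (apply ex_RInt_cont; auto).
change (RInt g 0 t + RInt g t x + - RInt g 0 t = RInt g t x); ring.
Qed.

(** The equation for [J] is given only between [0] and [x]. Its right-hand side [Y] is
    differentiable everywhere and agrees with [J] on that interval, so the integrating factor is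
    applied to [Y]. *)
Lemma exp_of_integral_equation (a J : R -> R) x :
  (forall y, continuous a y) -> (forall y, continuous J y) ->
  (forall t, Rmin 0 x <= t <= Rmax 0 x ->
     J t = 1 + RInt (fun t' => a t' * J t') 0 t) ->
  J x = exp (RInt a 0 x).
Proof.
intros Ca CJ H.
set (Y := fun t => 1 + RInt (fun t' => a t' * J t') 0 t).
assert (DY : forall t, is_derive Y t (a t * J t)).
{ intros t; replace (a t * J t) with (0 + a t * J t) by ring.
  apply (is_derive_plus (K := R_AbsRing) (fun _ => 1)
           (fun b => RInt (fun t' => a t' * J t') 0 b)).
  - apply (is_derive_const 1).
  - apply (is_derive_RInt_cont (fun t' => a t' * J t')).
    intros y; apply (continuous_mult a J); auto. }
set (v := fun t => exp (- RInt a 0 t) * Y t).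
assert (E : v x = v 0).
{ apply constant_of_is_derive_0; intros t Ht.
  replace 0 with (- a t * exp (- RInt a 0 t) * Y t
    + exp (- RInt a 0 t) * (a t * J t)) by (rewrite (H t Ht); fold (Y t); ring).
  apply (is_derive_mult (K := R_AbsRing) (fun b => exp (- RInt a 0 b)) Y); auto.
  - apply (is_derive_comp exp (fun b => - RInt a 0 b)).
    + apply is_derive_exp.
    + apply (is_derive_opp (K := R_AbsRing) (fun b => RInt a 0 b)).
      now apply is_derive_RInt_cont.
  - intros; apply Rmult_comm. }
rewrite H by (split; [apply Rmin_r | apply Rmax_r]); fold (Y x).
assert (HY0 : Y 0 = 1).
{ unfold Y; rewrite RInt_point; change (1 + 0 = 1); ring. }
unfold v in E; rewrite HY0, RInt_point in E.
unfold zero in E; simpl in E; rewrite Ropp_0, exp_0, Rmult_1_r in E.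
assert (Hee : exp (RInt a 0 x) * exp (- RInt a 0 x) = 1).
{ rewrite <- exp_plus, Rplus_opp_r; apply exp_0. }
transitivity (exp (RInt a 0 x) * exp (- RInt a 0 x) * Y x).
- rewrite Hee; ring.
- rewrite Rmult_assoc, E; ring.
Qed.

(** * Retarded solutions of the wave equation in one space dimension *)

Definition cone_integral (G : R -> R -> R) (x z : R) : R :=
  RInt (fun t => RInt (fun y => G t y) (t - x + z) (x - t + z)) 0 x.

(** Integrals over the two sides of the backward cone of [(x, z)]: [char_minus] keeps [t + y] fixed,
    [char_plus] keeps [y - t] fixed. *)
Definition char_minus (G : R -> R -> R) (x z : R) : R :=
  RInt (fun t => G t (x + z - t)) 0 x.
Definition char_plus (G : R -> R -> R) (x z : R) : R :=
  RInt (fun t => G t (t + (z - x))) 0 x.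

(** With [H] a primitive of [G] in space, the cone integral is a difference of a function of
    [(x + z, x)] and one of [(z - x, x)]. The terms from the upper limit [t = x] cancel since both
    sides of the cone meet at the apex. *)
Lemma partials_cone_integral G : C0 G ->
  partials (cone_integral G) (fun x z => char_minus G x z + char_plus G x z)
    (fun x z => char_minus G x z - char_plus G x z).
Proof.
intros HG.
set (H := fun t y => RInt (G t) 0 y).
assert (CH : C0 H) by (now apply C0_RInt).
assert (DH : forall t y, is_derive (H t) y (G t y)).
{ intros t y; apply is_derive_RInt_cont; intros; now apply C0_slice2. }
assert (C1' : forall K, C0 K -> C0 (fun v t => K t (v - t))).
{ intros K HK; apply C0_comp; auto;
    [apply C0_snd | apply C0_minus; [apply C0_fst | apply C0_snd]]. }
assert (C2' : forall K, C0 K -> C0 (fun w t => K t (t + w))).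
{ intros K HK; apply C0_comp; auto;
    [apply C0_snd | apply C0_plus; [apply C0_snd | apply C0_fst]]. }
assert (P1' : partials (fun v x => RInt (fun t => H t (v - t)) 0 x)
  (fun v x => RInt (fun t => G t (v - t)) 0 x) (fun v t => H t (v - t))).
{ apply (partials_RInt (fun v t => H t (v - t)) (fun v t => G t (v - t)));
    auto; intros v t; rewrite <- (Rmult_1_l (G t (v - t))).
  apply (is_derive_comp (H t) (fun v => v - t) v); [apply DH|].
  auto_derive; auto; ring. }
assert (P2' : partials (fun w x => RInt (fun t => H t (t + w)) 0 x)
  (fun w x => RInt (fun t => G t (t + w)) 0 x) (fun w t => H t (t + w))).
{ apply (partials_RInt (fun w t => H t (t + w)) (fun w t => G t (t + w)));
    auto; intros v t; rewrite <- (Rmult_1_l (G t (t + v))).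
  apply (is_derive_comp (H t) (fun v => t + v) v); [apply DH|].
  auto_derive; auto; ring. }
pose proof (partials_comp _ _ _ _ _ _ _ _ _ P1'
  (partials_plus _ _ _ _ _ _ partials_fst partials_snd) partials_fst) as Q1.
pose proof (partials_comp _ _ _ _ _ _ _ _ _ P2'
  (partials_minus _ _ _ _ _ _ partials_snd partials_fst) partials_fst) as Q2.
eapply partials_ext; [apply (partials_minus _ _ _ _ _ _ Q1 Q2) | | |];
  intros x z; simpl.
- unfold cone_integral.
  rewrite <- (RInt_minus (fun t => H t (x + z - t)) (fun t => H t (t + (z - x)))).
  + apply RInt_ext; intros t _.
    rewrite <- (RInt_Chasles (fun y => G t y) (t - x + z) 0 (x - t + z))
      by (apply ex_RInt_cont; intros; now apply C0_slice2).
    rewrite <- (opp_RInt_swap (fun y => G t y) 0)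
      by (apply ex_RInt_cont; intros; now apply C0_slice2).
    replace (t - x + z) with (t + (z - x)) by ring.
    replace (x - t + z) with (x + z - t) by ring.
    change (H t (x + z - t) + - H t (t + (z - x))
            = - H t (t + (z - x)) + H t (x + z - t)); ring.
  + apply ex_RInt_cont; intros y.
    apply (C0_slice2 (fun v t => H t (v - t))); auto.
  + apply ex_RInt_cont; intros y.
    apply (C0_slice2 (fun v t => H t (t + v))); auto.
- unfold char_minus, char_plus.
  replace (x + z - x) with (x + (z - x)) by ring; ring.
- unfold char_minus, char_plus; ring.
Qed.

Lemma C2_mixed A x z : C2 A -> d_0 (d_z A) x z = d_z (d_0 A) x z.
Proof.
intros ((H1 & H2 & _) & (K1 & K2 & K3 & K4) & (L1 & L2 & L3 & L4)).
apply (Schwarz A x z).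
- exists (mkposreal 1 Rlt_0_1); intros u v _ _; split; [|split; [|split]].
  + apply H1.
  + apply H2.
  + apply L1.
  + apply K2.
- apply L3.
- apply K4.
Qed.

Lemma is_derive_inj (f : R -> R) x l l' :
  is_derive f x l -> is_derive f x l' -> l = l'.
Proof.
intros H H'; rewrite <- (is_derive_unique _ _ _ H).
exact (is_derive_unique _ _ _ H').
Qed.

Definition dalembertian (A : R -> R -> R) (x z : R) : R :=
  d_0 (d_0 A) x z - d_z (d_z A) x z.

Lemma C0_dalembertian A : C2 A -> C0 (dalembertian A).
Proof. intros (_ & (_ & _ & H & _) & (_ & _ & _ & K)); now apply C0_minus. Qed.

Lemma partials_sum_derivatives A : C2 A ->
  partials (fun x z => d_0 A x z + d_z A x z)
    (fun x z => d_0 (d_0 A) x z + d_0 (d_z A) x z)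
    (fun x z => d_z (d_0 A) x z + d_z (d_z A) x z).
Proof. intros (_ & H & K); apply partials_plus; now apply C1_partials. Qed.

(** The wave operator is the derivative along one characteristic of the derivative along the other;
    the mixed second derivatives cancel by Schwarz. *)
Lemma is_derive_along_minus A v r : C2 A ->
  is_derive (fun t => d_0 A t (v - t) + d_z A t (v - t)) r
    (dalembertian A r (v - r)).
Proof.
intros HA.
replace (dalembertian A r (v - r))
  with ((d_0 (d_0 A) r (v - r) + d_0 (d_z A) r (v - r)) * 1
        + (d_z (d_0 A) r (v - r) + d_z (d_z A) r (v - r)) * (-1))
  by (rewrite (C2_mixed A) by auto; unfold dalembertian; ring).
apply (partials_curve _ _ _ (fun t => t) (fun t => v - t) r 1 (-1)
         (partials_sum_derivatives A HA)).
- apply (is_derive_id r).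
- auto_derive; auto; ring.
Qed.

Lemma is_derive_along_plus f f0 fz w r : partials f f0 fz ->
  is_derive (fun t => f t (w + t)) r (f0 r (w + r) + fz r (w + r)).
Proof.
intros Hf.
replace (f0 r (w + r) + fz r (w + r))
  with (f0 r (w + r) * 1 + fz r (w + r) * 1) by ring.
apply (partials_curve f f0 fz (fun t => t) (fun t => w + t) r); auto.
- apply (is_derive_id r).
- auto_derive; auto; ring.
Qed.

(** [G] is half of the source. Integrating once gives [d_0 A + d_z A], which matches the same
    derivative of [cone_integral G]; the difference is then constant along [z - x]. The last
    hypothesis says that the initial wave has no left-moving part. *)
Lemma dalembert_formula A G : C2 A -> C0 G ->
  (forall x z, 0 <= x -> dalembertian A x z = 2 * G x z) ->
  (forall z, d_0 A 0 z + d_z A 0 z = 0) ->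
  forall x z, 0 <= x -> A x z = A 0 (z - x) + cone_integral G x z.
Proof.
intros HA HG Hbox Hini.
assert (HQ : forall t y, 0 <= t ->
          d_0 A t y + d_z A t y = 2 * char_minus G t y).
{ intros t y Ht; unfold char_minus.
  pose proof (eq_RInt_derive
    (fun r => d_0 A r (t + y - r) + d_z A r (t + y - r))
    (fun r => dalembertian A r (t + y - r)) 0 t) as E; simpl in E.
  replace (t + y - t) with y in E by ring; rewrite E.
  - rewrite Hini, Rplus_0_l, Rmin_left, Rmax_right in * by auto.
    rewrite <- (RInt_scal (fun t0 => G t0 (t + y - t0))).
    + apply RInt_ext; rewrite Rmin_left, Rmax_right by auto.
      intros r Hr; apply Hbox; lra.
    + apply ex_RInt_cont; intros r.
      apply (C0_slice G (fun r => r) (fun r => t + y - r)); auto.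
      * apply continuous_id.
      * apply (ex_derive_continuous (fun r => t + y - r)); auto_derive; auto.
  - intros r _; apply is_derive_along_minus; auto.
  - intros r _; apply (C0_slice _ (fun r => r) (fun r => t + y - r)).
    + now apply C0_dalembertian.
    + apply continuous_id.
    + apply (ex_derive_continuous (fun r => t + y - r)); auto_derive; auto. }
intros x z Hx.
assert (E : A x (z - x + x) - cone_integral G x (z - x + x)
            = A 0 (z - x + 0) - cone_integral G 0 (z - x + 0)).
{ apply (constant_of_is_derive_0
    (fun t => A t (z - x + t) - cone_integral G t (z - x + t)) 0 x).
  intros t Ht; rewrite Rmin_left in Ht by auto.
  replace 0 with ((d_0 A t (z - x + t) + d_z A t (z - x + t))
    - ((char_minus G t (z - x + t) + char_plus G t (z - x + t))
       + (char_minus G t (z - x + t) - char_plus G t (z - x + t))))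
    by (rewrite HQ by lra; ring).
  apply (is_derive_minus (K := R_AbsRing) (fun t => A t (z - x + t))
    (fun t => cone_integral G t (z - x + t))).
  - apply (is_derive_along_plus A), C1_partials, HA.
  - exact (is_derive_along_plus _ _ _ (z - x) t (partials_cone_integral G HG)). }
unfold cone_integral at 2 in E; rewrite RInt_point in E.
unfold zero in E; simpl in E.
replace (z - x + x) with z in E by ring; rewrite Rplus_0_r in E; lra.
Qed.

(** [cone_integral G] need not be twice differentiable. One differentiation, along [x - z] where the
    term in [al] is constant, leaves [char_minus G]; along the other characteristic this is a plain
    primitive of [G]. *)
Lemma dalembertian_of_formula A G (al : R -> R) : C2 A -> C0 G ->
  (forall x z, 0 <= x -> A x z - al (x - z) = cone_integral G x z) ->
  forall x z, 0 <= x -> dalembertian A x z = 2 * G x z.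
Proof.
intros HA HG HW.
assert (PA : partials A (d_0 A) (d_z A)) by (apply C1_partials, HA).
assert (HQ : forall t y, 0 < t ->
          d_0 A t y + d_z A t y = 2 * char_minus G t y).
{ intros t y Ht.
  pose proof (is_derive_along_plus _ _ _ (y - t) t
    (partials_minus _ _ _ _ _ _ PA (partials_cone_integral G HG))) as D.
  simpl in D; replace (y - t + t) with y in D by ring.
  assert (D0 : is_derive (fun r => A r (y - t + r)
                          - cone_integral G r (y - t + r)) t 0).
  { apply (is_derive_ext_loc (fun _ => al (t - y))).
    - generalize (locally_lt 0 t Ht); apply filter_imp; intros r Hr.
      rewrite <- HW by lra; replace (r - (y - t + r)) with (t - y) by ring.
      refine (_ : al (t - y) = A r (y - t + r)
        - (A r (y - t + r) - al (t - y)) :> R); ring.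
    - apply (is_derive_const (al (t - y))). }
  pose proof (is_derive_inj _ _ _ _ D D0) as E; simpl in E; lra. }
apply C0_eq_right.
- now apply C0_dalembertian.
- apply C0_mult; [apply C0_const | auto].
- intros x z Hx.
  pose proof (is_derive_along_minus A (x + z) x HA) as D.
  replace (x + z - x) with z in D by ring.
  assert (D0 : is_derive (fun t => d_0 A t (x + z - t) + d_z A t (x + z - t)) x
                 (2 * G x (x + z - x))).
  { apply (is_derive_ext_loc
      (fun t => 2 * RInt (fun t' => G t' (x + z - t')) 0 t)).
    - generalize (locally_lt 0 x Hx); apply filter_imp; intros t Ht.
      rewrite HQ by auto; unfold char_minus.
      refine (_ : (2 * _ = 2 * _ :> R)); f_equal.
      apply RInt_ext; intros; f_equal; ring.
    - apply (is_derive_scal (fun t => RInt (fun t' => G t' (x + z - t')) 0 t)).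
      apply (is_derive_RInt_cont (fun t' => G t' (x + z - t'))).
      intros y; apply (C0_slice G (fun r => r) (fun r => x + z - r)); auto.
      + apply continuous_id.
      + apply (ex_derive_continuous (fun r => x + z - r)); auto_derive; auto. }
  replace (x + z - x) with z in D0 by ring.
  exact (is_derive_inj _ _ _ _ D D0).
Qed.

(** Each time integration gains a factor [/ lam] in the weighted norm, which yields the contraction
    for large [lam]. *)
Lemma Rabs_RInt_exp_le (f : R -> R) C lam t : 0 <= t -> 0 < lam -> 0 <= C ->
  (forall x, continuous f x) ->
  (forall r, 0 <= r <= t -> Rabs (f r) <= C * exp (lam * r)) ->
  Rabs (RInt f 0 t) <= C / lam * exp (lam * t).
Proof.
intros Ht Hl HC Hf H.
assert (Cg : forall x, continuous (fun r => C * exp (lam * r)) x).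
{ intros x; apply (ex_derive_continuous (fun r => C * exp (lam * r))).
  auto_derive; auto. }
eapply Rle_trans; [apply abs_RInt_le; auto; now apply ex_RInt_cont|].
eapply Rle_trans.
- apply (RInt_le _ (fun r => C * exp (lam * r))); auto.
  + apply ex_RInt_cont; intros x.
    apply (continuous_comp f Rabs); auto; apply continuous_Rabs.
  + now apply ex_RInt_cont.
  + intros r Hr; apply H; lra.
- pose proof (eq_RInt_derive (fun r => C / lam * exp (lam * r))
    (fun r => C * exp (lam * r)) 0 t) as E.
  simpl in E; rewrite Rmult_0_r, exp_0 in E.
  assert (0 <= C / lam) by (apply Rdiv_le_0_compat; lra).
  rewrite E; [lra | | auto].
  intros r _; auto_derive; auto; field; lra.
Qed.

Lemma C0_cone_slices G x z : C0 G ->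
  forall t, continuous (fun t => RInt (fun y => G t y) (t - x + z) (x - t + z)) t.
Proof.
intros HG t.
pose proof (C0_RInt G HG) as CH.
apply (continuous_ext (fun t => minus (RInt (fun y => G t y) 0 (x - t + z))
                           (RInt (fun y => G t y) 0 (t - x + z)))).
- intros r; rewrite <- (RInt_Chasles (fun y => G r y) 0 (r - x + z) (x - r + z))
    by (apply ex_RInt_cont; intros; now apply C0_slice2).
  assert (E : forall a b : R, minus (plus a b) a = b)
    by (intros; unfold minus, plus, opp; simpl; ring); apply E.
- apply (continuous_minus (V := R_NormedModule)
    (fun t => RInt (fun y => G t y) 0 (x - t + z))
    (fun t => RInt (fun y => G t y) 0 (t - x + z))).
  + apply (C0_slice _ (fun t => t) (fun t => x - t + z) t CH).
    * apply continuous_id.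
    * apply (ex_derive_continuous (fun t => x - t + z)); auto_derive; auto.
  + apply (C0_slice _ (fun t => t) (fun t => t - x + z) t CH).
    * apply continuous_id.
    * apply (ex_derive_continuous (fun t => t - x + z)); auto_derive; auto.
Qed.

(** * Estimates on backward light cones *)

Definition past_cone (x z t y : R) : Prop := 0 <= t <= x /\ Rabs (y - z) <= x - t.

Lemma past_cone_apex x z : 0 <= x -> past_cone x z x z.
Proof. intros H; split; [lra|]; rewrite Rminus_diag, Rabs_R0; lra. Qed.

Lemma past_cone_trans x z t y t' y' : past_cone x z t y -> past_cone t y t' y' ->
  past_cone x z t' y'.
Proof.
intros [H1 H2] [H3 H4]; split; [lra|].
replace (y' - z) with ((y' - y) + (y - z)) by ring.
eapply Rle_trans; [apply Rabs_triang | lra].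
Qed.

(** The region ahead of the front contains the past cones of its points, so the estimates can be run
    inside it. *)
Lemma past_cone_front x z t y : x <= z -> past_cone x z t y -> t <= y.
Proof. intros H [H1 H2]; apply Rabs_le_between in H2; lra. Qed.

Lemma past_cone_rectangle x z t y : past_cone x z t y ->
  0 <= t <= x /\ z - x <= y <= z + x.
Proof. intros [H1 H2]; apply Rabs_le_between in H2; lra. Qed.

Lemma C0_bounded_on_past_cone f x z : C0 f ->
  exists M, 0 < M /\ forall t y, past_cone x z t y -> Rabs (f t y) <= M.
Proof.
intros Hf; destruct (C0_bounded_on_rectangle f 0 x (z - x) (z + x) Hf)
  as (M & HM & H).
exists M; split; auto; intros t y Hp; apply past_cone_rectangle in Hp.
apply H; apply Hp.
Qed.

Lemma exp_ge_1 y : 0 <= y -> 1 <= exp y.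
Proof. intros H; pose proof (exp_ineq1_le y); lra. Qed.

Lemma vanishes_on_past_cone (f : R -> R -> R) x z lam : C0 f -> 0 <= lam ->
  (forall M, 0 <= M ->
     (forall t y, past_cone x z t y -> Rabs (f t y) <= M * exp (lam * t)) ->
     forall t y, past_cone x z t y -> Rabs (f t y) <= M / 2 * exp (lam * t)) ->
  forall t y, past_cone x z t y -> f t y = 0.
Proof.
intros Hf Hl; destruct (C0_bounded_on_past_cone f x z Hf) as (M & HM & H).
apply (vanishes_of_halving _ f lam M); [lra|].
intros t y Hp; eapply Rle_trans; [now apply H|].
rewrite <- (Rmult_1_r M) at 1; apply Rmult_le_compat_l; [lra|].
apply exp_ge_1, Rmult_le_pos; auto; apply Hp.
Qed.

Lemma cone_integral_bound G C lam x z : C0 G -> 0 <= x -> 0 < lam -> 0 <= C ->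
  (forall t y, past_cone x z t y -> Rabs (G t y) <= C * exp (lam * t)) ->
  Rabs (cone_integral G x z) <= 2 * x * C / lam * exp (lam * x).
Proof.
intros HG Hx Hl HC H; apply Rabs_RInt_exp_le; auto.
- apply Rmult_le_pos; lra.
- now apply C0_cone_slices.
- intros t Ht; pose proof (exp_pos (lam * t)).
  assert (HC' : 0 <= C * exp (lam * t)) by (apply Rmult_le_pos; lra).
  eapply Rle_trans; [apply (Rabs_RInt_le _ _ _ (C * exp (lam * t)))|].
  + intros y; now apply C0_slice2.
  + rewrite Rmin_left, Rmax_right by lra; intros y Hy; apply H.
    split; auto; apply Rabs_le; lra.
  + replace (x - t + z - (t - x + z)) with (2 * (x - t)) by ring.
    rewrite Rabs_right by lra.
    rewrite (Rmult_assoc (2 * x)); apply Rmult_le_compat_r; lra.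
Qed.

Lemma linear_wave_vanishes A K x z : C0 A -> C0 K -> 0 <= x ->
  (forall t y, past_cone x z t y ->
     A t y = cone_integral (fun t y => K t y * A t y) t y) ->
  A x z = 0.
Proof.
intros HA HK Hx H.
destruct (C0_bounded_on_past_cone K x z HK) as (C & HC & HKC).
(* The cone integral contributes the factor [2 * x * C / lam], which this choice keeps below one
   half. *)
set (lam := 4 * x * C + 1).
assert (H0 : 0 <= x * C) by (apply Rmult_le_pos; lra).
assert (Hlam : 0 < lam) by (unfold lam; lra).
apply (vanishes_on_past_cone A x z lam); [auto | lra | | now apply past_cone_apex].
intros M HM HAM t y Hp; rewrite H by auto.
assert (HCM : 0 <= C * M) by (apply Rmult_le_pos; lra).
eapply Rle_trans; [apply (cone_integral_bound _ (C * M) lam)|].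
- now apply C0_mult.
- apply Hp.
- auto.
- auto.
- intros t' y' Hp'; pose proof (past_cone_trans _ _ _ _ _ _ Hp Hp') as Hp2.
  rewrite Rabs_mult, Rmult_assoc.
  apply Rmult_le_compat; try apply Rabs_pos; auto.
- apply Rmult_le_compat_r; [left; apply exp_pos|].
  apply Rmult_le_reg_r with lam; auto.
  unfold Rdiv at 1; rewrite Rmult_assoc, Rinv_l, Rmult_1_r by lra.
  destruct Hp as [Ht _].
  assert (t * (C * M) <= x * (C * M)) by (apply Rmult_le_compat_r; lra).
  unfold lam; nra.
Qed.

(** * Trajectories and recovered quantities *)

Lemma C1_const a : C1 (fun _ _ => a).
Proof. eapply partials_C1, partials_const. Qed.

Lemma C1_plus f g : C1 f -> C1 g -> C1 (fun x z => f x z + g x z).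
Proof.
intros Hf Hg.
exact (partials_C1 _ _ _
  (partials_plus _ _ _ _ _ _ (C1_partials _ Hf) (C1_partials _ Hg))).
Qed.

Lemma C1_minus f g : C1 f -> C1 g -> C1 (fun x z => f x z - g x z).
Proof.
intros Hf Hg.
exact (partials_C1 _ _ _
  (partials_minus _ _ _ _ _ _ (C1_partials _ Hf) (C1_partials _ Hg))).
Qed.

Lemma C1_mult f g : C1 f -> C1 g -> C1 (fun x z => f x z * g x z).
Proof.
intros Hf Hg.
exact (partials_C1 _ _ _
  (partials_mult _ _ _ _ _ _ (C1_partials _ Hf) (C1_partials _ Hg))).
Qed.

Lemma C1_scal a f : C1 f -> C1 (fun x z => a * f x z).
Proof.
intros Hf; exact (partials_C1 _ _ _ (partials_scal a _ _ _ (C1_partials _ Hf))).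
Qed.

Lemma C1_pow2 f : C1 f -> C1 (fun x z => f x z ^ 2).
Proof.
intros Hf; exact (partials_C1 _ _ _ (partials_pow2 _ _ _ (C1_partials _ Hf))).
Qed.

Lemma C1_div f g : (forall x z, g x z <> 0) -> C1 f -> C1 g ->
  C1 (fun x z => f x z / g x z).
Proof.
intros Hn Hf Hg.
exact (partials_C1 _ _ _
  (partials_div _ _ _ _ _ _ Hn (C1_partials _ Hf) (C1_partials _ Hg))).
Qed.

Lemma C1_sqnorm v : (forall i, C1 (v i)) -> C1 (sqnorm v).
Proof. intros H; apply C1_plus; apply C1_pow2; apply H. Qed.

Lemma C0_tilde f g : C0 f -> C0 g -> C0 (tilde f g).
Proof. intros Hf Hg; apply (C0_comp g (fun x _ => x) f); auto; apply C0_fst. Qed.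

Lemma d_minus_scal a f x z : C1 f ->
  d_minus (fun t y => a * f t y) x z = a * d_minus f x z.
Proof.
intros Hf; pose proof (partials_scal a _ _ _ (C1_partials _ Hf)) as P.
unfold d_minus; rewrite (partials_d_0 _ _ _ P), (partials_d_z _ _ _ P); ring.
Qed.

Lemma C0_d_minus f : C1 f -> C0 (d_minus f).
Proof.
intros (_ & _ & H & K); apply C0_mult; [apply C0_const | now apply C0_plus].
Qed.

Lemma sum_species_ext D f g : (forall h, species D h -> f h = g h) ->
  sum_species D f = sum_species D g.
Proof. intros H; apply sum_n_m_ext_loc; exact H. Qed.

Lemma sum_species_scal D a f :
  sum_species D (fun h => a * f h) = a * sum_species D f.
Proof. apply (sum_n_m_mult_l (K := R_Ring) a f). Qed.

Lemma sum_species_0 D f : (forall h, species D h -> f h = 0) ->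
  sum_species D f = 0.
Proof.
intros H; rewrite (sum_species_ext D f (fun _ => 0)) by auto.
apply (sum_n_m_const_zero (G := R_AbelianMonoid)).
Qed.

Lemma Rabs_sum_species_le D f g B :
  (forall h, species D h -> Rabs (f h) <= g h * B) ->
  Rabs (sum_species D f) <= sum_species D g * B.
Proof.
unfold sum_species, species; induction (k D) as [|K IH]; intros H.
- rewrite !sum_n_m_zero by lia; unfold zero; simpl.
  rewrite Rabs_R0; lra.
- rewrite !sum_n_Sm by lia; unfold plus; simpl.
  eapply Rle_trans; [apply Rabs_triang|]; rewrite Rmult_plus_distr_r.
  apply Rplus_le_compat; [apply IH; intros; apply H; lia | apply H; lia].
Qed.

(** Differentiating the integral equation in [Z] gives a linear integral equation for [d_z f]. For a
    flow that is only C1 this replaces the time derivative of [d_z f]. *)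
Lemma flow_jacobian B f x : C1 B -> C1 f ->
  (forall t Z, Rmin 0 x <= t <= Rmax 0 x ->
     f t Z = Z + RInt (fun t' => B t' (f t' Z)) 0 t) ->
  forall Z, d_z f x Z = exp (RInt (fun t => d_z B t (f t Z)) 0 x).
Proof.
intros HB Hf H Z.
pose proof (C1_partials _ HB) as (B1 & B2 & B3 & B4).
pose proof (C1_partials _ Hf) as (F1 & F2 & F3 & F4).
pose proof (C1_C0 _ Hf) as Cf; pose proof (C1_C0 _ HB) as CB.
(* The label [Z] of the trajectory becomes the parameter, the first argument expected by
   [partials_RInt]. *)
assert (Sw : forall K, C0 K -> C0 (fun v t => K t v)).
{ intros K HK; apply (C0_comp K (fun _ t => t) (fun v _ => v)); auto;
    [apply C0_snd | apply C0_fst]. }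
assert (SwB : forall K, C0 K -> C0 (fun v t => K t (f t v))).
{ intros K HK; apply (C0_comp K (fun _ t => t) (fun v t => f t v)); auto.
  apply C0_snd. }
assert (P : partials (fun v x => RInt (fun t => B t (f t v)) 0 x)
  (fun v x => RInt (fun t => d_z B t (f t v) * d_z f t v) 0 x)
  (fun v t => B t (f t v))).
{ apply (partials_RInt (fun v t => B t (f t v))
           (fun v t => d_z B t (f t v) * d_z f t v)); auto.
  - apply (C0_mult (fun v t => d_z B t (f t v)) (fun v t => d_z f t v)); auto.
  - intros v t; rewrite Rmult_comm.
    apply (is_derive_comp (B t) (f t)); auto. }
apply (exp_of_integral_equation (fun t => d_z B t (f t Z)) (fun t => d_z f t Z)).
- intros y; apply (C0_slice2 (fun v t => d_z B t (f t v)) Z); auto.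
- intros y; now apply (C0_slice1 (d_z f)).
- intros t Ht; apply is_derive_unique.
  apply (is_derive_ext (fun v => v + RInt (fun t' => B t' (f t' v)) 0 t)).
  + intros v; symmetry; apply H; auto.
  + apply (is_derive_plus (K := R_AbsRing) (fun v => v)
             (fun v => RInt (fun t' => B t' (f t' v)) 0 t)).
    * apply (is_derive_id Z).
    * apply (proj1 P Z t).
Qed.

Lemma antitone_of_derive (f df : R -> R) a b : a <= b ->
  (forall t, is_derive f t (df t)) -> (forall t, a <= t <= b -> df t <= 0) ->
  f b <= f a.
Proof.
intros Hab Hd Hn; destruct (MVT_gen f a b df) as (t & Ht & E).
- auto.
- intros t _; apply continuity_pt_filterlim.
  apply (ex_derive_continuous f); now exists (df t).
- rewrite Rmin_left, Rmax_right in Ht by auto.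
  assert (df t * (b - a) <= 0); [|lra].
  specialize (Hn t Ht).
  assert (0 <= - df t * (b - a)) by (apply Rmult_le_pos; lra); lra.
Qed.

(* Ahead of the light cone a particle is at rest, and a subluminal trajectory
   can never re-enter that region. *)
Lemma at_rest_before_front (B : R -> R -> R) f Z :
  (forall t, is_derive f t (B t (f t))) -> (forall t z, B t z < 1) ->
  (forall t z, t <= z -> B t z = 0) -> f 0 = Z -> 0 <= Z ->
  forall t, t <= Z -> f t = Z.
Proof.
intros Hf Hlt H0 Hini HZ.
assert (Hd : forall t, is_derive (fun t => f t - t) t (B t (f t) - 1)).
{ intros t; apply (is_derive_minus (K := R_AbsRing) f (fun t => t)); auto.
  apply (is_derive_id t). }
assert (Hmono : forall a b, a <= b -> f b - b <= f a - a).
{ intros a b Hab; apply (antitone_of_derive (fun t => f t - t)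
    (fun t => B t (f t) - 1)); auto.
  intros t _; specialize (Hlt t (f t)); lra. }
assert (Hrest : forall t, t <= f t -> 0 <= t -> f t = Z).
{ intros t Ht Ht0; rewrite <- Hini; apply constant_of_is_derive_0.
  rewrite Rmin_left, Rmax_right by auto; intros r Hr.
  rewrite <- (H0 r (f r)); auto.
  specialize (Hmono r t ltac:(lra)); lra. }
intros t HtZ; destruct (Rle_lt_dec t 0) as [Ht|Ht].
- rewrite <- Hini; apply constant_of_is_derive_0.
  rewrite Rmin_right, Rmax_left by auto; intros r Hr.
  rewrite <- (H0 r (f r)); auto.
  specialize (Hmono r 0 ltac:(lra)); lra.
- apply Hrest; [|lra]; destruct (Rle_lt_dec t (f t)) as [|Hc]; auto; exfalso.
  (* The trajectory would meet the front at some [r <= t] with [r = f r = Z]. As [t <= Z], this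
     forces [r = t], contradicting [f t < t]. *)
  destruct (IVT_cor (fun r => r - f r) 0 t) as (r & Hr & Er).
  + intros r; apply continuity_pt_filterlim.
    apply (continuous_minus (fun r : R => r) f).
    * apply continuous_id.
    * apply (ex_derive_continuous f); exists (B r (f r)); auto.
  + lra.
  + rewrite Hini.
    assert (0 <= (Z - 0) * (t - f t)) by (apply Rmult_le_pos; lra); lra.
  + assert (f r = Z) by (apply Hrest; lra).
    assert (r = t) by lra; subst r; lra.
Qed.

Lemma gamma_formula (b2 bz : R) : b2 + bz ^ 2 < 1 ->
  let g := / sqrt (1 - (b2 + bz ^ 2)) in
  0 < g /\ g ^ 2 = 1 + g ^ 2 * b2 + (g * bz) ^ 2.
Proof.
intros H g; assert (Hr : 0 < sqrt (1 - (b2 + bz ^ 2))) by (apply sqrt_lt_R0; lra).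
split; [now apply Rinv_0_lt_compat|].
assert (E : g ^ 2 * (1 - (b2 + bz ^ 2)) = 1).
{ unfold g; rewrite <- (sqrt_sqrt (1 - (b2 + bz ^ 2))) at 2 by lra; field; lra. }
lra.
Qed.

Lemma abs_lt_1_of_sq (b2 bz : R) : 0 <= b2 -> b2 + bz ^ 2 < 1 -> -1 < bz < 1.
Proof. intros; split; nra. Qed.

(** The mass-shell relation factors as [(g - uz) * (g + uz) = 1 + u2], so [s] determines both the
    difference and the sum. *)
Lemma recovery_formulas (g u2 uz s : R) : g ^ 2 = 1 + u2 + uz ^ 2 -> s = g - uz ->
  0 < s -> 0 <= u2 ->
  g = (1 + u2 + s ^ 2) / (2 * s) /\ uz = (1 + u2 - s ^ 2) / (2 * s).
Proof.
intros E -> Hs Hu.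
assert (1 + u2 = (g - uz) * (g + uz)) by lra.
split; apply Rmult_eq_reg_r with (2 * (g - uz)); try lra; unfold Rdiv;
  rewrite Rmult_assoc, Rinv_l by lra; nra.
Qed.

Lemma partials_Ncum D Zbar h a a0 az : (forall Z, continuous (n0 D h) Z) ->
  partials a a0 az ->
  partials (fun x z => Ncum D Zbar h (a x z))
    (fun x z => n0 D h (a x z) * a0 x z) (fun x z => n0 D h (a x z) * az x z).
Proof.
intros Hc Ha; apply (partials_comp1 (Ncum D Zbar h) (n0 D h)); auto.
intros; now apply (is_derive_RInt_cont (n0 D h)).
Qed.

Lemma partials_rec_Ez D Zbar U (Z0 Zz : nat -> R -> R -> R) :
  (forall h, species D h -> forall Z, continuous (n0 D h) Z) ->
  (forall h, species D h -> partials (uZl U h) (Z0 h) (Zz h)) ->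
  partials (rec_Ez D Zbar U)
    (fun x z => 4 * PI * sum_species D
       (fun h => q D h * (n0 D h (uZl U h x z) * Z0 h x z)))
    (fun x z => 4 * PI * sum_species D
       (fun h => q D h * (n0 D h (uZl U h x z) * Zz h x z))).
Proof.
intros Hc HZ; apply partials_scal; apply partials_sum; intros h Hh.
apply partials_scal; apply partials_Ncum; auto.
Qed.

(** The derivative of the sum is the neutral initial charge density and its value at [Zbar] is zero.
    Hence [E^z] vanishes where all fluids have the same [Z], whatever the base point. *)
Lemma neutral_Ncum D Zbar Z : admissible D ->
  sum_species D (fun h => q D h * Ncum D Zbar h Z) = 0.
Proof.
intros (_ & _ & _ & Hc & _ & Hn & _).
assert (P : partials
  (fun _ z => sum_species D (fun h => q D h * Ncum D Zbar h z))
  (fun _ z => sum_species D (fun h => q D h * (n0 D h z * 0)))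
  (fun _ z => sum_species D (fun h => q D h * (n0 D h z * 1)))).
{ apply (partials_sum _ (fun h (_ z : R) => q D h * Ncum D Zbar h z)
    (fun h (_ z : R) => q D h * (n0 D h z * 0))
    (fun h (_ z : R) => q D h * (n0 D h z * 1))); intros h Hh.
  apply partials_scal.
  apply (partials_Ncum D Zbar h _ _ _ (Hc h Hh) partials_snd). }
rewrite (constant_of_is_derive_0
  (fun z => sum_species D (fun h => q D h * Ncum D Zbar h z)) Zbar Z).
- apply sum_species_0; intros h _; unfold Ncum; rewrite RInt_point.
  apply Rmult_0_r.
- intros z _; rewrite <- (Hn z).
  rewrite (sum_species_ext D (fun h => q D h * n0 D h z)
             (fun h => q D h * (n0 D h z * 1))) by (intros; ring).
  apply (proj1 (proj2 P) 0 z).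
Qed.

Lemma sqnorm_nonneg v x z : 0 <= sqnorm v x z.
Proof. unfold sqnorm; nra. Qed.

(** * From the plasma equations to the integral equations *)

Lemma C1_gamma F h :
  (forall x z, sqnorm (betap F h) x z + betaz F h x z ^ 2 < 1) ->
  (forall i, C1 (betap F h i)) -> C1 (betaz F h) -> C1 (gamma F h).
Proof.
intros Hlt Hp Hz.
assert (P : C1 (fun x z => 1 - (sqnorm (betap F h) x z + betaz F h x z ^ 2))).
{ apply C1_minus; [apply C1_const|]; apply C1_plus;
    [now apply C1_sqnorm | now apply C1_pow2]. }
eapply partials_C1.
apply (partials_comp1 (fun y => / sqrt y)
  (fun y => - (/ (2 * sqrt y)) / sqrt y ^ 2) _ _ _ (C1_partials _ P));
  intros x z; specialize (Hlt x z);
  set (y := 1 - (sqnorm (betap F h) x z + betaz F h x z ^ 2));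
  assert (Hy : 0 < y) by (unfold y; lra); pose proof (sqrt_lt_R0 y Hy).
- apply (is_derive_inv sqrt); [|lra].
  apply is_derive_Reals, (derivable_pt_lim_sqrt y Hy).
- apply (ex_derive_continuous (fun y => - (/ (2 * sqrt y)) / sqrt y ^ 2)).
  auto_derive; repeat split; auto; apply Rgt_not_eq; nra.
Qed.

Section PlasmaSolution.

Variables (D : plasma_data) (F : fields) (h : nat).
Hypothesis HD : admissible D.
Hypothesis HF : plasma_solution D F.
Hypothesis Hh : species D h.

Lemma mass_pos : 0 < m D h * c D ^ 2.
Proof.
destruct HD as (_ & Hc & Hm & _); apply Rmult_lt_0_compat; auto.
now apply pow_lt.
Qed.

Lemma sol_C0_n : C0 (n F h).
Proof.
destruct HF as ((_ & _ & H) & _); destruct (H h Hh) as (H1 & H2 & H3 & H4); exact H1.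
Qed.

Lemma sol_C1_betap i : C1 (betap F h i).
Proof.
destruct HF as ((_ & _ & H) & _); destruct (H h Hh) as (H1 & H2 & H3 & H4); exact (H2 i).
Qed.

Lemma sol_C1_betaz : C1 (betaz F h).
Proof.
destruct HF as ((_ & _ & H) & _); destruct (H h Hh) as (H1 & H2 & H3 & H4); exact H3.
Qed.

Lemma sol_C1_zl : C1 (zl F h).
Proof.
destruct HF as ((_ & _ & H) & _); destruct (H h Hh) as (H1 & H2 & H3 & H4); exact H4.
Qed.

Lemma sol_C2_Ap i : C2 (Ap F i).
Proof. destruct HF as ((H & _) & _); exact (H i). Qed.

Lemma sol_C1_Ap i : C1 (Ap F i).
Proof. exact (proj1 (sol_C2_Ap i)). Qed.

Lemma sol_C1_Ez : C1 (Ez F).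
Proof. destruct HF as ((_ & H & _) & _); exact H. Qed.

Lemma sol_subluminal x z : sqnorm (betap F h) x z + betaz F h x z ^ 2 < 1.
Proof.
destruct HF as (_ & H & _); destruct (H h Hh) as (H1 & H2 & H3 & H4); apply H1.
Qed.

Lemma sol_betaz_lt x z : betaz F h x z < 1.
Proof.
apply (abs_lt_1_of_sq _ _ (sqnorm_nonneg (betap F h) x z) (sol_subluminal x z)).
Qed.

Lemma sol_zl_Zl x z : zl F h x (Zl F h x z) = z.
Proof.
destruct HF as (_ & H & _); destruct (H h Hh) as (H1 & H2 & H3 & H4); apply H4.
Qed.

Lemma sol_Zl_zl x Z : Zl F h x (zl F h x Z) = Z.
Proof.
destruct HF as (_ & H & _); destruct (H h Hh) as (H1 & H2 & H3 & H4); apply H3.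
Qed.

Lemma sol_zl_increasing x Z Z' : Z < Z' -> zl F h x Z < zl F h x Z'.
Proof.
destruct HF as (_ & H & _); destruct (H h Hh) as (H1 & H2 & H3 & H4); apply H2.
Qed.

Lemma sol_motion_z t Z :
  is_derive (fun t => zl F h t Z) t (betaz F h t (zl F h t Z)).
Proof.
destruct HF as (_ & _ & _ & _ & _ & H & _); destruct (H h Hh) as (H1 & _).
apply H1.
Qed.

Lemma sol_zl_0 Z : zl F h 0 Z = Z.
Proof.
destruct HF as (_ & _ & _ & _ & _ & _ & _ & _ & H).
destruct (H h Hh) as (_ & H1 & _); apply H1.
Qed.

Lemma sol_C1_gamma : C1 (gamma F h).
Proof.
apply C1_gamma; [apply sol_subluminal | apply sol_C1_betap | apply sol_C1_betaz].
Qed.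

Lemma sol_C1_up i : C1 (up F h i).
Proof. apply C1_mult; [apply sol_C1_gamma | apply sol_C1_betap]. Qed.

Lemma sol_C1_uz : C1 (uz F h).
Proof. apply C1_mult; [apply sol_C1_gamma | apply sol_C1_betaz]. Qed.

Lemma sol_C1_s : C1 (s F h).
Proof. apply C1_minus; [apply sol_C1_gamma | apply sol_C1_uz]. Qed.

Lemma sol_gamma_pos x z : 0 < gamma F h x z.
Proof. apply (gamma_formula _ _ (sol_subluminal x z)). Qed.

Lemma sol_gamma_sq x z :
  gamma F h x z ^ 2 = 1 + sqnorm (up F h) x z + uz F h x z ^ 2.
Proof.
destruct (gamma_formula _ _ (sol_subluminal x z)) as [_ E].
unfold gamma at 1; rewrite E; unfold sqnorm, up, uz, gamma; unfold sqnorm; ring.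
Qed.

Lemma sol_s_pos x z : 0 < s F h x z.
Proof.
unfold s, uz; pose proof (sol_gamma_pos x z); pose proof (sol_betaz_lt x z).
replace (gamma F h x z - gamma F h x z * betaz F h x z)
  with (gamma F h x z * (1 - betaz F h x z)) by ring.
apply Rmult_lt_0_compat; lra.
Qed.

Lemma sol_gamma_recovery x z :
  gamma F h x z = (1 + sqnorm (up F h) x z + s F h x z ^ 2) / (2 * s F h x z).
Proof.
apply (recovery_formulas _ _ (uz F h x z)); auto using sol_gamma_sq, sol_s_pos,
  sqnorm_nonneg.
Qed.

Lemma sol_uz_recovery x z :
  uz F h x z = (1 + sqnorm (up F h) x z - s F h x z ^ 2) / (2 * s F h x z).
Proof.
apply (recovery_formulas (gamma F h x z)); auto using sol_gamma_sq, sol_s_pos,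
  sqnorm_nonneg.
Qed.

Lemma is_derive_trajectory f t Z : C1 f ->
  is_derive (fun r => f r (zl F h r Z)) t (material F h f t (zl F h t Z)).
Proof.
intros Hf; unfold material.
replace (d_0 f t (zl F h t Z) + betaz F h t (zl F h t Z) * d_z f t (zl F h t Z))
  with (d_0 f t (zl F h t Z) * 1
        + d_z f t (zl F h t Z) * betaz F h t (zl F h t Z)) by ring.
apply (partials_curve f _ _ (fun r => r) (fun r => zl F h r Z)).
- now apply C1_partials.
- apply (is_derive_id t).
- apply sol_motion_z.
Qed.

Lemma sol_betaz_front x z : x <= z -> betaz F h x z = 0.
Proof.
intros H; destruct HF as (_ & _ & _ & _ & _ & _ & Ha & _).
destruct (Ha x z H) as (_ & _ & Ha'); destruct (Ha' h Hh) as (_ & Hu & _).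
unfold uz in Hu; apply Rmult_integral in Hu; destruct Hu as [Hu|]; auto.
pose proof (sol_gamma_pos x z); lra.
Qed.

Lemma sol_zl_front t Z : 0 <= Z -> t <= Z -> zl F h t Z = Z.
Proof.
intros HZ; revert t.
apply (at_rest_before_front (betaz F h) (fun t => zl F h t Z)); auto.
- intros; apply sol_motion_z.
- apply sol_betaz_lt.
- apply sol_betaz_front.
- apply sol_zl_0.
Qed.

Lemma sol_zl_integral t Z :
  zl F h t Z = Z + RInt (fun r => betaz F h r (zl F h r Z)) 0 t.
Proof.
rewrite <- (sol_zl_0 Z) at 2.
apply (eq_RInt_derive (fun t => zl F h t Z)).
- intros; apply sol_motion_z.
- intros r _; apply (C0_slice1 (tilde (zl F h) (betaz F h))).
  apply C0_tilde; apply C1_C0; [apply sol_C1_zl | apply sol_C1_betaz].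
Qed.

(** Strict monotonicity alone would allow zeros of the derivative; the exponential form excludes
    them and makes [Z_h] differentiable. *)
Lemma sol_jacobian_pos t Z : 0 < d_z (zl F h) t Z.
Proof.
rewrite (flow_jacobian (betaz F h)); auto using sol_C1_betaz, sol_C1_zl.
- apply exp_pos.
- intros; apply sol_zl_integral.
Qed.

Lemma sol_partials_Zl : partials (Zl F h)
  (fun x z => - d_0 (zl F h) x (Zl F h x z) / d_z (zl F h) x (Zl F h x z))
  (fun x z => / d_z (zl F h) x (Zl F h x z)).
Proof.
apply (partials_inverse (zl F h) (d_0 (zl F h)) (d_z (zl F h)) (Zl F h));
  auto using sol_zl_increasing, sol_zl_Zl, sol_Zl_zl, sol_jacobian_pos.
apply C1_partials, sol_C1_zl.
Qed.

Lemma sol_density x z : n F h x z = n0 D h (Zl F h x z) * d_z (Zl F h) x z.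
Proof.
destruct HF as (_ & _ & _ & _ & H & _); specialize (H h Hh x (Zl F h x z)).
unfold tilde in H; rewrite sol_zl_Zl in H.
rewrite (partials_d_z _ _ _ sol_partials_Zl), <- H.
pose proof (sol_jacobian_pos x (Zl F h x z)); field; lra.
Qed.

(** An element with [0 <= Z] rests at [Z] until time [Z], so it is never found at [z < 0] before
    time [0]. Together with the support of [n0] this empties that quadrant. *)
Lemma sol_Zl_past x z : x <= 0 -> z < 0 -> Zl F h x z < 0.
Proof.
intros Hx Hz; destruct (Rlt_le_dec (Zl F h x z) 0) as [|H]; auto; exfalso.
pose proof (sol_zl_front x _ H ltac:(lra)) as E; rewrite sol_zl_Zl in E; lra.
Qed.

(** Why [s_h] is the convenient variable: in the difference of the two Lorentz equations [E^z] is
    multiplied by [uz / gamma - 1], which is [- s / gamma], and the wave enters through [d_minus]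
    only. *)
Lemma sol_material_s x z :
  material F h (s F h) x z
  = - (q D h * Ez F x z / (m D h * c D ^ 2)) / gamma F h x z * s F h x z
    + (q D h / (m D h * c D ^ 2)) ^ 2 * d_minus (sqnorm (Ap F)) x z
      / gamma F h x z.
Proof.
destruct HF as (_ & _ & _ & HL & _); destruct (HL h Hh x z) as (_ & Lg & Lu).
pose proof (partials_minus _ _ _ _ _ _ (C1_partials _ sol_C1_gamma)
              (C1_partials _ sol_C1_uz)) as P.
unfold material in *; unfold s at 1 2.
rewrite (partials_d_0 _ _ _ P), (partials_d_z _ _ _ P).
transitivity ((d_0 (gamma F h) x z + betaz F h x z * d_z (gamma F h) x z)
              - (d_0 (uz F h) x z + betaz F h x z * d_z (uz F h) x z)); [ring|].
pose proof (sol_gamma_pos x z); pose proof mass_pos.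
destruct HD as (_ & Hc & Hm & _); specialize (Hm h Hh).
replace (d_0 (gamma F h) x z + betaz F h x z * d_z (gamma F h) x z) with
  (q D h * uz F h x z * Ez F x z / (m D h * c D ^ 2 * gamma F h x z)
   + q D h ^ 2 * d_0 (sqnorm (Ap F)) x z
     / (2 * gamma F h x z * m D h ^ 2 * c D ^ 4)) by lra.
replace (d_0 (uz F h) x z + betaz F h x z * d_z (uz F h) x z) with
  (q D h * Ez F x z / (m D h * c D ^ 2)
   - q D h ^ 2 * d_z (sqnorm (Ap F)) x z
     / (2 * gamma F h x z * m D h ^ 2 * c D ^ 4)) by lra.
unfold d_minus, s; field; lra.
Qed.

End PlasmaSolution.

(** * The plasma before [x0 = 0] *)

Lemma free_wave_d_plus f al : C1 f -> (forall x z, x <= 0 -> f x z = al (x - z)) ->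
  forall x z, x <= 0 -> d_0 f x z + d_z f x z = 0.
Proof.
intros Hf E.
assert (Hlt : forall x z, x < 0 -> d_0 f x z + d_z f x z = 0).
{ intros x z Hx.
  pose proof (is_derive_along_plus _ _ _ (z - x) x (C1_partials _ Hf)) as H.
  replace (z - x + x) with z in H by ring.
  apply (is_derive_inj _ _ _ _ H).
  apply (is_derive_ext_loc (fun _ => al (x - z))).
  - generalize (locally_gt 0 x Hx); apply filter_imp; intros r Hr.
    rewrite E by lra; f_equal; ring.
  - apply (is_derive_const (al (x - z))). }
intros x z [Hx| ->]; auto.
destruct Hf as (_ & _ & H0 & Hz).
apply (continuous_eq_left (fun t => d_0 f t z + d_z f t z) (fun _ => 0)); auto.
- apply (C0_slice1 (fun t z => d_0 f t z + d_z f t z)); now apply C0_plus.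
- apply continuous_const.
Qed.

Lemma free_wave_d_minus_sqnorm (A : Perp -> R -> R -> R) (al : Perp -> R -> R) :
  (forall i, C1 (A i)) -> (forall i x z, x <= 0 -> A i x z = al i (x - z)) ->
  forall x z, x <= 0 -> d_minus (sqnorm A) x z = 0.
Proof.
intros HA E x z Hx; unfold d_minus.
rewrite (free_wave_d_plus (sqnorm A) (fun y => al px y ^ 2 + al py y ^ 2)); auto.
- ring.
- now apply C1_sqnorm.
- intros t y Ht; unfold sqnorm; rewrite !E by auto; reflexivity.
Qed.

Section PlasmaSolutionPast.

Variables (D : plasma_data) (F : fields).
Hypothesis HD : admissible D.
Hypothesis HF : plasma_solution D F.

Lemma sol_free_wave i x z : x <= 0 -> Ap F i x z = alpha D i (x - z).
Proof. destruct HF as (_ & _ & _ & _ & _ & _ & _ & H & _); apply H. Qed.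

(** To the left of the origin there is no matter yet; to the right the point lies ahead of the
    front, where the densities are the neutral initial ones. *)
Lemma sol_past_charge x z : x <= 0 ->
  sum_species D (fun h => q D h * n F h x z) = 0.
Proof.
intros Hx; pose proof HD as (_ & _ & _ & _ & Hneg & Hneut & _).
destruct (Rlt_le_dec z 0) as [Hz|Hz].
- apply sum_species_0; intros h Hh.
  rewrite (sol_density D F h HF Hh), Hneg; auto; [ring|].
  now apply (sol_Zl_past D).
- rewrite <- (Hneut z); apply sum_species_ext; intros h Hh; f_equal.
  destruct HF as (_ & _ & _ & _ & _ & _ & Ha & _).
  apply (Ha x z ltac:(lra)), Hh.
Qed.

Lemma sol_past_Ez x z : x <= 0 -> Ez F x z = 0.
Proof.
intros Hx; transitivity (Ez F x 0).
- apply (constant_of_is_derive_0 (Ez F x)); intros y _.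
  pose proof (C1_partials _ (sol_C1_Ez D F HF)) as (_ & P & _).
  destruct HF as (_ & _ & HM & _); destruct (HM x y) as (E & _).
  rewrite sol_past_charge, Rmult_0_r in E by auto; rewrite <- E; apply P.
- destruct HF as (_ & _ & _ & _ & _ & _ & Ha & _); now apply Ha.
Qed.

Variable h : nat.
Hypothesis Hh : species D h.

(** Both terms driving [s_h] are absent: [E^z] vanishes and [d_minus] annihilates functions of
    [x0 - z]. *)
Lemma sol_past_s x z : x <= 0 -> s F h x z = 1.
Proof.
intros Hx; rewrite <- (sol_zl_Zl D F h HF Hh x z).
set (Z := Zl F h x z); transitivity (s F h 0 (zl F h 0 Z)).
- symmetry; apply (constant_of_is_derive_0 (fun t => s F h t (zl F h t Z))).
  rewrite Rmin_left, Rmax_right by auto; intros t Ht.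
  assert (E : material F h (s F h) t (zl F h t Z) = 0).
  { rewrite (sol_material_s D), sol_past_Ez by (auto; lra).
    rewrite (free_wave_d_minus_sqnorm _ (alpha D));
      [unfold Rdiv; ring | | | lra].
    - intros; now apply (sol_C1_Ap D).
    - intros; now apply sol_free_wave. }
  rewrite <- E; apply (is_derive_trajectory D); auto; now apply (sol_C1_s D).
- destruct HF as (_ & _ & _ & _ & _ & _ & _ & _ & H); now apply H.
Qed.

Definition canonical_momentum (i : Perp) (x z : R) : R :=
  m D h * c D ^ 2 * up F h i x z + q D h * Ap F i x z.

Lemma canonical_momentum_conserved i t t' Z :
  canonical_momentum i t (zl F h t Z) = canonical_momentum i t' (zl F h t' Z).
Proof.
apply (constant_of_is_derive_0
         (fun t => canonical_momentum i t (zl F h t Z))); intros r _.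
destruct HF as (_ & _ & _ & HL & _).
destruct (HL h Hh r (zl F h r Z)) as (E & _); rewrite <- (E i).
apply (is_derive_trajectory D F h HF Hh (canonical_momentum i)).
apply C1_plus; apply C1_scal;
  [now apply (sol_C1_up D) | now apply (sol_C1_Ap D)].
Qed.

Lemma canonical_momentum_front i x z : x <= z -> canonical_momentum i x z = 0.
Proof.
intros H; destruct HF as (_ & _ & _ & _ & _ & _ & Ha & _).
destruct (Ha x z H) as (HA & _ & Hu); destruct (Hu h Hh) as (Hu' & _).
unfold canonical_momentum; rewrite HA, Hu'; ring.
Qed.

(* In the free wave t - z_h grows at rate 1 / gamma_h along a trajectory, and
   gamma_h stays bounded while t - z_h does, so that the front is met at some
   finite time in the past. *)
Lemma trajectory_meets_front Z : exists t, t <= zl F h t Z.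
Proof.
destruct (Rle_lt_dec 0 Z) as [HZ|HZ].
{ exists 0; now rewrite (sol_zl_0 D). }
destruct (Classical_Prop.classic (exists t, t <= zl F h t Z)) as [|Hno]; auto.
exfalso; assert (Hxi : forall t, zl F h t Z < t).
{ intros t; apply Rnot_le_lt; intros H; apply Hno; now exists t. }
clear Hno.
set (xi := fun t => t - zl F h t Z).
assert (Dxi : forall t, is_derive xi t (1 - betaz F h t (zl F h t Z))).
{ intros t; apply (is_derive_minus (K := R_AbsRing) (fun t => t)
    (fun t => zl F h t Z)).
  - apply (is_derive_id t).
  - now apply (sol_motion_z D). }
assert (Hxi_le : forall t, t <= 0 -> 0 < xi t <= - Z).
{ intros t Ht; split; [unfold xi; specialize (Hxi t); lra|].
  assert (H : - xi 0 <= - xi t).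
  { apply (antitone_of_derive (fun t => - xi t)
      (fun t => - (1 - betaz F h t (zl F h t Z)))); auto.
    - intros r; apply (is_derive_opp (K := R_AbsRing) xi); auto.
    - intros r _; pose proof (sol_betaz_lt D F h HF Hh r (zl F h r Z)); lra. }
  unfold xi at 1 in H; rewrite (sol_zl_0 D) in H by auto; lra. }
set (mc := m D h * c D ^ 2).
assert (Hmc : 0 < mc) by (now apply (mass_pos D)).
assert (Hbound : exists K, forall t, t <= 0 -> sqnorm (up F h) t (zl F h t Z) <= K).
{ assert (Hi : forall i, exists K, forall t, t <= 0 ->
                 up F h i t (zl F h t Z) ^ 2 <= K ^ 2).
  { intros i.
    (* The free wave at [(t, z_h)] has its value at [(0, - xi t)]. As [- xi t] stays in [[Z, 0]] for
       all past times, a bound on this one segment is enough. *)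
    destruct (C0_bounded_on_rectangle (Ap F i) 0 0 Z 0) as (M & HM & HA).
    { apply C1_C0, (sol_C1_Ap D), HF. }
    set (w := canonical_momentum i 0 (zl F h 0 Z)).
    exists ((Rabs w + Rabs (q D h) * M) / mc); intros t Ht.
    assert (E : up F h i t (zl F h t Z)
                = (w - q D h * Ap F i 0 (- xi t)) / mc).
    { unfold w; rewrite (canonical_momentum_conserved i 0 t).
      unfold canonical_momentum; fold mc.
      rewrite !sol_free_wave by lra.
      replace (0 - - xi t) with (t - zl F h t Z) by (unfold xi; ring).
      field; lra. }
    rewrite E, <- Rsqr_pow2, <- Rsqr_pow2; apply Rsqr_le_abs_1.
    unfold Rdiv; rewrite !Rabs_mult.
    pose proof (Rabs_pos w); pose proof (Rabs_pos (q D h)).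
    rewrite (Rabs_right (Rabs w + Rabs (q D h) * M)) by nra.
    apply Rmult_le_compat_r; [apply Rabs_pos|].
    eapply Rle_trans; [apply Rabs_triang|]; rewrite Rabs_Ropp, Rabs_mult.
    apply Rplus_le_compat_l, Rmult_le_compat_l; auto.
    specialize (Hxi_le t Ht); apply HA; lra. }
  destruct (Hi px) as (Kx & Hx); destruct (Hi py) as (Ky & Hy).
  exists (Kx ^ 2 + Ky ^ 2); intros t Ht; unfold sqnorm.
  specialize (Hx t Ht); specialize (Hy t Ht); lra. }
destruct Hbound as (K & HK).
assert (HK0 : 0 <= K).
{ eapply Rle_trans; [|apply (HK 0 (Rle_refl 0))]; apply sqnorm_nonneg. }
(* With [s_h = 1], [1 - betaz] is [/ gamma], and [gamma] is [1] plus half of the squared transverse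
   momentum, hence at most [1 + K]. *)
assert (Hrate : forall t, t <= 0 ->
          / (1 + K) <= 1 - betaz F h t (zl F h t Z)).
{ intros t Ht; set (y := zl F h t Z).
  pose proof (sol_gamma_pos D F h HF Hh t y) as Hg.
  pose proof (sol_past_s t y Ht) as Hs.
  pose proof (sol_gamma_recovery D F h HF Hh t y) as Eg; rewrite Hs in Eg.
  specialize (HK t Ht); fold y in HK.
  assert (Es : 1 - betaz F h t y = / gamma F h t y).
  { unfold s, uz in Hs; apply Rmult_eq_reg_l with (gamma F h t y); [|lra].
    rewrite Rinv_r by lra; lra. }
  rewrite Es; apply Rinv_le_contravar; lra. }
(* Going back from [0] to [T] at a rate of at least [/ (1 + K)] lowers [xi] from [- Z] to at most
   [0], against [0 < xi]. *)
set (T := (1 + K) * Z).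
assert (HT : T <= 0) by (unfold T; nra).
assert (Hfin : xi 0 - / (1 + K) * 0 >= xi T - / (1 + K) * T).
{ apply Rle_ge.
  assert (H : - (xi 0 - / (1 + K) * 0) <= - (xi T - / (1 + K) * T)); [|lra].
  apply (antitone_of_derive (fun t => - (xi t - / (1 + K) * t))
    (fun t => - (1 - betaz F h t (zl F h t Z) - / (1 + K)))); auto.
  - intros t; apply (is_derive_opp (K := R_AbsRing)
      (fun t => xi t - / (1 + K) * t) t (1 - betaz F h t (zl F h t Z) - / (1 + K))).
    apply (is_derive_minus (K := R_AbsRing) xi (fun t => / (1 + K) * t)); auto.
    auto_derive; auto; ring.
  - intros t Ht; specialize (Hrate t ltac:(lra)); lra. }
assert (HT' : / (1 + K) * T = Z) by (unfold T; field; lra).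
rewrite HT' in Hfin; specialize (Hxi_le T HT).
unfold xi at 1 in Hfin; rewrite (sol_zl_0 D) in Hfin by auto; lra.
Qed.

Lemma sol_up i x z : up F h i x z = - q D h / (m D h * c D ^ 2) * Ap F i x z.
Proof.
rewrite <- (sol_zl_Zl D F h HF Hh x z); set (Z := Zl F h x z).
destruct (trajectory_meets_front Z) as (t & Ht).
pose proof (canonical_momentum_conserved i x t Z) as E.
rewrite (canonical_momentum_front i t) in E by auto.
unfold canonical_momentum in E; pose proof (mass_pos D h HD Hh).
destruct HD as (_ & Hc & Hm & _); specialize (Hm h Hh).
apply Rmult_eq_reg_l with (m D h * c D ^ 2); [|lra].
transitivity (- q D h * Ap F i x (zl F h x Z)); [lra | field; lra].
Qed.

End PlasmaSolutionPast.

(** Equality of functions, rather than of values, lets recovered quantities be replaced under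
    integrals and derivatives. *)
Lemma funext2 (f g : R -> R -> R) : (forall x z, f x z = g x z) -> f = g.
Proof.
intros H; apply functional_extensionality; intros x.
apply functional_extensionality; auto.
Qed.

(** * The recovered quantities of a plasma solution *)

Section PlasmaSolutionReduction.

Variables (D : plasma_data) (Zbar : R) (F : fields).
Hypothesis HD : admissible D.
Hypothesis HF : plasma_solution D F.

Let U := unknowns_of F.

Lemma sol_rec_Ez : rec_Ez D Zbar U = Ez F.
Proof.
assert (P : partials (rec_Ez D Zbar U)
  (fun x z => 4 * PI * sum_species D (fun h => q D h * (n0 D h (Zl F h x z)
     * (- d_0 (zl F h) x (Zl F h x z) / d_z (zl F h) x (Zl F h x z)))))
  (fun x z => 4 * PI * sum_species D (fun h => q D h * (n0 D h (Zl F h x z)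
     * / d_z (zl F h) x (Zl F h x z))))).
{ apply (partials_rec_Ez D Zbar U
    (fun h x z => - d_0 (zl F h) x (Zl F h x z) / d_z (zl F h) x (Zl F h x z))
    (fun h x z => / d_z (zl F h) x (Zl F h x z))).
  - apply HD.
  - intros h Hh; now apply (sol_partials_Zl D). }
apply funext2; intros x z.
(* At [Rmax x 0], a nonnegative position ahead of the front, every fluid is still at rest: all the
   [Z_h] coincide there and neutrality applies. *)
assert (E : rec_Ez D Zbar U x z - Ez F x z
            = rec_Ez D Zbar U x (Rmax x 0) - Ez F x (Rmax x 0)).
{ apply (constant_of_is_derive_0 (fun z => rec_Ez D Zbar U x z - Ez F x z)).
  intros y _.
  rewrite <- (Rminus_diag (d_z (Ez F) x y)).
  apply (is_derive_minus (K := R_AbsRing) (rec_Ez D Zbar U x) (Ez F x)).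
  - destruct HF as (_ & _ & HM & _); destruct (HM x y) as (-> & _).
    rewrite (sum_species_ext D _ (fun h => q D h * (n0 D h (Zl F h x y)
     * / d_z (zl F h) x (Zl F h x y)))).
    + apply P.
    + intros h Hh; rewrite (sol_density D F h HF Hh).
      now rewrite (partials_d_z _ _ _ (sol_partials_Zl D F h HF Hh)).
  - apply (C1_partials _ (sol_C1_Ez D F HF)). }
assert (E1 : Ez F x (Rmax x 0) = 0).
{ destruct HF as (_ & _ & _ & _ & _ & _ & Ha & _).
  apply (Ha x _ (Rmax_l x 0)). }
assert (E2 : rec_Ez D Zbar U x (Rmax x 0) = 0).
{ unfold rec_Ez.
  rewrite (sum_species_ext D _ (fun h => q D h * Ncum D Zbar h (Rmax x 0))).
  - rewrite neutral_Ncum by auto; ring.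
  - intros h Hh; do 2 f_equal; simpl.
    rewrite <- (sol_zl_front D F h HF Hh x (Rmax x 0)) at 1
      by (apply Rmax_r || apply Rmax_l).
    now apply (sol_Zl_zl D). }
lra.
Qed.

Variable h : nat.
Hypothesis Hh : species D h.

Lemma sol_rec_up : rec_up D U h = up F h.
Proof.
apply functional_extensionality; intros i; apply funext2; intros x z.
symmetry; now apply sol_up.
Qed.

Lemma sol_rec_up2 : rec_up2 D U h = sqnorm (up F h).
Proof. unfold rec_up2; now rewrite sol_rec_up. Qed.

Lemma sol_rec_gamma : rec_gamma D U h = gamma F h.
Proof.
apply funext2; intros x z; unfold rec_gamma; rewrite sol_rec_up2.
symmetry; now apply (sol_gamma_recovery D).
Qed.

Lemma sol_rec_uz : rec_uz D U h = uz F h.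
Proof.
apply funext2; intros x z; unfold rec_uz; rewrite sol_rec_up2.
symmetry; now apply (sol_uz_recovery D).
Qed.

Lemma sol_rec_betap i : rec_betap D U h i = betap F h i.
Proof.
apply funext2; intros x z; unfold rec_betap; rewrite sol_rec_up2, sol_rec_up.
pose proof (sol_gamma_recovery D F h HF Hh x z) as E.
pose proof (sol_s_pos D F h HF Hh x z) as Hs.
pose proof (sqnorm_nonneg (up F h) x z).
unfold up at 1; rewrite E; simpl us; field; nra.
Qed.

Lemma sol_rec_betaz : rec_betaz D U h = betaz F h.
Proof.
apply funext2; intros x z; unfold rec_betaz; rewrite sol_rec_up2; simpl us.
pose proof (sol_gamma_recovery D F h HF Hh x z) as E.
pose proof (sol_uz_recovery D F h HF Hh x z) as E'.
pose proof (sol_s_pos D F h HF Hh x z) as Hs.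
pose proof (sqnorm_nonneg (up F h) x z).
unfold uz in E'; rewrite E in E'.
apply Rmult_eq_reg_l with ((1 + sqnorm (up F h) x z + s F h x z ^ 2)
                           / (2 * s F h x z)).
- rewrite E'; field; nra.
- apply Rgt_not_eq, Rdiv_lt_0_compat; nra.
Qed.

Lemma sol_rec_n : rec_n D U h = n F h.
Proof.
apply funext2; intros x z; symmetry; now apply sol_density.
Qed.

Lemma sol_s_equation x0 Z :
  tilde (uzl U h) (us U h) x0 Z
  = exp (RInt (fun t => growth D Zbar U h t Z) 0 x0)
    + RInt (fun t =>
        exp (RInt (fun t' => growth D Zbar U h t' Z) t x0)
        * (tilde (uzl U h) (d_minus (rec_up2 D U h)) t Z
           / tilde (uzl U h) (rec_gamma D U h) t Z))
        0 x0.
Proof.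
pose proof (sol_C1_zl D F h HF Hh) as Czl.
assert (Cu2 : C1 (sqnorm (up F h))).
{ apply C1_sqnorm; intros i; now apply (sol_C1_up D). }
assert (CG : C0 (growth D Zbar U h)).
{ unfold growth, eps; rewrite sol_rec_gamma, sol_rec_Ez.
  apply C0_div.
  - intros x z; apply Rgt_not_eq, (sol_gamma_pos D); auto.
  - apply C0_tilde; [now apply C1_C0|].
    apply C0_mult; [|apply C0_const].
    apply C0_mult; [apply C0_const | apply C1_C0, (sol_C1_Ez D), HF].
  - apply C0_tilde; apply C1_C0; auto; now apply (sol_C1_gamma D). }
assert (CR : C0 (fun t Z => tilde (uzl U h) (d_minus (rec_up2 D U h)) t Z
           / tilde (uzl U h) (rec_gamma D U h) t Z)).
{ rewrite sol_rec_gamma, sol_rec_up2; apply C0_div.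
  - intros x z; apply Rgt_not_eq, (sol_gamma_pos D); auto.
  - apply C0_tilde; [now apply C1_C0 | now apply C0_d_minus].
  - apply C0_tilde; apply C1_C0; auto; now apply (sol_C1_gamma D). }
rewrite <- (linear_solution_Duhamel (fun t => growth D Zbar U h t Z)
  (fun t => tilde (uzl U h) (d_minus (rec_up2 D U h)) t Z
           / tilde (uzl U h) (rec_gamma D U h) t Z));
  try (intros y; now apply C0_slice1).
2:{ intros y; now apply (C0_slice1 (fun t Z =>
      tilde (uzl U h) (d_minus (rec_up2 D U h)) t Z
           / tilde (uzl U h) (rec_gamma D U h) t Z)). }
apply (linear_solution_unique _ _ (fun t => tilde (uzl U h) (us U h) t Z)).
- intros y; now apply C0_slice1.
- intros y; now apply (C0_slice1 (fun t Z =>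
      tilde (uzl U h) (d_minus (rec_up2 D U h)) t Z
           / tilde (uzl U h) (rec_gamma D U h) t Z)).
- intros t.
  assert (E : growth D Zbar U h t Z * tilde (uzl U h) (us U h) t Z
     + tilde (uzl U h) (d_minus (rec_up2 D U h)) t Z
       / tilde (uzl U h) (rec_gamma D U h) t Z
     = material F h (s F h) t (zl F h t Z)).
  { unfold growth, eps; rewrite sol_rec_gamma, sol_rec_Ez, (sol_material_s D) by auto.
    replace (rec_up2 D U h) with
      (fun x z => (q D h / (m D h * c D ^ 2)) ^ 2 * sqnorm (Ap F) x z).
    - unfold tilde; rewrite d_minus_scal.
      + simpl uzl; simpl us.
        pose proof (sol_gamma_pos D F h HF Hh t (zl F h t Z)).
        pose proof (mass_pos D h HD Hh).
        destruct HD as (_ & Hc & Hm & _); specialize (Hm h Hh).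
        field; lra.
      + apply C1_sqnorm; intros i; now apply (sol_C1_Ap D).
    - apply funext2; intros x z; unfold rec_up2, rec_up, sqnorm; simpl.
      unfold Rdiv; ring. }
  rewrite E; apply (is_derive_trajectory D F h HF Hh).
  now apply (sol_C1_s D).
- destruct HF as (_ & _ & _ & _ & _ & _ & _ & _ & H); now apply H.
Qed.

End PlasmaSolutionReduction.

Theorem integral_solution_of_plasma_solution D Zbar F : admissible D ->
  plasma_solution D F -> integral_solution D Zbar (unknowns_of F).
Proof.
intros HD HF; split; [|split; [|split]].
- split; [|split].
  + intros i; now apply (sol_C2_Ap D).
  + intros i x0 z Hx; now apply sol_free_wave.
  + intros h Hh; split; [|split].
    * exists (s F h); split; auto; now apply (sol_C1_s D).
    * exists (zl F h); split; auto; now apply (sol_C1_zl D).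
    * intros x0 _; split; [|split; [|split]].
      -- now apply (sol_s_pos D).
      -- now apply (sol_zl_increasing D).
      -- now apply (sol_Zl_zl D).
      -- now apply (sol_zl_Zl D).
- intros i x0 z Hx.
  set (G := fun t y => 2 * PI * sum_species D
              (fun j => q D j * n F j t y * betap F j i t y)).
  assert (EG : (fun t y => 2 * PI * sum_species D
            (fun j => q D j * rec_n D (unknowns_of F) j t y
                      * rec_betap D (unknowns_of F) j i t y)) = G).
  { apply funext2; intros t y; unfold G; f_equal.
    apply sum_species_ext; intros j Hj.
    now rewrite sol_rec_n, sol_rec_betap. }
  change (Ap F i x0 z - alpha D i (x0 - z)
    = cone_integral (fun t y => 2 * PI * sum_species D
            (fun j => q D j * rec_n D (unknowns_of F) j t y
                      * rec_betap D (unknowns_of F) j i t y)) x0 z).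
  rewrite EG, (dalembert_formula (Ap F i) G).
  + rewrite (sol_free_wave D F HF) by lra.
    replace (0 - (z - x0)) with (x0 - z) by ring; ring.
  + now apply (sol_C2_Ap D).
  + apply C0_mult; [apply C0_const|]; apply C0_sum; intros j Hj.
    apply C0_mult; [|apply C1_C0; now apply (sol_C1_betap D)].
    apply C0_mult; [apply C0_const | now apply (sol_C0_n D)].
  + intros x y _; destruct HF as (_ & _ & HM & _).
    destruct (HM x y) as (_ & _ & E); specialize (E i).
    unfold dalembertian, G; lra.
  + intros y; apply (free_wave_d_plus _ (alpha D i)); try lra.
    * now apply (sol_C1_Ap D).
    * intros; now apply sol_free_wave.
  + auto.
- intros h Hh x0 Z _; now apply sol_s_equation.
- intros h Hh x0 Z _; rewrite sol_rec_betaz by auto.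
  now apply (sol_zl_integral D).
Qed.

Theorem recovered_of_plasma_solution D Zbar F : admissible D ->
  plasma_solution D F -> forall x0, recovered_at D Zbar (unknowns_of F) F x0.
Proof.
intros HD HF x0; split; [|split].
- reflexivity.
- intros z; now rewrite sol_rec_Ez.
- intros h Hh; split.
  + intros z; rewrite sol_rec_up, sol_rec_n, sol_rec_gamma, sol_rec_uz,
      sol_rec_betaz by auto.
    repeat split; auto.
    * now apply (sol_s_pos D).
    * intros i; now rewrite sol_rec_betap.
  + intros i X Z; rewrite sol_rec_betap by auto; simpl uzl.
    assert (E : xp F h i 0 X Z = X i).
    { destruct HF as (_ & _ & _ & _ & _ & _ & _ & _ & H); now apply H. }
    rewrite <- E; apply (eq_RInt_derive (fun t => xp F h i t X Z)).
    * intros t _; destruct HF as (_ & _ & _ & _ & _ & H & _); now apply H.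
    * intros t _; apply (C0_slice1 (tilde (zl F h) (betap F h i))).
      apply C0_tilde; apply C1_C0; [now apply (sol_C1_zl D) |
        now apply (sol_C1_betap D)].
Qed.

(** * From the integral equations to the plasma equations *)

(** The squared transverse momentum of species [h] in the free wave, as a function of
    [y = x0 - z]. *)
Definition intensity (D : plasma_data) (h : nat) (y : R) : R :=
  (q D h / (m D h * c D ^ 2)) ^ 2 * (alpha D px y ^ 2 + alpha D py y ^ 2).

(* In the free wave the motion with s_h = 1 integrates to
   phase (x0 - z_h) = x0 + phase (- Z). *)
Definition phase (D : plasma_data) (h : nat) (y : R) : R :=
  y + / 2 * RInt (intensity D h) 0 y.

(** * Explicit motion in the free wave *)

Section Phase.

Variables (D : plasma_data) (h : nat).
Hypothesis Ca : forall i y, continuous (alpha D i) y.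
Hypothesis Ha : forall i y, y <= 0 -> alpha D i y = 0.

Lemma intensity_nonneg y : 0 <= intensity D h y.
Proof.
unfold intensity; apply Rmult_le_pos; [apply pow2_ge_0|].
pose proof (pow2_ge_0 (alpha D px y)); pose proof (pow2_ge_0 (alpha D py y)); lra.
Qed.

Lemma C0_intensity : C0 (fun _ y => intensity D h y).
Proof.
apply C0_mult; [apply C0_const|]; apply C0_plus; apply C0_pow2;
  apply (C0_comp1 _ (fun _ y => y)); auto; apply C0_snd.
Qed.

Lemma continuous_intensity y : continuous (intensity D h) y.
Proof. apply (C0_slice2 (fun _ y => intensity D h y) 0 y C0_intensity). Qed.

Lemma partials_phase : partials (fun _ y => phase D h y) (fun _ _ => 0)
  (fun _ y => 1 + / 2 * intensity D h y).
Proof.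
pose proof (partials_comp1 (fun y => RInt (intensity D h) 0 y) (intensity D h)
  _ _ _ partials_snd
  (fun _ z => is_derive_RInt_cont _ 0 z continuous_intensity)
  (fun _ z => continuous_intensity z)) as P.
eapply partials_ext;
  [apply (partials_plus _ _ _ _ _ _ partials_snd (partials_scal (/ 2) _ _ _ P))
  | | |]; intros; unfold phase; simpl; try reflexivity; ring.
Qed.

Lemma phase_neg y : y <= 0 -> phase D h y = y.
Proof.
intros Hy; unfold phase.
rewrite (RInt_ext _ (fun _ => 0)).
- rewrite RInt_const; change (y + / 2 * ((y - 0) * 0) = y); ring.
- rewrite Rmin_right, Rmax_left by auto; intros t Ht.
  unfold intensity; rewrite !Ha by lra.
  refine (_ : _ = 0 :> R); ring.
Qed.

(** The slope is at least [1]. This gives injectivity, the bracket for surjectivity and the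
    monotonicity of the inverse. *)
Lemma phase_expanding y y' : y <= y' -> y' - y <= phase D h y' - phase D h y.
Proof.
intros Hy.
assert (H : - (phase D h y' - y') <= - (phase D h y - y)); [|lra].
apply (antitone_of_derive (fun y => - (phase D h y - y))
         (fun y => - (1 + / 2 * intensity D h y - 1))); auto.
- intros t; apply (is_derive_opp (K := R_AbsRing) (fun y => phase D h y - y)
    t (1 + / 2 * intensity D h t - 1)).
  apply (is_derive_minus (K := R_AbsRing) (phase D h) (fun y => y)).
  + apply partials_phase; exact 0.
  + apply (is_derive_id t).
- intros t _; pose proof (intensity_nonneg t); lra.
Qed.

Lemma phase_increasing y y' : y < y' -> phase D h y < phase D h y'.
Proof. intros H; pose proof (phase_expanding y y' (Rlt_le _ _ H)); lra. Qed.

Lemma phase_inj y y' : phase D h y = phase D h y' -> y = y'.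
Proof.
intros E; destruct (Rtotal_order y y') as [H|[|H]]; auto;
  apply phase_increasing in H; lra.
Qed.

(** Stated with a witness that can be extracted, since the inverse is needed as a function. As
    [phase] fixes [0] and expands distances, [Rabs v] and its opposite bracket the root. *)
Lemma phase_surj v : {y : R | phase D h y = v}.
Proof.
assert (H0 : phase D h 0 = 0) by (apply phase_neg; lra).
pose proof (Rabs_pos v) as Hv.
pose proof (phase_expanding 0 (Rabs v) Hv).
pose proof (phase_expanding (- Rabs v) 0 ltac:(lra)).
assert (- Rabs v <= v <= Rabs v).
{ unfold Rabs; destruct (Rcase_abs v); lra. }
destruct (IVT_cor (fun y => phase D h y - v) (- Rabs v) (Rabs v)) as (y & _ & Hy).
- intros y; apply continuity_pt_filterlim.
  apply (continuous_minus (phase D h) (fun _ => v)).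
  + apply (C0_slice2 (fun _ y => phase D h y) 0 y (partials_C0 _ _ _ partials_phase)).
  + apply continuous_const.
- lra.
- assert (0 <= (v - phase D h (- Rabs v)) * (phase D h (Rabs v) - v))
    by (apply Rmult_le_pos; lra); lra.
- exists y; lra.
Qed.

Variable inv : R -> R.
Hypothesis Hinv : forall v, phase D h (inv v) = v.

Lemma inv_phase y : inv (phase D h y) = y.
Proof. apply phase_inj, Hinv. Qed.

Lemma inv_neg y : y <= 0 -> inv y = y.
Proof. intros Hy; rewrite <- (phase_neg y Hy) at 1; apply inv_phase. Qed.

Lemma inv_increasing v v' : v < v' -> inv v < inv v'.
Proof.
intros H; destruct (Rlt_le_dec (inv v) (inv v')) as [|H']; auto; exfalso.
pose proof (phase_expanding _ _ H') as H2; rewrite !Hinv in H2; lra.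
Qed.

Lemma partials_inv : partials (fun _ v => inv v) (fun _ _ => 0)
  (fun _ v => / (1 + / 2 * intensity D h (inv v))).
Proof.
eapply partials_ext.
- apply (partials_inverse _ _ _ (fun _ v => inv v) partials_phase).
  + intros _; apply phase_increasing.
  + intros _; apply inv_phase.
  + intros _; apply Hinv.
  + intros _ y; pose proof (intensity_nonneg y); lra.
- reflexivity.
- intros x z; simpl; pose proof (intensity_nonneg (inv z)); field; lra.
- reflexivity.
Qed.

Definition past_zl (x Z : R) : R := x - inv (x + phase D h (- Z)).
Definition past_Zl (x z : R) : R := - inv (phase D h (x - z) - x).

Lemma past_zl_0 Z : past_zl 0 Z = Z.
Proof. unfold past_zl; rewrite Rplus_0_l, inv_phase; ring. Qed.

Lemma past_Zl_zl x Z : past_Zl x (past_zl x Z) = Z.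
Proof.
unfold past_Zl, past_zl.
replace (x - (x - inv (x + phase D h (- Z)))) with (inv (x + phase D h (- Z)))
  by ring.
rewrite Hinv; replace (x + phase D h (- Z) - x) with (phase D h (- Z)) by ring.
rewrite inv_phase; ring.
Qed.

Lemma past_zl_Zl x z : past_zl x (past_Zl x z) = z.
Proof.
unfold past_zl, past_Zl; rewrite Ropp_involutive, Hinv.
replace (x + (phase D h (x - z) - x)) with (phase D h (x - z)) by ring.
rewrite inv_phase; ring.
Qed.

Lemma past_zl_increasing x Z Z' : Z < Z' -> past_zl x Z < past_zl x Z'.
Proof.
intros H; unfold past_zl.
assert (inv (x + phase D h (- Z')) < inv (x + phase D h (- Z))); [|lra].
apply inv_increasing.
pose proof (phase_increasing (- Z') (- Z) ltac:(lra)); lra.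
Qed.

Lemma past_zl_front x Z : x <= 0 -> 0 <= Z -> past_zl x Z = Z.
Proof.
intros Hx HZ; unfold past_zl; rewrite phase_neg, inv_neg by lra; ring.
Qed.

Lemma past_Zl_front x z : x <= 0 -> 0 <= z -> past_Zl x z = z.
Proof.
intros Hx Hz; rewrite <- (past_zl_front x z Hx Hz) at 1; apply past_Zl_zl.
Qed.

Lemma past_Zl_neg x z : x <= 0 -> z < 0 -> past_Zl x z < 0.
Proof.
intros Hx Hz; destruct (Rlt_le_dec (past_Zl x z) 0) as [|H]; auto; exfalso.
pose proof (past_zl_front x _ Hx H) as E; rewrite past_zl_Zl in E; lra.
Qed.

(** The recovered longitudinal velocity for [s_h = 1]. *)
Definition past_betaz (y : R) : R := intensity D h y / (2 + intensity D h y).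

(** Gluing compares values and time derivatives, so the derivative in [Z] may stay anonymous. *)
Lemma partials_past_zl : exists fz, partials past_zl
  (fun x Z => past_betaz (x - past_zl x Z)) fz.
Proof.
pose proof (partials_comp _ _ _ _ _ _ _ _ _ partials_phase
  partials_fst (partials_scal (-1) _ _ _ partials_snd)) as P1.
pose proof (partials_comp _ _ _ _ _ _ _ _ _ partials_inv
  partials_fst (partials_plus _ _ _ _ _ _ partials_fst P1)) as P2.
eexists; eapply partials_ext;
  [apply (partials_minus _ _ _ _ _ _ partials_fst P2) | | |].
- intros x Z; simpl; unfold past_zl; do 4 f_equal; ring.
- intros x Z; simpl; unfold past_betaz, past_zl.
  replace (-1 * Z) with (- Z) by ring.
  replace (x - (x - inv (x + phase D h (- Z)))) with (inv (x + phase D h (- Z)))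
    by ring.
  pose proof (intensity_nonneg (inv (x + phase D h (- Z)))); field; lra.
- reflexivity.
Qed.

End Phase.

(** [A^perp] is left alone because it already is the free wave at [x0 <= 0]; the other unknowns are
    unconstrained there and get replaced. *)
Definition extension (D : plasma_data) (inv : nat -> R -> R) (U : unknowns)
  : unknowns :=
  {| uA := uA U;
     us := fun h => glue (us U h) (fun _ _ => 1);
     uzl := fun h => glue (uzl U h) (past_zl D h (inv h));
     uZl := fun h => glue (uZl U h) (past_Zl D h (inv h)) |}.

Definition reconstruction (D : plasma_data) (Zbar : R) (V : unknowns) : fields :=
  {| Ap := uA V; Ez := rec_Ez D Zbar V; n := rec_n D V; betap := rec_betap D V;
     betaz := rec_betaz D V; zl := uzl V; Zl := uZl V;
     xp := fun h i x0 X Z =>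
       X i + RInt (fun t => rec_betap D V h i t (uzl V h t Z)) 0 x0 |}.

Lemma C1_slowness_ratio u2 s : C1 u2 -> C1 s -> (forall x z, 0 <= u2 x z) ->
  C1 (fun x z => (1 + u2 x z - s x z ^ 2) / (1 + u2 x z + s x z ^ 2)).
Proof.
intros Hu Hs Hp.
assert (C1 (fun x z => 1 + u2 x z)) by (apply C1_plus; auto; apply C1_const).
apply C1_div.
- intros x z; specialize (Hp x z); pose proof (pow2_ge_0 (s x z)); lra.
- apply C1_minus; auto; now apply C1_pow2.
- apply C1_plus; auto; now apply C1_pow2.
Qed.

(** Continuity of the velocity is used before [s_h] is known to be C1 across [x0 = 0]. *)
Lemma C0_slowness_ratio u2 s : C0 u2 -> C0 s -> (forall x z, 0 <= u2 x z) ->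
  C0 (fun x z => (1 + u2 x z - s x z ^ 2) / (1 + u2 x z + s x z ^ 2)).
Proof.
intros Hu Hs Hp.
assert (C0 (fun x z => 1 + u2 x z)) by (apply C0_plus; auto; apply C0_const).
apply C0_div.
- intros x z; specialize (Hp x z); pose proof (pow2_ge_0 (s x z)); lra.
- apply C0_minus; auto; now apply C0_pow2.
- apply C0_plus; auto; now apply C0_pow2.
Qed.

(** Since [gamma] and [uz] are functions of [u2] and [s], the one transport equation for [s] returns
    both Lorentz equations. Here [a], [b] stand for the partials of [u2], [p], [r] for those of [s],
    and [e] for [eps]; the left side has the shape produced by the quotient rule. *)
Lemma gamma_equation_algebra u2 s a b p r e : 0 <= u2 -> 0 < s ->
  let d := 1 + u2 + s ^ 2 in
  let g := d / (2 * s) in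
  let w := (1 + u2 - s ^ 2) / (2 * s) in
  let bz := (1 + u2 - s ^ 2) / d in
  p + bz * r = e / g * s + / 2 * (a + b) / g ->
  ((a + 2 * s * p) * (2 * s) - d * (2 * p)) / (2 * s) ^ 2
  + bz * (((b + 2 * s * r) * (2 * s) - d * (2 * r)) / (2 * s) ^ 2)
  = - e * w / g + a / (2 * g).
Proof.
intros Hu Hs d g w bz T; assert (Hd : 0 < d) by (unfold d; nra).
assert (E : p = e / g * s + / 2 * (a + b) / g - bz * r) by lra.
rewrite E; unfold w, bz, g, d in *; field; lra.
Qed.

Lemma uz_equation_algebra u2 s a b p r e : 0 <= u2 -> 0 < s ->
  let d := 1 + u2 + s ^ 2 in
  let g := d / (2 * s) in
  let bz := (1 + u2 - s ^ 2) / d in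
  p + bz * r = e / g * s + / 2 * (a + b) / g ->
  ((a - 2 * s * p) * (2 * s) - (1 + u2 - s ^ 2) * (2 * p)) / (2 * s) ^ 2
  + bz * (((b - 2 * s * r) * (2 * s) - (1 + u2 - s ^ 2) * (2 * r)) / (2 * s) ^ 2)
  = - e - b / (2 * g).
Proof.
intros Hu Hs d g bz T; assert (Hd : 0 < d) by (unfold d; nra).
assert (E : p = e / g * s + / 2 * (a + b) / g - bz * r) by lra.
rewrite E; unfold bz, g, d in *; field; lra.
Qed.

(** * The unknowns continued to negative times *)

Section Extension.

Variables (D : plasma_data) (Zbar : R) (U : unknowns) (inv : nat -> R -> R).
Hypothesis HD : admissible D.
Hypothesis HU : integral_solution D Zbar U.
Hypothesis Hinv : forall h v, phase D h (inv h v) = v.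

Let V := extension D inv U.

Lemma ext_C2_A i : C2 (uA V i).
Proof. destruct HU as ((H & _) & _); exact (H i). Qed.

Lemma ext_C1_A i : C1 (uA V i).
Proof. exact (proj1 (ext_C2_A i)). Qed.

Lemma ext_free i x z : x <= 0 -> uA V i x z = alpha D i (x - z).
Proof. destruct HU as ((_ & H & _) & _); exact (H i x z). Qed.

(** Continuity of [alpha] is inherited from the regularity of [A^perp], whose values on the slice
    [x0 = 0] are those of [alpha]. *)
Lemma continuous_alpha i y : continuous (alpha D i) y.
Proof.
apply (continuous_ext (fun y => uA V i 0 (- y))).
- intros t; rewrite ext_free by lra; f_equal; ring.
- apply (C0_slice (uA V i) (fun _ => 0) Ropp).
  + apply C1_C0, ext_C1_A.
  + apply continuous_const.
  + apply (continuous_opp (fun y : R => y)), continuous_id.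
Qed.

Lemma alpha_neg i y : y <= 0 -> alpha D i y = 0.
Proof. destruct HD as (_ & _ & _ & _ & _ & _ & H); exact (H i y). Qed.

Lemma C1_rec_up h i : C1 (rec_up D V h i).
Proof. apply (C1_scal (- q D h / (m D h * c D ^ 2))), ext_C1_A. Qed.

Lemma C1_rec_up2 h : C1 (rec_up2 D V h).
Proof. apply C1_sqnorm, C1_rec_up. Qed.

Lemma rec_up2_nonneg h x z : 0 <= rec_up2 D V h x z.
Proof. apply sqnorm_nonneg. Qed.

Lemma rec_up2_past h x z : x <= 0 -> rec_up2 D V h x z = intensity D h (x - z).
Proof.
intros Hx; unfold rec_up2, sqnorm, rec_up; rewrite !ext_free by auto.
unfold intensity, Rdiv; ring.
Qed.

Section Species.

Variable h : nat.
Hypothesis Hh : species D h.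

Lemma unknown_zl_0 Z : uzl U h 0 Z = Z.
Proof.
destruct HU as (_ & _ & _ & H); rewrite (H h Hh 0 Z (Rle_refl 0)).
rewrite RInt_point; apply Rplus_0_r.
Qed.

Lemma unknown_s_0 z : us U h 0 z = 1.
Proof.
destruct HU as (_ & _ & H & _); specialize (H h Hh 0 z (Rle_refl 0)).
unfold tilde at 1 in H; rewrite unknown_zl_0, !RInt_point in H.
rewrite H; unfold zero; simpl; rewrite exp_0; ring.
Qed.

Lemma future_s x z : 0 <= x -> us V h x z = us U h x z.
Proof. apply glue_future. Qed.

Lemma future_zl x z : 0 <= x -> uzl V h x z = uzl U h x z.
Proof. apply glue_future. Qed.

Lemma future_Zl x z : 0 <= x -> uZl V h x z = uZl U h x z.
Proof. apply glue_future. Qed.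

Lemma past_s x z : x <= 0 -> us V h x z = 1.
Proof. apply (glue_past0 (us U h) (fun _ _ => 1)), unknown_s_0. Qed.

Lemma past_zl_ext x Z : x <= 0 -> uzl V h x Z = past_zl D h (inv h) x Z.
Proof.
apply (glue_past0 (uzl U h)); intros y; rewrite unknown_zl_0.
symmetry; apply past_zl_0; auto using continuous_alpha.
Qed.

Lemma ext_order x :
  (forall z, 0 < us V h x z) /\
  (forall Z Z', Z < Z' -> uzl V h x Z < uzl V h x Z') /\
  (forall Z, uZl V h x (uzl V h x Z) = Z) /\
  (forall z, uzl V h x (uZl V h x z) = z).
Proof.
destruct (Rle_lt_dec 0 x) as [Hx|Hx].
- destruct HU as ((_ & _ & H) & _); destruct (H h Hh) as (_ & _ & H').
  destruct (H' x Hx) as (H1 & H2 & H3 & H4).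
  repeat split; intros; rewrite ?future_s, ?future_zl, ?future_Zl by auto; auto.
- assert (Ez : forall Z, uzl V h x Z = past_zl D h (inv h) x Z)
    by (intros; now apply glue_past).
  assert (EZ : forall Z, uZl V h x Z = past_Zl D h (inv h) x Z)
    by (intros; now apply glue_past).
  repeat split; intros; rewrite ?past_s, ?Ez, ?EZ by lra.
  + lra.
  + apply past_zl_increasing; auto using continuous_alpha.
  + apply past_Zl_zl; auto using continuous_alpha.
  + apply past_zl_Zl; auto using continuous_alpha.
Qed.

Lemma ext_s_pos x z : 0 < us V h x z.
Proof. apply ext_order. Qed.

Lemma ext_zl_increasing x Z Z' : Z < Z' -> uzl V h x Z < uzl V h x Z'.
Proof. apply ext_order. Qed.

Lemma ext_Zl_zl x Z : uZl V h x (uzl V h x Z) = Z.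
Proof. apply ext_order. Qed.

Lemma ext_zl_Zl x z : uzl V h x (uZl V h x z) = z.
Proof. apply ext_order. Qed.

Lemma past_Zl_ext x z : x <= 0 -> uZl V h x z = past_Zl D h (inv h) x z.
Proof.
intros Hx; rewrite <- (past_zl_Zl D h continuous_alpha (inv h) (Hinv h) x z) at 1.
rewrite <- past_zl_ext by auto; apply ext_Zl_zl.
Qed.

Lemma ext_Zl_front x z : x <= 0 -> 0 <= z -> uZl V h x z = z.
Proof.
intros; rewrite past_Zl_ext by auto.
apply past_Zl_front; auto using continuous_alpha, alpha_neg.
Qed.

Lemma ext_Zl_neg x z : x <= 0 -> z < 0 -> uZl V h x z < 0.
Proof.
intros; rewrite past_Zl_ext by auto.
apply past_Zl_neg; auto using continuous_alpha, alpha_neg.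
Qed.

(** [us U h] is arbitrary at [x0 < 0] and so cannot be differentiated at [x0 = 0]; its C1
    continuation [g] takes its place in the gluing. *)
Lemma ext_s_representation : exists g, C1 g /\ (forall z, g 0 z = 1) /\
  (forall x z, 0 <= x -> us V h x z = g x z) /\
  us V h = glue g (fun _ _ => 1).
Proof.
destruct HU as ((_ & _ & H) & _); destruct (H h Hh) as ((g & Hg & E) & _).
exists g; repeat split; try apply Hg.
- intros z; rewrite <- E by lra; apply unknown_s_0.
- intros x z Hx; rewrite future_s by auto; auto.
- apply funext2; intros x z; simpl; unfold glue; destruct (Rle_dec 0 x); auto.
Qed.

Lemma ext_zl_representation : exists g, C1 g /\ (forall z, g 0 z = z) /\
  (forall x z, 0 <= x -> uzl V h x z = g x z) /\
  uzl V h = glue g (past_zl D h (inv h)).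
Proof.
destruct HU as ((_ & _ & H) & _); destruct (H h Hh) as (_ & (g & Hg & E) & _).
exists g; repeat split; try apply Hg.
- intros z; rewrite <- E by lra; apply unknown_zl_0.
- intros x z Hx; rewrite future_zl by auto; auto.
- apply funext2; intros x z; simpl; unfold glue; destruct (Rle_dec 0 x); auto.
Qed.

Lemma C0_ext_s : C0 (us V h).
Proof.
destruct ext_s_representation as (g & Hg & H0 & _ & ->).
apply C0_glue; auto; [now apply C1_C0 | apply C0_const].
Qed.

Lemma C0_ext_zl : C0 (uzl V h).
Proof.
destruct ext_zl_representation as (g & Hg & H0 & _ & ->).
destruct (partials_past_zl D h continuous_alpha (inv h) (Hinv h)) as (fz & P).
apply C0_glue.
- now apply C1_C0.
- now apply partials_C0 in P.
- intros z; rewrite H0; symmetry; apply past_zl_0; auto using continuous_alpha.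
Qed.

Lemma C0_ext_Zl : C0 (uZl V h).
Proof.
apply (C0_inverse (uzl V h)); auto using C0_ext_zl, ext_zl_increasing,
  ext_Zl_zl, ext_zl_Zl.
Qed.

Lemma denominator_pos x z : 0 < 1 + rec_up2 D V h x z + us V h x z ^ 2.
Proof.
pose proof (rec_up2_nonneg h x z); pose proof (pow2_ge_0 (us V h x z)); lra.
Qed.

Lemma rec_gamma_pos x z : 0 < rec_gamma D V h x z.
Proof.
apply Rdiv_lt_0_compat; [apply denominator_pos|].
pose proof (ext_s_pos x z); lra.
Qed.

Lemma C0_rec_betaz : C0 (rec_betaz D V h).
Proof.
apply C0_slowness_ratio;
  [apply C1_C0, C1_rec_up2 | apply C0_ext_s | apply rec_up2_nonneg].
Qed.

Lemma C0_rec_gamma : C0 (rec_gamma D V h).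
Proof.
apply C0_div.
- intros x z; pose proof (ext_s_pos x z); lra.
- apply C0_plus; [|apply C0_pow2, C0_ext_s].
  apply C0_plus; [apply C0_const | apply C1_C0, C1_rec_up2].
- apply C0_mult; [apply C0_const | apply C0_ext_s].
Qed.

Lemma future_betaz x z : 0 <= x -> rec_betaz D V h x z = rec_betaz D U h x z.
Proof. intros Hx; unfold rec_betaz; rewrite future_s by auto; reflexivity. Qed.

Lemma future_betap i x z :
  0 <= x -> rec_betap D V h i x z = rec_betap D U h i x z.
Proof. intros Hx; unfold rec_betap; rewrite future_s by auto; reflexivity. Qed.

Lemma future_gamma x z : 0 <= x -> rec_gamma D V h x z = rec_gamma D U h x z.
Proof. intros Hx; unfold rec_gamma; rewrite future_s by auto; reflexivity. Qed.

Lemma future_uz x z : 0 <= x -> rec_uz D V h x z = rec_uz D U h x z.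
Proof. intros Hx; unfold rec_uz; rewrite future_s by auto; reflexivity. Qed.

Lemma future_n x z : 0 <= x -> rec_n D V h x z = rec_n D U h x z.
Proof.
intros Hx; unfold rec_n; rewrite future_Zl by auto; f_equal.
apply Derive_ext; intros; now apply future_Zl.
Qed.

(** The two claims belong together: the gluing is C1 because both pieces move with the same
    continuous velocity field at [x0 = 0], where [s_h = 1] and the wave is free. *)
Lemma ext_d_0_zl x Z : d_0 (uzl V h) x Z = rec_betaz D V h x (uzl V h x Z) /\
  C1 (uzl V h).
Proof.
pose proof C0_rec_betaz as Cb; pose proof C0_ext_zl as Cz.
assert (Cbz : C0 (fun x Z => rec_betaz D V h x (uzl V h x Z)))
  by (now apply (C0_tilde (uzl V h) (rec_betaz D V h))).
destruct ext_zl_representation as (g & Hg & H0 & HgE & E).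
pose proof (C1_partials _ Hg) as Pg.
assert (Hfut : forall x Z, 0 <= x ->
          d_0 g x Z = rec_betaz D V h x (uzl V h x Z)).
{ apply C0_eq_right; auto; [apply Hg|].
  intros t Y Ht; apply is_derive_unique.
  apply (is_derive_ext_loc
    (fun t => Y + RInt (fun r => rec_betaz D V h r (uzl V h r Y)) 0 t)).
  - generalize (locally_lt 0 t Ht); apply filter_imp; intros r Hr.
    rewrite <- HgE, future_zl by lra.
    destruct HU as (_ & _ & _ & HZ); rewrite (HZ h Hh r Y) by lra.
    refine (_ : (_ + _ = _ + _ :> R)); f_equal.
    apply RInt_ext; rewrite Rmin_left by lra; intros p Hp.
    rewrite future_betaz, future_zl by lra; reflexivity.
  - rewrite <- (Rplus_0_l (rec_betaz D V h t (uzl V h t Y))).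
    apply (is_derive_plus (K := R_AbsRing) (fun _ => Y)
      (fun t => RInt (fun r => rec_betaz D V h r (uzl V h r Y)) 0 t)).
    + apply (is_derive_const Y).
    + apply (is_derive_RInt_cont (fun r => rec_betaz D V h r (uzl V h r Y))).
      intros y; now apply (C0_slice1 (fun x Z => rec_betaz D V h x (uzl V h x Z))). }
destruct (partials_past_zl D h continuous_alpha (inv h) (Hinv h)) as (fz & P).
assert (Hpast : forall x z, x <= 0 ->
          rec_betaz D V h x z = past_betaz D h (x - z)).
{ intros t y Ht; unfold rec_betaz, past_betaz.
  rewrite rec_up2_past, past_s by auto.
  pose proof (intensity_nonneg D h (t - y)); field; lra. }
assert (PV : partials (uzl V h)
  (glue (d_0 g) (fun x Z => past_betaz D h (x - past_zl D h (inv h) x Z)))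
  (glue (d_z g) fz)).
{ rewrite E; apply partials_glue; auto.
  - intros z; rewrite H0; symmetry; apply past_zl_0; auto using continuous_alpha.
  - intros z; rewrite Hfut by lra.
    rewrite Hpast, past_zl_ext by lra; reflexivity. }
split; [|now apply partials_C1 in PV].
rewrite (partials_d_0 _ _ _ PV); unfold glue.
destruct (Rle_dec 0 x) as [Hx|Hx]; [now apply Hfut|].
rewrite Hpast, past_zl_ext by lra; reflexivity.
Qed.

Lemma C1_ext_zl : C1 (uzl V h).
Proof. exact (proj2 (ext_d_0_zl 0 0)). Qed.

Lemma ext_motion_z x Z :
  is_derive (fun t => uzl V h t Z) x (rec_betaz D V h x (uzl V h x Z)).
Proof.
destruct (ext_d_0_zl x Z) as [<- _].
destruct (C1_partials _ C1_ext_zl) as (P & _); exact (P x Z).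
Qed.

Lemma ext_trajectory f x Z : C1 f ->
  is_derive (fun t => f t (uzl V h t Z)) x
    (d_0 f x (uzl V h x Z)
     + rec_betaz D V h x (uzl V h x Z) * d_z f x (uzl V h x Z)).
Proof.
intros Hf.
replace (d_0 f x (uzl V h x Z)
     + rec_betaz D V h x (uzl V h x Z) * d_z f x (uzl V h x Z))
  with (d_0 f x (uzl V h x Z) * 1
     + d_z f x (uzl V h x Z) * rec_betaz D V h x (uzl V h x Z)) by ring.
apply (partials_curve f _ _ (fun r => r) (fun r => uzl V h r Z)).
- now apply C1_partials.
- apply (is_derive_id x).
- apply ext_motion_z.
Qed.

End Species.

Lemma C0_ext_Ez : C0 (rec_Ez D Zbar V).
Proof.
apply C0_mult; [apply C0_const|]; apply C0_sum; intros h Hh.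
apply C0_mult; [apply C0_const|].
apply (C0_comp1 (Ncum D Zbar h)); [|now apply C0_ext_Zl].
intros x z; apply (continuous_RInt_cont (n0 D h)); apply HD, Hh.
Qed.

Lemma past_Ez x z : x <= 0 -> rec_Ez D Zbar V x z = 0.
Proof.
intros Hx; unfold rec_Ez.
(* For [z < 0] the labels [Z_h] may differ between species, but all are negative and [n0] vanishes
   from there up to [0]; the cumulated densities can thus be evaluated at the common point [0]. *)
rewrite (sum_species_ext D _ (fun h => q D h * Ncum D Zbar h (Rmax z 0))).
- rewrite neutral_Ncum by auto; ring.
- intros h Hh; f_equal.
  destruct (Rlt_le_dec z 0) as [Hz|Hz].
  + rewrite Rmax_right by lra; unfold Ncum.
    pose proof HD as (_ & _ & _ & Hc & Hneg & _).
    pose proof (ext_Zl_neg h Hh x z Hx Hz) as HZ.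
    rewrite <- (RInt_Chasles (n0 D h) Zbar (uZl V h x z) 0)
      by (apply ex_RInt_cont; now apply Hc).
    rewrite (RInt_ext (n0 D h) (fun _ => 0) (uZl V h x z)).
    * rewrite RInt_const.
      assert (E : forall a b : R, a = a + b * 0) by (intros; ring); apply E.
    * rewrite Rmax_right by lra; intros t Ht; apply Hneg; auto; lra.
  + rewrite Rmax_left by lra; now rewrite ext_Zl_front.
Qed.

Lemma future_Ez x z : 0 <= x -> rec_Ez D Zbar V x z = rec_Ez D Zbar U x z.
Proof.
intros Hx; unfold rec_Ez; f_equal; apply sum_species_ext; intros h Hh.
now rewrite future_Zl.
Qed.

Lemma d_minus_rec_up2_past h x z : x <= 0 -> d_minus (rec_up2 D V h) x z = 0.
Proof.
intros Hx; unfold d_minus.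
rewrite (free_wave_d_plus _ (intensity D h) (C1_rec_up2 h) (rec_up2_past h) x z Hx).
ring.
Qed.

(** * Transport of [s_h], densities and Lorentz equations *)

Section SpeciesEquations.

Variable h : nat.
Hypothesis Hh : species D h.

Let drive (t Z : R) : R :=
  tilde (uzl V h) (d_minus (rec_up2 D V h)) t Z
  / tilde (uzl V h) (rec_gamma D V h) t Z.

Lemma C0_growth : C0 (growth D Zbar V h).
Proof.
apply C0_div.
- intros x z; apply Rgt_not_eq, rec_gamma_pos, Hh.
- apply C0_tilde; [now apply C0_ext_zl|].
  apply C0_mult; [|apply C0_const].
  apply C0_mult; [apply C0_const | apply C0_ext_Ez].
- apply C0_tilde; [now apply C0_ext_zl | now apply C0_rec_gamma].
Qed.

Lemma C0_drive : C0 drive.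
Proof.
apply C0_div.
- intros x z; apply Rgt_not_eq, rec_gamma_pos, Hh.
- apply C0_tilde; [now apply C0_ext_zl | apply C0_d_minus, C1_rec_up2].
- apply C0_tilde; [now apply C0_ext_zl | now apply C0_rec_gamma].
Qed.

Lemma ext_s_linear x Z : 0 <= x ->
  us V h x (uzl V h x Z)
  = linear_solution (fun t => growth D Zbar V h t Z) (fun t => drive t Z) x.
Proof.
intros Hx.
rewrite linear_solution_Duhamel.
- destruct HU as (_ & _ & HS & _); specialize (HS h Hh x Z Hx).
  rewrite future_zl, future_s by auto; unfold tilde at 1 in HS; rewrite HS.
  assert (EG : forall t, 0 <= t -> growth D Zbar U h t Z = growth D Zbar V h t Z).
  { intros t Ht; unfold growth, tilde, eps.
    now rewrite future_zl, future_Ez, future_gamma. }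
  f_equal.
  + f_equal; apply RInt_ext; rewrite Rmin_left by auto; intros t Ht.
    apply EG; lra.
  + apply RInt_ext; rewrite Rmin_left, Rmax_right by auto; intros t Ht.
    refine (_ : (_ * _ = _ * _ :> R)); f_equal.
    * f_equal; apply RInt_ext; rewrite Rmin_left by lra; intros r Hr.
      apply EG; lra.
    * unfold drive, tilde; rewrite future_zl, future_gamma by lra; reflexivity.
- intros t; apply (C0_slice1 _ Z t C0_growth).
- intros t; apply (C0_slice1 _ Z t C0_drive).
Qed.

Definition s_source (x z : R) : R :=
  eps D Zbar V h x z / rec_gamma D V h x z * us V h x z
  + d_minus (rec_up2 D V h) x z / rec_gamma D V h x z.

Lemma C0_s_source : C0 s_source.
Proof.
assert (Hn : forall x z, rec_gamma D V h x z <> 0)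
  by (intros; apply Rgt_not_eq, rec_gamma_pos, Hh).
apply C0_plus; [|apply C0_div; auto using C0_rec_gamma].
- apply C0_mult; [|now apply C0_ext_s].
  apply C0_div; auto using C0_rec_gamma.
  apply C0_mult; [|apply C0_const].
  apply C0_mult; [apply C0_const | apply C0_ext_Ez].
- apply C0_d_minus, C1_rec_up2.
Qed.

Lemma s_source_past x z : x <= 0 -> s_source x z = 0.
Proof.
intros Hx; unfold s_source, eps; rewrite past_Ez, d_minus_rec_up2_past by auto.
unfold Rdiv; ring.
Qed.

(** Every point lies on a trajectory, along which Duhamel's formula can be differentiated; as [g] is
    C1 the result splits into its partial derivatives. *)
Lemma ext_s_transport_C1 : C1 (us V h) /\ forall x z,
  d_0 (us V h) x z + rec_betaz D V h x z * d_z (us V h) x z = s_source x z.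
Proof.
destruct (ext_s_representation h Hh) as (g & Hg & H0 & HgE & E).
pose proof (C1_partials _ Hg) as (G1 & G2 & G3 & G4).
pose proof C0_s_source as CS.
assert (Hfut : forall x z, 0 <= x ->
          d_0 g x z + rec_betaz D V h x z * d_z g x z = s_source x z).
{ apply C0_eq_right; auto.
  { apply C0_plus; auto; apply C0_mult; auto; now apply C0_rec_betaz. }
  intros x z Hx; rewrite <- (ext_zl_Zl h Hh x z); set (Z := uZl V h x z).
  apply (is_derive_inj (fun t => g t (uzl V h t Z)) x).
  - now apply ext_trajectory.
  - apply (is_derive_ext_loc (linear_solution
      (fun t => growth D Zbar V h t Z) (fun t => drive t Z))).
    + generalize (locally_lt 0 x Hx); apply filter_imp; intros t Ht.
      rewrite <- ext_s_linear by lra; apply HgE; lra.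
    + unfold s_source.
      change (eps D Zbar V h x (uzl V h x Z) / rec_gamma D V h x (uzl V h x Z))
        with (growth D Zbar V h x Z).
      rewrite ext_s_linear by lra.
      apply (is_derive_linear_solution (fun t => growth D Zbar V h t Z)
               (fun t => drive t Z)).
      * intros t; apply (C0_slice1 _ Z t C0_growth).
      * intros t; apply (C0_slice1 _ Z t C0_drive). }
assert (Hz0 : forall z, d_z g 0 z = 0).
{ intros z; apply is_derive_unique.
  apply (is_derive_ext (fun _ => 1)); [intros; now rewrite H0|].
  apply (is_derive_const 1). }
assert (PV : partials (us V h) (glue (d_0 g) (fun _ _ => 0))
               (glue (d_z g) (fun _ _ => 0))).
{ rewrite E; apply partials_glue; auto using partials_const, C1_partials.
  (* At [x0 = 0] both the source and the [z]-derivative vanish, so the time derivative does too and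
     fits the constant past. *)
  intros z; pose proof (Hfut 0 z (Rle_refl 0)) as H.
  rewrite s_source_past, Hz0 in H by lra; lra. }
split; [now apply partials_C1 in PV|].
intros x z; rewrite (partials_d_0 _ _ _ PV), (partials_d_z _ _ _ PV).
unfold glue; destruct (Rle_dec 0 x) as [Hx|Hx]; [now apply Hfut|].
rewrite s_source_past by lra; ring.
Qed.

Lemma C1_ext_s : C1 (us V h).
Proof. apply ext_s_transport_C1. Qed.

Lemma ext_s_transport x z :
  d_0 (us V h) x z + rec_betaz D V h x z * d_z (us V h) x z = s_source x z.
Proof. apply ext_s_transport_C1. Qed.

Lemma C1_rec_betaz : C1 (rec_betaz D V h).
Proof.
apply C1_slowness_ratio;
  [apply C1_rec_up2 | apply C1_ext_s | apply rec_up2_nonneg].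
Qed.

Lemma C1_rec_betap i : C1 (rec_betap D V h i).
Proof.
apply C1_div.
- intros x z; apply Rgt_not_eq, denominator_pos.
- apply C1_mult; [apply C1_scal, C1_ext_s | apply C1_rec_up].
- apply C1_plus; [|apply C1_pow2, C1_ext_s].
  apply C1_plus; [apply C1_const | apply C1_rec_up2].
Qed.

Lemma ext_zl_0 Z : uzl V h 0 Z = Z.
Proof. rewrite future_zl by lra; now apply unknown_zl_0. Qed.

Lemma ext_zl_integral t Z :
  uzl V h t Z = Z + RInt (fun r => rec_betaz D V h r (uzl V h r Z)) 0 t.
Proof.
rewrite <- (ext_zl_0 Z) at 2.
apply (eq_RInt_derive (fun t => uzl V h t Z)).
- intros; now apply ext_motion_z.
- intros r _; apply (C0_slice1 (tilde (uzl V h) (rec_betaz D V h))).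
  apply C0_tilde; [now apply C0_ext_zl | now apply C0_rec_betaz].
Qed.

Lemma ext_jacobian_pos t Z : 0 < d_z (uzl V h) t Z.
Proof.
rewrite (flow_jacobian (rec_betaz D V h)); auto using C1_rec_betaz, C1_ext_zl.
- apply exp_pos.
- intros; apply ext_zl_integral.
Qed.

Lemma ext_partials_Zl : partials (uZl V h)
  (fun x z => - d_0 (uzl V h) x (uZl V h x z) / d_z (uzl V h) x (uZl V h x z))
  (fun x z => / d_z (uzl V h) x (uZl V h x z)).
Proof.
apply (partials_inverse (uzl V h) (d_0 (uzl V h)) (d_z (uzl V h)) (uZl V h));
  auto using ext_zl_increasing, ext_zl_Zl, ext_Zl_zl, ext_jacobian_pos,
    C1_partials, C1_ext_zl.
Qed.

Lemma C0_rec_n : C0 (rec_n D V h).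
Proof.
apply C0_mult.
- apply (C0_comp1 (n0 D h)); [|now apply C0_ext_Zl].
  pose proof HD as (_ & _ & _ & Hc & _); intros; now apply Hc.
- pose proof (partials_C1 _ _ _ ext_partials_Zl) as (_ & _ & _ & H); exact H.
Qed.

Let F := reconstruction D Zbar V.

(** The ratio is the inverse of the recovered [gamma], so the square root in the definition of
    [gamma] is taken of a perfect square. *)
Lemma rec_beta_sq x z :
  sqnorm (betap F h) x z + betaz F h x z ^ 2
  = 1 - (2 * us V h x z / (1 + rec_up2 D V h x z + us V h x z ^ 2)) ^ 2.
Proof.
pose proof (denominator_pos h x z) as Hd.
unfold sqnorm; simpl betap; simpl betaz; unfold rec_betap, rec_betaz.
unfold rec_up2, sqnorm in *; field; lra.
Qed.

Lemma rec_beta_ratio_pos x z :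
  0 < 2 * us V h x z / (1 + rec_up2 D V h x z + us V h x z ^ 2).
Proof.
apply Rdiv_lt_0_compat; [|apply denominator_pos].
pose proof (ext_s_pos h Hh x z); lra.
Qed.

Lemma rec_subluminal x z : sqnorm (betap F h) x z + betaz F h x z ^ 2 < 1.
Proof.
rewrite rec_beta_sq; pose proof (rec_beta_ratio_pos x z).
set (r := 2 * us V h x z / _) in *; nra.
Qed.

Lemma gamma_reconstruction : gamma F h = rec_gamma D V h.
Proof.
apply funext2; intros x z; unfold gamma; rewrite rec_beta_sq.
pose proof (rec_beta_ratio_pos x z) as Hr.
pose proof (denominator_pos h x z); pose proof (ext_s_pos h Hh x z).
set (r := 2 * us V h x z / _) in *.
replace (1 - (1 - r ^ 2)) with (r ^ 2) by ring.
rewrite sqrt_pow2 by lra; unfold r, rec_gamma; field; lra.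
Qed.

Lemma up_reconstruction : up F h = rec_up D V h.
Proof.
apply functional_extensionality; intros i; apply funext2; intros x z.
unfold up; rewrite gamma_reconstruction; simpl betap.
pose proof (denominator_pos h x z); pose proof (ext_s_pos h Hh x z).
unfold rec_gamma, rec_betap; field; lra.
Qed.

Lemma uz_reconstruction : uz F h = rec_uz D V h.
Proof.
apply funext2; intros x z; unfold uz; rewrite gamma_reconstruction; simpl betaz.
pose proof (denominator_pos h x z); pose proof (ext_s_pos h Hh x z).
unfold rec_gamma, rec_betaz, rec_uz; field; lra.
Qed.

Lemma s_reconstruction : s F h = us V h.
Proof.
apply funext2; intros x z; unfold s.
rewrite gamma_reconstruction, uz_reconstruction.
pose proof (ext_s_pos h Hh x z); unfold rec_gamma, rec_uz; field; lra.
Qed.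

Lemma rec_up2_Ap : rec_up2 D V h
  = fun x z => (q D h / (m D h * c D ^ 2)) ^ 2 * sqnorm (uA V) x z.
Proof.
apply funext2; intros x z; unfold rec_up2, rec_up, sqnorm; unfold Rdiv; ring.
Qed.

Lemma lorentz_reconstruction x z :
  (forall i,
     material F h
       (fun t y => m D h * c D ^ 2 * up F h i t y + q D h * Ap F i t y)
       x z = 0) /\
  material F h (gamma F h) x z
    - q D h * uz F h x z * Ez F x z / (m D h * c D ^ 2 * gamma F h x z)
    - q D h ^ 2 * d_0 (sqnorm (Ap F)) x z
        / (2 * gamma F h x z * m D h ^ 2 * c D ^ 4) = 0 /\
  material F h (uz F h) x z
    - q D h * Ez F x z / (m D h * c D ^ 2)
    + q D h ^ 2 * d_z (sqnorm (Ap F)) x z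
        / (2 * gamma F h x z * m D h ^ 2 * c D ^ 4) = 0.
Proof.
rewrite gamma_reconstruction, up_reconstruction, uz_reconstruction.
assert (Hc : 0 < c D) by (destruct HD as (_ & H & _); exact H).
assert (Hm : 0 < m D h) by (destruct HD as (_ & _ & H & _); exact (H h Hh)).
pose proof (C1_partials _ (C1_rec_up2 h)) as Pu.
pose proof (C1_partials _ C1_ext_s) as Ps.
pose proof (ext_s_transport x z) as T; unfold s_source, d_minus in T.
pose proof (rec_up2_nonneg h x z) as Hu; pose proof (ext_s_pos h Hh x z) as Hs.
pose proof (denominator_pos h x z) as Hd.
assert (PA : partials (rec_up2 D V h)
  (fun x z => (q D h / (m D h * c D ^ 2)) ^ 2 * d_0 (sqnorm (uA V)) x z)
  (fun x z => (q D h / (m D h * c D ^ 2)) ^ 2 * d_z (sqnorm (uA V)) x z)).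
{ rewrite rec_up2_Ap; apply partials_scal, C1_partials, C1_sqnorm, ext_C1_A. }
assert (Hs2 : forall x z, 2 * us V h x z <> 0).
{ intros t y; pose proof (ext_s_pos h Hh t y); lra. }
pose proof (partials_plus _ _ _ _ _ _ (partials_const 1) Pu) as P1.
pose proof (partials_div _ _ _ _ _ _ Hs2
  (partials_plus _ _ _ _ _ _ P1 (partials_pow2 _ _ _ Ps))
  (partials_scal 2 _ _ _ Ps)) as Pg.
pose proof (partials_div _ _ _ _ _ _ Hs2
  (partials_minus _ _ _ _ _ _ P1 (partials_pow2 _ _ _ Ps))
  (partials_scal 2 _ _ _ Ps)) as Pz.
unfold material; split; [|split].
- intros i.
  (* The recovered transverse momentum makes the canonical momentum identically zero, not merely
     conserved. *)
  replace (fun t y => m D h * c D ^ 2 * rec_up D V h i t y + q D h * Ap F i t y)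
    with (fun _ _ : R => 0).
  + rewrite (partials_d_0 _ _ _ (partials_const 0)),
      (partials_d_z _ _ _ (partials_const 0)); ring.
  + apply funext2; intros t y; unfold rec_up.
    change (Ap F i t y) with (uA V i t y); field; lra.
- rewrite (partials_d_0 (rec_gamma D V h) _ _ Pg),
    (partials_d_z (rec_gamma D V h) _ _ Pg).
  pose proof (gamma_equation_algebra _ _ _ _ _ _ _ Hu Hs T) as E.
  change (betaz F h x z) with (rec_betaz D V h x z); unfold rec_betaz.
  rewrite !Rplus_0_l, E.
  rewrite (partials_d_0 _ _ _ PA); unfold eps, rec_gamma, rec_uz.
  change (Ez F x z) with (rec_Ez D Zbar V x z).
  change (sqnorm (Ap F)) with (sqnorm (uA V)); field; lra.
- rewrite (partials_d_0 (rec_uz D V h) _ _ Pz),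
    (partials_d_z (rec_uz D V h) _ _ Pz).
  pose proof (uz_equation_algebra _ _ _ _ _ _ _ Hu Hs T) as E.
  change (betaz F h x z) with (rec_betaz D V h x z); unfold rec_betaz.
  rewrite !Rplus_0_l, E.
  rewrite (partials_d_z _ _ _ PA); unfold eps, rec_gamma, rec_uz.
  change (Ez F x z) with (rec_Ez D Zbar V x z).
  change (sqnorm (Ap F)) with (sqnorm (uA V)); field; lra.
Qed.

End SpeciesEquations.

(** * Maxwell's equations for the reconstructed fields *)

Let F := reconstruction D Zbar V.

Lemma partials_ext_Ez : partials (rec_Ez D Zbar V)
  (fun x z => 4 * PI * sum_species D (fun h => q D h * (n0 D h (uZl V h x z)
    * (- d_0 (uzl V h) x (uZl V h x z) / d_z (uzl V h) x (uZl V h x z)))))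
  (fun x z => 4 * PI * sum_species D (fun h => q D h * (n0 D h (uZl V h x z)
    * / d_z (uzl V h) x (uZl V h x z)))).
Proof.
apply (partials_rec_Ez D Zbar V
  (fun h x z => - d_0 (uzl V h) x (uZl V h x z) / d_z (uzl V h) x (uZl V h x z))
  (fun h x z => / d_z (uzl V h) x (uZl V h x z))).
- pose proof HD as (_ & _ & _ & Hc & _); exact Hc.
- intros h Hh; now apply ext_partials_Zl.
Qed.

Lemma rec_n_jacobian h x z : species D h ->
  rec_n D V h x z = n0 D h (uZl V h x z) * / d_z (uzl V h) x (uZl V h x z).
Proof.
intros Hh; unfold rec_n; now rewrite (partials_d_z _ _ _ (ext_partials_Zl h Hh)).
Qed.

Lemma ext_d_z_Ez x z :
  d_z (rec_Ez D Zbar V) x z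
  = 4 * PI * sum_species D (fun h => q D h * rec_n D V h x z).
Proof.
rewrite (partials_d_z _ _ _ partials_ext_Ez); f_equal.
apply sum_species_ext; intros h Hh; now rewrite rec_n_jacobian.
Qed.

Lemma ext_d_0_Ez x z :
  d_0 (rec_Ez D Zbar V) x z
  = - (4 * PI * sum_species D
         (fun h => q D h * rec_n D V h x z * rec_betaz D V h x z)).
Proof.
rewrite (partials_d_0 _ _ _ partials_ext_Ez), Ropp_mult_distr_r; f_equal.
rewrite <- (Rmult_1_l (sum_species D (fun h => q D h * rec_n D V h x z
                                               * rec_betaz D V h x z))).
rewrite Ropp_mult_distr_l, <- sum_species_scal.
apply sum_species_ext; intros h Hh; rewrite rec_n_jacobian by auto.
(* The label [Z_h] is transported by the flow: its time derivative is [- betaz] times its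
   [z]-derivative, which turns charge into current. *)
rewrite (proj1 (ext_d_0_zl h Hh x (uZl V h x z))), ext_zl_Zl by auto.
unfold Rdiv; ring.
Qed.

Definition wave_source (i : Perp) (x z : R) : R :=
  2 * PI * sum_species D (fun j => q D j * rec_n D V j x z * rec_betap D V j i x z).

Lemma C0_wave_source i : C0 (wave_source i).
Proof.
apply C0_mult; [apply C0_const|]; apply C0_sum; intros j Hj.
apply C0_mult; [|now apply C1_C0, C1_rec_betap].
apply C0_mult; [apply C0_const | now apply C0_rec_n].
Qed.

Lemma ext_wave_formula i x z : 0 <= x ->
  uA V i x z - alpha D i (x - z) = cone_integral (wave_source i) x z.
Proof.
intros Hx; destruct HU as (_ & HW & _).
change (uA V i x z) with (uA U i x z); rewrite (HW i x z Hx).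
apply RInt_ext; rewrite Rmin_left, Rmax_right by auto; intros t Ht.
apply RInt_ext; intros y _; unfold wave_source.
refine (_ : (_ * _ = _ * _ :> R)); f_equal.
apply sum_species_ext; intros j Hj.
now rewrite future_n, future_betap by lra.
Qed.

(** Where there is matter the wave has not yet arrived, and where the wave is there is no matter. *)
Lemma wave_source_past i x z : x <= 0 -> wave_source i x z = 0.
Proof.
intros Hx; unfold wave_source; rewrite sum_species_0; [ring|].
intros j Hj; destruct (Rlt_le_dec z 0) as [Hz|Hz].
- unfold rec_n; pose proof HD as (_ & _ & _ & _ & Hneg & _).
  rewrite Hneg; auto; [ring | now apply ext_Zl_neg].
- unfold rec_betap, rec_up; rewrite ext_free, alpha_neg by lra.
  unfold Rdiv; ring.
Qed.

Lemma ext_dalembertian i x z : dalembertian (uA V i) x z = 2 * wave_source i x z.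
Proof.
destruct (Rle_lt_dec 0 x) as [Hx|Hx].
- apply (dalembertian_of_formula _ _ (alpha D i)); auto.
  + apply ext_C2_A.
  + apply C0_wave_source.
  + intros; now apply ext_wave_formula.
- rewrite wave_source_past, Rmult_0_r by lra.
  pose proof (is_derive_along_minus (uA V i) (x + z) x (ext_C2_A i)) as H.
  replace (x + z - x) with z in H by ring.
  apply (is_derive_inj _ _ _ _ H).
  apply (is_derive_ext_loc (fun _ => 0)).
  + generalize (locally_gt 0 x Hx); apply filter_imp; intros t Ht.
    symmetry; apply (free_wave_d_plus _ (alpha D i)); try lra.
    * apply ext_C1_A.
    * intros; now apply ext_free.
  + apply (is_derive_const 0).
Qed.

(** The transverse current is proportional to [A^perp]. The factor still contains [A^perp] through
    [rec_up2], but it is treated as a given continuous coefficient. *)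
Definition wave_coupling (x z : R) : R :=
  2 * PI * sum_species D (fun j => q D j * rec_n D V j x z
    * (2 * us V j x z / (1 + rec_up2 D V j x z + us V j x z ^ 2)
       * (- q D j / (m D j * c D ^ 2)))).

Lemma wave_source_linear i x z :
  wave_source i x z = wave_coupling x z * uA V i x z.
Proof.
unfold wave_source, wave_coupling; set (S := fun j => q D j * _ * (_ * _)).
replace (2 * PI * sum_species D S * uA V i x z)
  with (2 * PI * (uA V i x z * sum_species D S)) by ring.
f_equal; unfold S; rewrite <- sum_species_scal.
apply sum_species_ext; intros j Hj; unfold rec_betap, rec_up.
unfold Rdiv; ring.
Qed.

Lemma C0_wave_coupling : C0 wave_coupling.
Proof.
apply C0_mult; [apply C0_const|]; apply C0_sum; intros j Hj.
apply C0_mult; [apply C0_mult; [apply C0_const | now apply C0_rec_n]|].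
apply C0_mult; [|apply C0_const]; apply C0_div.
- intros x z; apply Rgt_not_eq, denominator_pos.
- apply C0_mult; [apply C0_const | now apply C0_ext_s].
- apply C0_plus; [|now apply C0_pow2, C0_ext_s].
  apply C0_plus; [apply C0_const | apply C1_C0, C1_rec_up2].
Qed.

(** * Nothing happens ahead of the front *)

Lemma ext_A_front i x z : x <= z -> uA V i x z = 0.
Proof.
intros Hxz; destruct (Rle_lt_dec x 0) as [Hx|Hx].
{ rewrite ext_free by auto; apply alpha_neg; lra. }
apply (linear_wave_vanishes _ wave_coupling); try lra.
- apply C1_C0, ext_C1_A.
- apply C0_wave_coupling.
- intros t y Hp; pose proof (past_cone_front _ _ _ _ Hxz Hp).
  replace (fun t y => wave_coupling t y * uA V i t y) with (wave_source i)
    by (apply funext2; intros; apply wave_source_linear).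
  rewrite <- ext_wave_formula, alpha_neg by (try lra; apply Hp); ring.
Qed.

Lemma rec_up_front h i x z : x <= z -> rec_up D V h i x z = 0.
Proof. intros H; unfold rec_up; rewrite ext_A_front by auto; ring. Qed.

Lemma rec_up2_front h x z : x <= z -> rec_up2 D V h x z = 0.
Proof.
intros H; unfold rec_up2, sqnorm; rewrite !rec_up_front by auto; ring.
Qed.

(** The derivative of a square contains the function as a factor, so the claim holds on the boundary
    [x = z] as well. *)
Lemma d_minus_rec_up2_front h x z : x <= z -> d_minus (rec_up2 D V h) x z = 0.
Proof.
intros H.
pose proof (partials_plus _ _ _ _ _ _
  (partials_pow2 _ _ _ (C1_partials _ (C1_rec_up h px)))
  (partials_pow2 _ _ _ (C1_partials _ (C1_rec_up h py)))) as P.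
unfold d_minus.
rewrite (partials_d_0 (rec_up2 D V h) _ _ P),
  (partials_d_z (rec_up2 D V h) _ _ P), !rec_up_front by auto; ring.
Qed.

Lemma ext_trajectory_past_cone h t Z r : species D h -> 0 <= r <= t ->
  past_cone t (uzl V h t Z) r (uzl V h r Z).
Proof.
intros Hh Hr; split; auto.
assert (Hb : forall r, -1 < rec_betaz D V h r (uzl V h r Z) < 1).
{ intros p; apply (abs_lt_1_of_sq (sqnorm (betap F h) p (uzl V h p Z))).
  - apply sqnorm_nonneg.
  - apply (rec_subluminal h Hh). }
assert (H1 : uzl V h t Z - t <= uzl V h r Z - r).
{ apply (antitone_of_derive (fun t => uzl V h t Z - t)
    (fun t => rec_betaz D V h t (uzl V h t Z) - 1)); try lra.
  - intros p; apply (is_derive_minus (K := R_AbsRing) (fun t => uzl V h t Z)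
      (fun t => t)); [now apply ext_motion_z | apply (is_derive_id p)].
  - intros p _; specialize (Hb p); lra. }
assert (H2 : - uzl V h t Z - t <= - uzl V h r Z - r).
{ apply (antitone_of_derive (fun t => - uzl V h t Z - t)
    (fun t => - rec_betaz D V h t (uzl V h t Z) - 1)); try lra.
  - intros p; apply (is_derive_minus (K := R_AbsRing) (fun t => - uzl V h t Z)
      (fun t => t)); [|apply (is_derive_id p)].
    apply (is_derive_opp (K := R_AbsRing) (fun t => uzl V h t Z)).
    now apply ext_motion_z.
  - intros p _; specialize (Hb p); lra. }
apply Rabs_le; lra.
Qed.

(** Ahead of the front only [E^z] drives [s_h], and trajectories remain in the cone. The coefficient
    [s / gamma] is twice a ratio between [0] and [1], so no a priori bound on [s_h] is required. *)
Lemma front_s_bound h x z lam M : species D h -> x <= z -> 0 < lam -> 0 <= M ->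
  (forall t y, past_cone x z t y ->
     Rabs (rec_Ez D Zbar V t y) <= M * exp (lam * t)) ->
  forall t y, past_cone x z t y ->
  Rabs (us V h t y - 1)
  <= 2 * (Rabs (q D h) / (m D h * c D ^ 2)) * M / lam * exp (lam * t).
Proof.
intros Hh Hxz Hl HM HE t y Hp.
assert (Hmc : 0 < m D h * c D ^ 2) by (now apply mass_pos).
set (kap := Rabs (q D h) / (m D h * c D ^ 2)).
assert (Hk : 0 <= kap) by (apply Rdiv_le_0_compat; [apply Rabs_pos | auto]).
rewrite <- (ext_zl_Zl h Hh t y) in *; set (Z := uZl V h t y) in *.
pose proof (C0_s_source h Hh) as Csrc; set (src := s_source h) in *.
assert (Ct : forall r, continuous (fun r => src r (uzl V h r Z)) r).
{ intros r; apply (C0_slice1 (tilde (uzl V h) src)).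
  apply C0_tilde; auto; now apply C0_ext_zl. }
assert (E : us V h t (uzl V h t Z)
  = us V h 0 (uzl V h 0 Z) + RInt (fun r => src r (uzl V h r Z)) 0 t).
{ apply (eq_RInt_derive (fun r => us V h r (uzl V h r Z))
    (fun r => src r (uzl V h r Z))); intros r _; auto.
  unfold src; rewrite <- (ext_s_transport h Hh).
  apply ext_trajectory; auto; now apply C1_ext_s. }
rewrite E, (past_s h Hh 0) by lra.
rewrite Rplus_minus_l; apply Rabs_RInt_exp_le; auto.
- apply Hp.
- apply Rmult_le_pos; lra.
- intros r Hr.
  pose proof (past_cone_trans _ _ _ _ _ _ Hp
                (ext_trajectory_past_cone h t Z r Hh Hr)) as Hp'.
  specialize (HE _ _ Hp'); set (w := uzl V h r Z) in *.
  unfold src, s_source; rewrite d_minus_rec_up2_front by (now apply (past_cone_front x z)).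
  pose proof (ext_s_pos h Hh r w) as Hs; pose proof (denominator_pos h r w) as Hd.
  pose proof (rec_up2_nonneg h r w).
  assert (E2 : eps D Zbar V h r w / rec_gamma D V h r w * us V h r w
      + 0 / rec_gamma D V h r w
    = - (q D h / (m D h * c D ^ 2)) * rec_Ez D Zbar V r w
      * (2 * (us V h r w ^ 2 / (1 + rec_up2 D V h r w + us V h r w ^ 2)))).
  { unfold eps, rec_gamma; field.
    destruct HD as (_ & Hc & Hm & _); specialize (Hm h Hh); lra. }
  rewrite E2, !Rabs_mult, Rabs_Ropp.
  assert (Ek : Rabs (q D h / (m D h * c D ^ 2)) = kap).
  { unfold kap, Rdiv; rewrite Rabs_mult; f_equal.
    apply Rabs_right; left; now apply Rinv_0_lt_compat. }
  rewrite Ek.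
  set (rho := us V h r w ^ 2 / _).
  assert (Hrho : 0 <= rho <= 1).
  { unfold rho; split.
    - apply Rdiv_le_0_compat; auto; apply pow2_ge_0.
    - apply Rmult_le_reg_r with (1 + rec_up2 D V h r w + us V h r w ^ 2); auto.
      unfold Rdiv; rewrite Rmult_assoc, Rinv_l by lra; lra. }
  rewrite (Rabs_right 2), (Rabs_right rho) by lra.
  pose proof (Rabs_pos (rec_Ez D Zbar V r w)).
  assert (0 <= kap * Rabs (rec_Ez D Zbar V r w)) by (apply Rmult_le_pos; auto).
  assert (kap * Rabs (rec_Ez D Zbar V r w) <= kap * (M * exp (lam * r)))
    by (apply Rmult_le_compat_l; auto).
  assert (kap * Rabs (rec_Ez D Zbar V r w) * (2 * rho)
          <= kap * Rabs (rec_Ez D Zbar V r w) * 2)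
    by (apply Rmult_le_compat_l; lra).
  lra.
Qed.

Lemma front_betaz_bound h x z : species D h -> x <= z ->
  Rabs (rec_betaz D V h x z) <= 2 * Rabs (us V h x z - 1).
Proof.
intros Hh Hxz; unfold rec_betaz; rewrite rec_up2_front by auto.
set (r := us V h x z); pose proof (ext_s_pos h Hh x z) as Hr; fold r in Hr.
(* The velocity vanishes to first order at [r = 1], and the remaining factor is at most [2] for
   every positive [r]. *)
replace ((1 + 0 - r ^ 2) / (1 + 0 + r ^ 2))
  with (- ((1 + r) / (1 + r ^ 2)) * (r - 1)) by (field; nra).
rewrite Rabs_mult, Rabs_Ropp; apply Rmult_le_compat_r; [apply Rabs_pos|].
rewrite Rabs_right by (apply Rle_ge, Rdiv_le_0_compat; nra).
apply Rmult_le_reg_r with (1 + r ^ 2); [nra|].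
unfold Rdiv; rewrite Rmult_assoc, Rinv_l by nra; nra.
Qed.

Lemma ext_Ez_front x z : x <= z -> rec_Ez D Zbar V x z = 0.
Proof.
intros Hxz; destruct (Rle_lt_dec x 0) as [Hx|Hx]; [now apply past_Ez|].
(* The current is bounded by the densities times [betaz]; one factor [2] comes from
   [front_betaz_bound], the rest from [front_s_bound]. *)
set (w := fun t y => sum_species D (fun h => Rabs (4 * PI * (q D h * rec_n D V h t y))
   * (2 * (2 * (Rabs (q D h) / (m D h * c D ^ 2)))))).
assert (Cw : C0 w).
{ apply C0_sum; intros h Hh; apply C0_mult; [|apply C0_const].
  apply C0_Rabs, C0_mult; [apply C0_const|].
  apply C0_mult; [apply C0_const | now apply C0_rec_n]. }
destruct (C0_bounded_on_past_cone w x z Cw) as (C & HC & Hw).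
(* Two integrations occur, one along trajectories for [s_h] and one at fixed position for [E^z]. The
   total factor is [C / (lam * lam)], here at most one half. *)
set (lam := 1 + 2 * C); assert (Hlam : 0 < lam) by (unfold lam; lra).
apply (vanishes_on_past_cone (rec_Ez D Zbar V) x z lam);
  [apply C0_ext_Ez | lra | | apply past_cone_apex; lra].
intros M HM HE t y Hp.
pose proof (past_cone_rectangle _ _ _ _ Hp) as [Ht _].
assert (Hvert : forall r, 0 <= r <= t -> past_cone x z r y).
{ intros r Hr; destruct Hp as [_ Hy]; split; lra. }
assert (E : rec_Ez D Zbar V t y = rec_Ez D Zbar V 0 y
              + RInt (fun r => d_0 (rec_Ez D Zbar V) r y) 0 t).
{ pose proof (C1_partials _ (partials_C1 _ _ _ partials_ext_Ez)) as (P1 & _ & P3 & _).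
  apply (eq_RInt_derive (fun r => rec_Ez D Zbar V r y)); intros r _.
  - apply P1.
  - now apply (C0_slice1 (d_0 (rec_Ez D Zbar V))). }
rewrite E, (past_Ez 0), Rplus_0_l by lra.
assert (HCM : 0 <= C * M / lam).
{ apply Rdiv_le_0_compat; auto; apply Rmult_le_pos; lra. }
eapply Rle_trans; [apply (Rabs_RInt_exp_le _ (C * M / lam) lam t); auto; try lra|].
- pose proof (partials_C1 _ _ _ partials_ext_Ez) as (_ & _ & P3 & _).
  intros r; now apply (C0_slice1 (d_0 (rec_Ez D Zbar V))).
- intros r Hr; rewrite ext_d_0_Ez, Rabs_Ropp, <- sum_species_scal.
  specialize (Hvert r Hr).
  eapply Rle_trans; [apply (Rabs_sum_species_le D _
    (fun h => Rabs (4 * PI * (q D h * rec_n D V h r y))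
      * (2 * (2 * (Rabs (q D h) / (m D h * c D ^ 2)))))
    (M / lam * exp (lam * r)))|].
  + intros h Hh.
    rewrite <- !Rmult_assoc, (Rmult_assoc (4 * PI)), Rabs_mult.
    set (a := Rabs (4 * PI * (q D h * rec_n D V h r y))).
    assert (Ha : 0 <= a) by apply Rabs_pos.
    pose proof (front_s_bound h x z lam M Hh Hxz Hlam HM HE r y Hvert) as Hs.
    pose proof (front_betaz_bound h r y Hh (past_cone_front _ _ _ _ Hxz Hvert)) as Hb.
    eapply Rle_trans; [apply Rmult_le_compat_l; [exact Ha | exact Hb]|].
    eapply Rle_trans; [apply Rmult_le_compat_l; [exact Ha|];
      apply Rmult_le_compat_l; [lra | exact Hs]|].
    unfold Rdiv; right; ring.
  + fold (w r y).
    replace (C * M / lam * exp (lam * r)) with (C * (M / lam * exp (lam * r)))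
      by (field; lra).
    apply Rmult_le_compat_r.
    * apply Rmult_le_pos; [|left; apply exp_pos].
      apply Rdiv_le_0_compat; lra.
    * eapply Rle_trans; [apply Rle_abs | now apply Hw].
- apply Rmult_le_compat_r; [left; apply exp_pos|].
  apply Rmult_le_reg_r with (lam * lam); [nra|].
  replace (C * M / lam / lam * (lam * lam)) with (C * M) by (field; lra).
  assert (0 <= C * M) by (apply Rmult_le_pos; lra).
  unfold lam; nra.
Qed.

Lemma ext_s_front h x z : species D h -> x <= z -> us V h x z = 1.
Proof.
intros Hh Hxz; destruct (Rle_lt_dec x 0) as [Hx|Hx]; [now apply past_s|].
(* With [E^z] already zero the bound is available for [M = 0], and any positive [lam] will do. *)
assert (H : Rabs (us V h x z - 1)
  <= 2 * (Rabs (q D h) / (m D h * c D ^ 2)) * 0 / 1 * exp (1 * x)).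
{ apply (front_s_bound h x z 1 0); auto; try lra.
  - intros t y Hp; rewrite ext_Ez_front by (now apply (past_cone_front x z)).
    rewrite Rabs_R0; lra.
  - apply past_cone_apex; lra. }
replace (2 * (Rabs (q D h) / (m D h * c D ^ 2)) * 0 / 1 * exp (1 * x)) with 0 in H
  by (unfold Rdiv; ring).
pose proof (Rabs_pos (us V h x z - 1)).
assert (E : Rabs (us V h x z - 1) = 0) by lra.
destruct (Req_dec (us V h x z - 1) 0) as [|Hn]; [lra|].
apply Rabs_no_R0 in Hn; lra.
Qed.

Lemma ext_betaz_front h x z : species D h -> x <= z -> rec_betaz D V h x z = 0.
Proof.
intros Hh Hxz; unfold rec_betaz.
rewrite rec_up2_front, ext_s_front by auto; field.
Qed.

Lemma ext_Zl_ahead h x z : species D h -> 0 <= z -> x <= z -> uZl V h x z = z.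
Proof.
intros Hh Hz Hxz.
assert (E : uzl V h x z = z).
{ apply (at_rest_before_front (rec_betaz D V h) (fun t => uzl V h t z)); auto.
  - intros; now apply ext_motion_z.
  - intros t y; apply (abs_lt_1_of_sq (sqnorm (betap F h) t y)).
    + apply sqnorm_nonneg.
    + apply (rec_subluminal h Hh).
  - intros; now apply ext_betaz_front.
  - now apply ext_zl_0. }
rewrite <- E at 1; now apply ext_Zl_zl.
Qed.

Lemma ext_n_front h x z : species D h -> x <= z -> rec_n D V h x z = n0 D h z.
Proof.
intros Hh Hxz; pose proof HD as (_ & _ & _ & _ & Hneg & _).
unfold rec_n; destruct (Rlt_le_dec z 0) as [Hz|Hz].
{ rewrite !Hneg; auto; [ring|]; apply ext_Zl_neg; auto; lra. }
rewrite ext_Zl_ahead by auto.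
assert (E : d_z (uZl V h) x z = 1); [|rewrite E; ring].
(* If [x = z], the identity [Z_h = z] is known on one side only; the derivative is computed further
   ahead and brought back by continuity. *)
assert (Hgt : forall y, z < y -> d_z (uZl V h) x y = 1).
{ intros y Hy; apply is_derive_unique.
  apply (is_derive_ext_loc (fun y => y)); [|apply (is_derive_id y)].
  generalize (locally_lt z y Hy); apply filter_imp; intros r Hr.
  symmetry; apply ext_Zl_ahead; auto; lra. }
apply (continuous_eq_right (d_z (uZl V h) x) (fun _ => 1)); auto.
- pose proof (partials_C1 _ _ _ (ext_partials_Zl h Hh)) as (_ & _ & _ & H).
  now apply C0_slice2.
- apply continuous_const.
Qed.

(** * The reconstructed fields as a plasma solution *)

Lemma plasma_solution_reconstruction : plasma_solution D F.
Proof.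
split; [|split; [|split; [|split; [|split; [|split; [|split]]]]]].
- split; [|split].
  + apply ext_C2_A.
  + exact (partials_C1 _ _ _ partials_ext_Ez).
  + intros h Hh; split; [|split; [|split]].
    * now apply C0_rec_n.
    * intros i; now apply C1_rec_betap.
    * now apply C1_rec_betaz.
    * now apply C1_ext_zl.
- intros h Hh; split; [|split; [|split]].
  + now apply rec_subluminal.
  + now apply ext_zl_increasing.
  + now apply ext_Zl_zl.
  + now apply ext_zl_Zl.
- intros x z; split; [|split].
  + apply ext_d_z_Ez.
  + apply ext_d_0_Ez.
  + intros i; pose proof (ext_dalembertian i x z) as E.
    unfold dalembertian, wave_source in E.
    change (d_0 (d_0 (uA V i)) x z - d_z (d_z (uA V i)) x z
      - 4 * PI * sum_species D
          (fun j => q D j * rec_n D V j x z * rec_betap D V j i x z) = 0); lra.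
- intros h Hh x z; now apply lorentz_reconstruction.
- intros h Hh x Z; unfold tilde.
  change (rec_n D V h x (uzl V h x Z) * d_z (uzl V h) x Z = n0 D h Z).
  rewrite rec_n_jacobian, ext_Zl_zl by auto.
  pose proof (ext_jacobian_pos h Hh x Z); field; lra.
- intros h Hh; split.
  + intros x Z; now apply ext_motion_z.
  + intros i x X Z.
    change (is_derive (fun t => X i
      + RInt (fun r => rec_betap D V h i r (uzl V h r Z)) 0 t) x
      (rec_betap D V h i x (uzl V h x Z))).
    rewrite <- (Rplus_0_l (rec_betap D V h i x (uzl V h x Z))).
    apply (is_derive_plus (K := R_AbsRing) (fun _ => X i)
      (fun t => RInt (fun r => rec_betap D V h i r (uzl V h r Z)) 0 t)).
    * apply (is_derive_const (X i)).
    * apply (is_derive_RInt_cont (fun r => rec_betap D V h i r (uzl V h r Z))).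
      intros y; apply (C0_slice1 (tilde (uzl V h) (rec_betap D V h i))).
      apply C0_tilde; [now apply C0_ext_zl | now apply C1_C0, C1_rec_betap].
- intros x z Hxz; split; [|split].
  + intros i; now apply ext_A_front.
  + now apply ext_Ez_front.
  + intros h Hh; split; [|split].
    * intros i; unfold F; rewrite (up_reconstruction h Hh).
      now apply rec_up_front.
    * unfold F; rewrite (uz_reconstruction h Hh).
      unfold rec_uz; fold V; rewrite rec_up2_front, ext_s_front by auto; field.
    * now apply ext_n_front.
- split.
  + intros i x z; apply ext_free.
  + intros h Hh; split; [|split; [|split]].
    * intros Z; destruct (Rlt_le_dec Z 0) as [HZ|HZ]; [|now apply ext_n_front].
      change (rec_n D V h 0 Z = n0 D h Z); unfold rec_n.
      pose proof HD as (_ & _ & _ & _ & Hneg & _).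
      rewrite !Hneg; auto; [ring|]; apply ext_Zl_neg; auto; lra.
    * now apply ext_zl_0.
    * intros i X Z; simpl xp; rewrite RInt_point; apply Rplus_0_r.
    * intros Z; unfold tilde, F; rewrite (s_reconstruction h Hh).
      apply past_s; auto; lra.
Qed.

Lemma recovered_reconstruction x0 : 0 <= x0 -> recovered_at D Zbar U F x0.
Proof.
intros Hx; split; [|split].
- reflexivity.
- intros z; now apply future_Ez.
- intros h Hh; split.
  + intros z; unfold F.
    rewrite (s_reconstruction h Hh), (up_reconstruction h Hh),
      (gamma_reconstruction h Hh), (uz_reconstruction h Hh); fold V.
    split; [now apply future_s|]; split; [now apply ext_s_pos|].
    split; [now apply future_zl|]; split; [now apply future_Zl|].
    split; [reflexivity|]; split; [now apply future_n|].
    split; [now apply future_gamma|]; split; [now apply future_uz|].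
    split; [intros i; now apply future_betap | now apply future_betaz].
  + intros i X Z.
    change (X i + RInt (fun t => rec_betap D V h i t (uzl V h t Z)) 0 x0
            = X i + RInt (fun t => rec_betap D U h i t (uzl U h t Z)) 0 x0).
    f_equal; apply RInt_ext; rewrite Rmin_left by auto; intros t Ht.
    rewrite future_zl, future_betap by lra; reflexivity.
Qed.

End Extension.

Theorem mainTheorem4 (D : plasma_data) (HD : admissible D) (Zbar : R) :
  (forall F : fields, plasma_solution D F ->
     integral_solution D Zbar (unknowns_of F) /\
     (forall x0, recovered_at D Zbar (unknowns_of F) F x0)) /\
  (forall U : unknowns, integral_solution D Zbar U ->
     exists F : fields, plasma_solution D F /\
       (forall x0, 0 <= x0 -> recovered_at D Zbar U F x0)).
Proof.
split.
- intros F HF; split.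
  + now apply integral_solution_of_plasma_solution.
  + now apply recovered_of_plasma_solution.
- intros U HU.
  (* The continuity of [alpha] is read off [uA U], which every extension leaves unchanged, so the
     identity can stand in for the inverse under construction. *)
  set (inv := fun h v => proj1_sig (phase_surj D h
    (continuous_alpha D Zbar U (fun _ v => v) HU) (alpha_neg D HD) v)).
  assert (Hinv : forall h v, phase D h (inv h v) = v).
  { intros h v; exact (proj2_sig (phase_surj D h _ _ v)). }
  exists (reconstruction D Zbar (extension D inv U)); split.
  + now apply plasma_solution_reconstruction.
  + intros x0 Hx; now apply recovered_reconstruction.
Qed.
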